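(* Fix $\alpha\in(0,1)$, $\theta\in[-1,1]$, and $\mu\in\mathcal{M}$. The following assertions are equivalent: (1) $\mu\in\mathcal{C}_{\alpha,\theta}$; (2) there exists $f\in\mathcal{R}_{-\alpha-1}$ such that $$G_\mu(iy)-\frac{1}{iy}=\left(i-\theta\tan\frac{\pi\alpha}{2}\right)f(y)(1+o(1))\quad\text{as }y\to\infty;$$ (3) there exists $g\in\mathcal{R}_{1-\alpha}$ such that $$\phi_\mu(iy)=-\left(i-\theta\tan\frac{\pi\alpha}{2}\right)g(y)(1+o(1))\quad\text{as }y\to\infty.$$
   Context: $\mathcal{M}$ is the set of Borel probability measures on $\mathbf{R}$. $\mathcal{R}_\rho$ is the class of regularly varying functions of index $\rho$: positive Borel functions $r$ defined in a neighborhood of $+\infty$ of the form $r(y)=y^\rho\ell(y)$ with $\ell$ slowly varying, i.e. $\lim_{x\to\infty}\ell(tx)/\ell(x)=1$ for all $t>0$. For $\alpha\in(0,2)$ and $\theta\in[-1,1]$, $\mathcal{C}_{\alpha,\theta}$ is the set of $\mu\in\mathcal{M}$ such that (a) $y\mapsto\int_{-y}^{y}t^2\,d\mu(t)$ varies regularly with index $2-\alpha$, and (b) $\lim_{t\to\infty}\frac{\mu((t,\infty))-\mu((-\infty,-t))}{\mu((t,\infty))+\mu((-\infty,-t))}=\theta$. For $\mu\in\mathcal{M}$ let $G_\mu(z)=\int_{-\infty}^\infty\frac{1}{z-t}\,d\mu(t)$ and $F_\mu=1/G_\mu$ on $\mathbf{C}^+=\{\Im z>0\}$. For every $\eta>0$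 there is $M>0$ such that $F_\mu$ has an analytic inverse $F_\mu^{-1}$ on $\Gamma_{\eta,M}=\{x+iy:y>M,|x|<\eta y\}$ with values in $\mathbf{C}^+$ ($F_\mu(F_\mu^{-1}(z))=z$, $F_\mu^{-1}(z)/z\to1$ as $z\to\infty$). The Voiculescu transform is $\phi_\mu(z)=F_\mu^{-1}(z)-z$. The terms $o(1)$ are complex-valued. *)

(* Defs.v *)
From HB Require Import structures.
From mathcomp Require Import all_boot all_order all_algebra.
From mathcomp Require Export complex.
From mathcomp Require Import all_classical all_reals all_analysis.
Set Implicit Arguments.
Unset Strict Implicit.
Unset Printing Implicit Defensive.
Import Order.TTheory GRing.Theory Num.Theory.
Import numFieldNormedType.Exports.
Local Open Scope classical_set_scope.
Local Open Scope ring_scope.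
Local Open Scope complex_scope.

(* Functions defined only in a neighborhood of +oo are represented by total
   functions; what they do outside `]A, +oo[ is irrelevant. *)
Definition positive_borel_near_pinfty (R : realType) (r : R -> R) : Prop :=
  exists A : R, measurable_fun `]A, +oo[ r /\ (forall y, A < y -> 0 < r y).

Definition slowly_varying (R : realType) (l : R -> R) : Prop :=
  positive_borel_near_pinfty l /\
  forall t : R, 0 < t -> l (t * x) / l x @[x --> +oo] --> (1 : R).

Definition regularly_varying (R : realType) (rho : R) (r : R -> R) : Prop :=
  positive_borel_near_pinfty r /\
  exists2 l : R -> R, slowly_varying l &
    \forall y \near +oo, r y = y `^ rho * l y.

Definition truncated_second_moment (R : realType)
    (mu : probability (measurableTypeR R) R) (y : R) : R :=
  \int[mu]_(t in `[- y, y]) (t ^+ 2).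

Definition tail_balance (R : realType)
    (mu : probability (measurableTypeR R) R) (t : R) : R :=
  let p := fine (mu `]t, +oo[%classic) in
  let m := fine (mu `]-oo, - t[%classic) in
  (p - m) / (p + m).

Definition class_C (R : realType) (alpha theta : R)
    (mu : probability (measurableTypeR R) R) : Prop :=
  regularly_varying (2 - alpha) (truncated_second_moment mu) /\
  tail_balance mu t @[t --> +oo] --> theta.

Definition upper_half_plane (R : realType) : set R[i] :=
  [set z | 0 < complex.Im z].

Definition Gamma_cone (R : realType) (eta M : R) : set R[i] :=
  [set z | M < complex.Im z /\ `|complex.Re z| < eta * complex.Im z].

(* The integral of 1 / (z - t), taken componentwise; the integrand is bounded
   when z is in the upper half-plane. *)
Definition cauchy_transform (R : realType)
    (mu : probability (measurableTypeR R) R) (z : R[i]) : R[i] :=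
  (\int[mu]_t complex.Re ((z - t%:C)^-1)) +i*
  (\int[mu]_t complex.Im ((z - t%:C)^-1)).

Definition F_transform (R : realType)
    (mu : probability (measurableTypeR R) R) (z : R[i]) : R[i] :=
  (cauchy_transform mu z)^-1.

(* Complex differentiability at every point of the (open) set D: the difference
   quotients are taken with complex increments. *)
Definition analytic_on (R : realType) (D : set R[i]) (f : R[i] -> R[i]) : Prop :=
  forall z, D z -> derivable (f : (R[i])^o -> (R[i])^o) z 1.

Definition is_F_inverse_on (R : realType)
    (mu : probability (measurableTypeR R) R) (D : set R[i])
    (H : R[i] -> R[i]) : Prop :=
  [/\ analytic_on D H,
      (forall z, D z -> upper_half_plane (H z)),
      (forall z, D z -> F_transform mu (H z) = z) &
      forall e : R, 0 < e -> exists N : R, forall z, D z ->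
        N%:C < `|z| -> `|H z / z - 1| < e%:C].

(* One function serves all cones at once: two inverses on two cones agree on the
   common part of the cones far enough from 0. *)
Definition is_F_inverse (R : realType)
    (mu : probability (measurableTypeR R) R) (H : R[i] -> R[i]) : Prop :=
  forall eta : R, 0 < eta ->
    exists2 M : R, 0 < M & is_F_inverse_on mu (Gamma_cone eta M) H.

(* F_inverse mu is a chosen function with this property. Such functions exist for
   every mu, and on each cone any two of them agree far enough from 0, so the
   choice does not affect the behaviour of F_inverse mu (i y) as y tends to +oo.
   The default value id is never used. *)
Definition F_inverse (R : realType)
    (mu : probability (measurableTypeR R) R) : R[i] -> R[i] :=
  xget (id : R[i] -> R[i]) [set H : R[i] -> R[i] | is_F_inverse mu H].

Definition voiculescu_transform (R : realType)
    (mu : probability (measurableTypeR R) R) (z : R[i]) : R[i] :=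
  F_inverse mu z - z.

(* u y = c * v y * (1 + o(1)) as y -> +oo, the term o(1) being complex-valued. *)
Definition asymptotic_pinfty (R : realType) (u : R -> R[i]) (c : R[i])
    (v : R -> R) : Prop :=
  exists2 eps : R -> R[i],
    (eps : R -> (R[i])^o) y @[y --> +oo] --> (0 : (R[i])^o) &
    \forall y \near +oo, u y = c * (v y)%:C * (1 + eps y).

(* Main.v *)
Require Import Defs.
From HB Require Import structures.
From mathcomp Require Import all_boot all_order all_algebra.
From mathcomp Require Import complex.
From mathcomp Require Import all_classical all_reals all_analysis.
From mathcomp Require Import measurable_realfun ring lra.
Import Order.TTheory GRing.Theory Num.Theory.
Import numFieldNormedType.Exports.
Local Open Scope classical_set_scope.
Local Open Scope ring_scope.
Local Open Scope complex_scope.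

(** Writing U for the truncated second moment, A y for the mean of t^2 / (t^2 + y^2) and
    B y for that of y t / (t^2 + y^2), one has G(iy) - 1/(iy) = (i A y - B y) / y. So the
    expansion of the Cauchy transform says that A varies regularly with index - alpha and
    that B / A tends to theta tan (pi alpha / 2).

    To compare A and B with the tails of mu, the measures mu (y dt) are normalized by a gauge
    V of index - alpha: V y = U y / y^2 when the tails are known, V = A when the transforms
    are. In both cases y^2 V y is monotone and dominates U, which by summation over dyadic
    shells ([moment1_gauge], [tail_gauge]) makes the normalized measures tight against
    min (|t|, 1); alpha < 1 is what keeps |t| under control at 0. Convergence of integrals
    is then a closure property. Starting from t^2 on annuli it reaches all continuous test
    functions through step functions ([step_annulus]); starting from the resolvents
    1 / (t^2 + l^2) it does so through polynomials in 1 / (1 + t^2) ([tauberian_annulus]).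
    The balance theta of the tails is the statement that the integrals against the weight
    sgn t - theta vanish in the limit, and this passes through the same closure arguments.

    The constant tan (pi alpha / 2) comes without computing an integral. The limit
    functional L is homogeneous of degree - alpha, since V varies regularly. By the
    Cauchy-Riemann equations in w for |t| / (|t| + w), the value K of L at w = e^(ix)
    satisfies K' = - i alpha K, whence
    L (|t| / (t^2 + 1)) = tan (pi alpha / 2) L (t^2 / (t^2 + 1)) ([homogeneous_ratio]).

    For the Voiculescu transform, E z = F z - z is compared at iy and at w = F^-1(iy), where
    phi(iy) = - E w. The increments of E are covariances of normalized resolvents, so that
    |E z - E w| <= |z - w| (Im E z / Im z + Im E w / Im w), a form of the Schwarz-Pick
    inequality ([F_schwarz_pick]). As w / (iy) tends to 1, the expansions of E along w and
    along iy are equivalent, and y^2 (G(iy) - 1/(iy)) = E(iy) (iy G(iy)) with iy G(iy)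
    tending to 1. The inverse of F is built by iterating the contraction w |-> z - E w in a
    disc about z; its derivative comes from the same covariance formula
    ([local_inverse_is_F_inverse]). *)

Set Implicit Arguments.
Unset Strict Implicit.
Unset Printing Implicit Defensive.

Local Notation "'\1[' P ]" := ((P%R : bool)%:R) (at level 0, P at level 200).
Local Notation nrm := ComplexField.Normc.normc.

(** * Means of bounded measurable functions *)

Section expectation.
Variables (R : realType) (mu : probability (measurableTypeR R) R).

(** Since [mu] has mass 1, bounded measurable integrands always have finite integrals. *)
Definition bmeas (h : R -> R) : Prop :=
  measurable_fun [set: R] h /\ exists C, forall t, `|h t| <= C.

Lemma bmeas_integrable h : bmeas h -> mu.-integrable setT (EFin \o h).
Proof.
move=> [mh [C hC]]; apply: (@le_integrable _ _ _ _ _ _ _ (EFin \o cst C)) => //.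
- exact/measurable_EFinP.
- by move=> x _ /=; rewrite lee_fin (le_trans (hC x)) // ler_norm.
- by apply: finite_measure_integrable_cst.
Qed.

Lemma bmeas_cst c : bmeas (cst c).
Proof. by split; [exact: measurable_cst | exists `|c|]. Qed.

Lemma bmeasD f g : bmeas f -> bmeas g -> bmeas (fun t => f t + g t).
Proof.
move=> [mf [C fC]] [mg [D gD]]; split; first exact: measurable_funD.
by exists (C + D) => t; rewrite (le_trans (ler_normD _ _))// lerD.
Qed.

Lemma bmeasM f g : bmeas f -> bmeas g -> bmeas (fun t => f t * g t).
Proof.
move=> [mf [C fC]] [mg [D gD]]; split; first exact: measurable_funM.
by exists (C * D) => t; rewrite normrM ler_pM.
Qed.

Lemma bmeasN f : bmeas f -> bmeas (fun t => - f t).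
Proof.
move=> bf; rewrite (_ : (fun _ => _) = (fun t => -1 * f t)); last first.
  by apply/funext => t; rewrite mulN1r.
exact: bmeasM (bmeas_cst _) bf.
Qed.

Lemma bmeasB f g : bmeas f -> bmeas g -> bmeas (fun t => f t - g t).
Proof. by move=> bf bg; apply: bmeasD => //; exact: bmeasN. Qed.

Lemma bmeas_norm f : bmeas f -> bmeas (fun t => `|f t|).
Proof.
move=> [mf [C fC]]; split; first exact: measurableT_comp.
by exists C => t; rewrite normr_id.
Qed.

Definition mean (h : R -> R) : R := \int[mu]_t h t.
Local Notation E := mean.

Lemma meanD f g : bmeas f -> bmeas g -> E (fun t => f t + g t) = E f + E g.
Proof. by move=> bf bg; apply: RintegralD => //; exact: bmeas_integrable. Qed.

Lemma meanB f g : bmeas f -> bmeas g -> E (fun t => f t - g t) = E f - E g.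
Proof. by move=> bf bg; apply: RintegralB => //; exact: bmeas_integrable. Qed.

Lemma meanZ c f : bmeas f -> E (fun t => c * f t) = c * E f.
Proof. by move=> bf; apply: RintegralZl => //; exact: bmeas_integrable. Qed.

Lemma mean_le f g : bmeas f -> bmeas g -> (forall t, f t <= g t) -> E f <= E g.
Proof. by move=> bf bg fg; apply: le_Rintegral => //; exact: bmeas_integrable. Qed.

Lemma norm_mean_le f : bmeas f -> `|E f| <= E (fun t => `|f t|).
Proof. by move=> bf; apply: le_normr_Rintegral => //; exact: bmeas_integrable. Qed.

Lemma mean_cst c : E (fun=> c) = c.
Proof.
rewrite /mean Rintegral_cst //; transitivity (c * fine (1%E : \bar R)).
  by congr (_ * fine _); exact: probability_setT.
by rewrite mulr1. Qed.

Lemma mean_indic (A : set R) : measurable A -> E (\1_A : R -> R) = fine (mu A).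
Proof. by move=> mA; rewrite /mean /Rintegral integral_indic // setIT. Qed.

End expectation.

(** * Polynomial approximation *)

Section uniform_approximation.
Variable R : realType.

Lemma heine (f : R -> R) (a b eps : R) : continuous f -> 0 < eps ->
  exists2 d, 0 < d & forall x y, a <= x <= b -> `|x - y| < d -> `|f x - f y| <= eps.
Proof.
move=> cf e0.
have /compact_near_coveringP/(_ R (0 : R)^'+ (fun d x => forall y, `|x - y| < d ->
    `|f x - f y| <= eps)) : compact (`[a, b]%classic : set R) := @segment_compact _ a b.
case=> [x xab|d /= d0 h].
  have /cvgrPdist_lt /(_ (eps / 2)) := cf x.
  rewrite divr_gt0// => /(_ isT) [d /= d0 hd].
  exists (ball x (d / 2), [set e | e < d / 2]) => /=.
    split; first by apply: nbhsx_ballx; rewrite divr_gt0.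
    by apply: nbhs_right_lt; rewrite divr_gt0.
  case=> x' e /= [xx' ed] y x'y; rewrite -ball_normE /= in xx'.
  have h1 : `|f x - f x'| < eps / 2 by apply: hd => /=; lra.
  have h2 : `|f x - f y| < eps / 2.
    apply: hd => /=; rewrite (_ : x - y = (x - x') + (x' - y)); last by ring.
    by rewrite (le_lt_trans (ler_normD _ _))//; lra.
  rewrite (_ : f x' - f y = (f x - f y) - (f x - f x')); last by ring.
  by rewrite (le_trans (ler_normB _ _))//; lra.
have dd : `|0 - d / 2| < d by rewrite sub0r normrN ger0_norm; lra.
exists (d / 2); first by rewrite divr_gt0.
move=> x y xab xy; apply: (h (d / 2) dd _ x) => //=; first by rewrite divr_gt0.
Qed.

(** The expectation of [phi] under the binomial law of parameters [n] and 'X; the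
   recursion conditions on the last trial, so the moments follow by induction. *)
Fixpoint bernstein (n : nat) (phi : nat -> R) : {poly R} :=
  if n is m.+1 then 'X * bernstein m (fun k => phi k.+1) + (1 - 'X) * bernstein m phi
  else (phi 0%N)%:P.

Lemma bernsteinS n phi x : (bernstein n.+1 phi).[x] =
  x * (bernstein n (fun k => phi k.+1)).[x] + (1 - x) * (bernstein n phi).[x].
Proof. by rewrite /= hornerD !hornerM !hornerE. Qed.

Lemma bernstein_lin n phi psi a b x :
  (bernstein n (fun k => a * phi k + b * psi k)).[x] =
  a * (bernstein n phi).[x] + b * (bernstein n psi).[x].
Proof.
elim: n phi psi => [|n IH] phi psi; first by rewrite !hornerE.
by rewrite !bernsteinS !IH; ring.
Qed.

Lemma bernstein_le n phi psi x : 0 <= x <= 1 ->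
  (forall k, (k <= n)%N -> phi k <= psi k) ->
  (bernstein n phi).[x] <= (bernstein n psi).[x].
Proof.
move=> /andP[x0 x1]; elim: n phi psi => [|n IH] phi psi h; first by rewrite !hornerE h.
rewrite !bernsteinS lerD// ler_wpM2l// ?subr_ge0//.
  by apply: IH => k kn; apply: h.
by apply: IH => k kn; apply: h; rewrite (leq_trans kn).
Qed.

Lemma bernstein_cst n c x : (bernstein n (fun=> c)).[x] = c.
Proof. by elim: n => [|n IH]; [rewrite !hornerE | rewrite bernsteinS IH; ring]. Qed.

Lemma bernstein_id n x : (bernstein n (fun k => k%:R)).[x] = n%:R * x.
Proof.
elim: n => [|n IH]; first by rewrite /= hornerC mul0r.
rewrite bernsteinS IH.
rewrite (_ : (fun k => k.+1%:R) = (fun k => 1 * k%:R + 1 * (fun=> 1) k)); last first.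
  by apply/funext => k; rewrite -natr1; ring.
by rewrite bernstein_lin IH bernstein_cst -natr1; ring.
Qed.

Lemma bernstein_sq n x :
  (bernstein n (fun k => k%:R ^+ 2)).[x] = n%:R * x * (1 - x) + (n%:R * x) ^+ 2.
Proof.
elim: n => [|n IH]; first by rewrite /= hornerC; ring.
rewrite bernsteinS IH.
rewrite (_ : (fun k => k.+1%:R ^+ 2) =
   (fun k => 1 * k%:R ^+ 2 + 1 * (2 * k%:R + 1 * (fun=> 1) k))); last first.
  by apply/funext => k; rewrite -natr1; ring.
by rewrite !bernstein_lin IH bernstein_id bernstein_cst -natr1; ring.
Qed.

(** Chebyshev's inequality for the binomial law: the square of k/n - x has mean
   x (1 - x) / n, so the values of g far from x contribute at most a multiple of 1/n. *)
Lemma weierstrass (g : R -> R) (eps : R) : continuous g -> 0 < eps ->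
  exists p : {poly R}, forall x, 0 <= x <= 1 -> `|p.[x] - g x| <= eps.
Proof.
move=> cg e0.
have [d d0 hd] := heine 0 1 cg (divr_gt0 e0 (ltr0Sn R 1)).
have [M M0 hM] : exists2 M, 0 < M & forall x, 0 <= x <= 1 -> `|g x| <= M.
  have cn : {within `[0, 1], continuous (fun x => `|g x|)}.
    by apply: continuous_subspaceT => x; apply: cvg_norm; exact: cg.
  have [c _ hc] := EVT_max ler01 cn.
  exists (`|g c| + 1) => [|x x01]; first by rewrite ltr_wpDl.
  by rewrite (le_trans (hc x _))// ?lerDl// in_itv.
(* Where |k/n - x| >= d the increment of g is at most 2 M <= C (k/n - x)^2. *)
pose C := 2 * M / d ^+ 2.
have C0 : 0 < C by rewrite !divr_gt0// ?mulr_gt0// exprn_gt0.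
have [n nC] : exists n : nat, C / (eps / 2) < n.+1%:R.
  exists (Num.bound (C / (eps / 2))).
  apply: lt_trans (archi_boundP _) _; last by rewrite ltr_nat.
  by apply: divr_ge0; [exact: ltW | lra].
set N := n.+1 in nC.
have N0 : 0 < N%:R :> R by rewrite ltr0n.
exists (bernstein N (fun k => g (k%:R / N%:R))) => x x01.
have key k : (k <= N)%N ->
    `|g (k%:R / N%:R) - g x| <= eps / 2 + C * (k%:R / N%:R - x) ^+ 2.
  move=> kN.
  have k01 : 0 <= (k%:R / N%:R : R) <= 1.
    by rewrite divr_ge0//= ler_pdivrMr// mul1r ler_nat.
  have [near|far] := ltP `|x - k%:R / N%:R| d.
    rewrite distrC (le_trans (hd _ _ x01 near))// lerDl.
    by rewrite mulr_ge0// ?sqr_ge0// ltW.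
  have : `|g (k%:R / N%:R) - g x| <= 2 * M.
    by rewrite (le_trans (ler_normB _ _))//; have := hM _ x01; have := hM _ k01; lra.
  move=> /le_trans; apply; rewrite (@le_trans _ _ (C * d ^+ 2))//.
    by rewrite /C divfK// lt0r_neq0// exprn_gt0.
  rewrite (@le_trans _ _ (C * (k%:R / N%:R - x) ^+ 2))//; last by rewrite lerDr; lra.
  rewrite ler_pM2l// -[leRHS]real_normK ?num_real// -distrC.
  by rewrite lerXn2r// ?nnegrE ?normr_ge0// ltW.
have var : (bernstein N (fun k => (eps / 2) + C * (k%:R / N%:R - x) ^+ 2)).[x] =
    eps / 2 + C * (x * (1 - x) / N%:R).
  rewrite (_ : (fun k => _) = (fun k => (C / N%:R ^+ 2) * k%:R ^+ 2 +
     1 * (((- 2) * C * x / N%:R) * k%:R + (C * x ^+ 2 + eps / 2) * (fun=> 1) k))); last first.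
    by apply/funext => k; field; rewrite lt0r_neq0.
  rewrite !bernstein_lin bernstein_sq bernstein_id bernstein_cst.
  by field; rewrite lt0r_neq0.
have small : C * (x * (1 - x) / N%:R) <= eps / 2.
  rewrite mulrA ler_pdivrMr// (@le_trans _ _ C)//.
    by rewrite ger_pMr//; nra.
  by move: nC; rewrite ltr_pdivrMr; [rewrite mulrC; exact: ltW | lra].
have split_ : (bernstein N (fun k => g (k%:R / N%:R))).[x] - g x =
    (bernstein N (fun k => 1 * g (k%:R / N%:R) + (- g x) * (fun=> 1) k)).[x].
  by rewrite bernstein_lin bernstein_cst; ring.
rewrite split_ ler_norml; apply/andP; split.
  rewrite -(@opprK _ (bernstein _ _).[x]) lerN2.
  have -> : - (bernstein N (fun k => 1 * g (k%:R / N%:R) + (- g x) * (fun=> 1) k)).[x] =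
    (bernstein N (fun k => (-1) * g (k%:R / N%:R) + (g x) * (fun=> 1) k)).[x].
    by rewrite !bernstein_lin; ring.
  apply: (le_trans (bernstein_le x01 (psi := fun k => (eps / 2) + C * (k%:R / N%:R - x) ^+ 2) _)).
    move=> k kN; apply: le_trans (key k kN).
    by rewrite -normrN; apply: le_trans (ler_norm _); rewrite le_eqVlt; apply/orP; left; apply/eqP; ring.
  by rewrite var; lra.
apply: (le_trans (bernstein_le x01 (psi := fun k => (eps / 2) + C * (k%:R / N%:R - x) ^+ 2) _)).
  move=> k kN; apply: le_trans (key k kN).
  by apply: le_trans (ler_norm _); rewrite le_eqVlt; apply/orP; left; apply/eqP; ring.
by rewrite var; lra.
Qed.

End uniform_approximation.

(** * Indicators and truncations *)

Section measurability.
Variable R : realType.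
Implicit Types (f g h : R -> R).

Lemma measurable_bool_real (b : R -> bool) : measurable_fun [set: R] b ->
  measurable_fun [set: R] (fun t => (b t)%:R : R).
Proof.
move=> mb; apply: (@measurableT_comp _ _ _ _ _ _ (fun c : bool => c%:R : R)) => //.
Qed.

Lemma bmeas_bool (b : R -> bool) : measurable_fun [set: R] b ->
  bmeas (fun t => (b t)%:R : R).
Proof.
move=> /measurable_bool_real mb; split => //; exists 1 => t.
by case: (b t); rewrite /= ?normr1 ?normr0.
Qed.

Lemma bmeas_continuous f C : continuous f -> (forall t, `|f t| <= C) -> bmeas f.
Proof.
by move=> cf fC; split; [exact: continuous_measurable_fun | exists C].
Qed.

Lemma bmeas_le f g : measurable_fun [set: R] f -> measurable_fun [set: R] g ->
  bmeas (fun t => \1[f t <= g t] : R).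
Proof. by move=> mf mg; apply: bmeas_bool; exact: measurable_fun_ler. Qed.

Lemma bmeas_lt f g : measurable_fun [set: R] f -> measurable_fun [set: R] g ->
  bmeas (fun t => \1[f t < g t] : R).
Proof. by move=> mf mg; apply: bmeas_bool; exact: measurable_fun_ltr. Qed.

Lemma measurable_absval : measurable_fun [set: R] (fun t : R => `|t|).
Proof. exact: measurableT_comp. Qed.

Lemma bmeas_norm_le x : bmeas (fun t : R => \1[`|t| <= x] : R).
Proof. by apply: bmeas_le => //; exact: measurable_absval. Qed.

Lemma bmeas_norm_gt x : bmeas (fun t : R => \1[x < `|t|] : R).
Proof. by apply: bmeas_lt => //; exact: measurable_absval. Qed.

Lemma bmeas_scale f y : bmeas f -> bmeas (fun t => f (t / y)).
Proof.
move=> [mf [C fC]]; split; last by exists C => t; exact: fC.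
apply: measurableT_comp mf _; exact: measurable_funM.
Qed.

Lemma bmeas_trunc f C x : measurable_fun [set: R] f ->
  (forall t, `|t| <= x -> `|f t| <= C) -> 0 <= C -> bmeas (fun t => f t * \1[`|t| <= x]).
Proof.
move=> mf fC C0; split.
  by apply: measurable_funM => //; case: (bmeas_norm_le x).
exists C => t; case: (leP `|t| x) => tx; rewrite ?mulr1 ?mulr0 ?normr0//.
exact: fC.
Qed.

Lemma bmeas_norm_trunc x : bmeas (fun t : R => `|t| * \1[`|t| <= x]).
Proof.
apply: (@bmeas_trunc (fun t => `|t|) `|x| x) => //.
by move=> t tx; rewrite normr_id (le_trans tx)// ler_norm.
Qed.

Lemma bmeas_sq_trunc x : bmeas (fun t : R => t ^+ 2 * \1[`|t| <= x]).
Proof.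
apply: (@bmeas_trunc (fun t => t ^+ 2) (x ^+ 2) x) => [|t tx|]; last exact: sqr_ge0.
  by apply: measurable_funX.
rewrite normrX lerXn2r ?nnegrE//.
by rewrite (le_trans _ tx).
Qed.

End measurability.

(** * Limits at infinity *)

Section limits.
Variable R : realType.
Implicit Types (f g : R -> R) (b : bool).

(** Convergence at infinity, to 0 when [b] holds; carrying the flag lets the same
   approximation arguments prove existence of a limit and vanishing of a limit. *)
Definition tends b f := exists2 l : R, (b -> l = 0) & f y @[y --> +oo] --> l.

Lemma tends_near b f g : (\forall y \near +oo, f y = g y) -> tends b f -> tends b g.
Proof.
move=> fg [l bl fl]; exists l => //; apply: cvg_trans fl.
exact: near_eq_cvg.
Qed.

Lemma tends_lin b f g c d : tends b f -> tends b g ->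
  tends b (fun y => c * f y + d * g y).
Proof.
move=> [l bl fl] [m bm gm]; exists (c * l + d * m).
  by move=> bb; rewrite bl// bm// !mulr0 addr0.
by apply: cvgD; apply: cvgMr.
Qed.

Lemma tends_closure b f :
  (forall eps, 0 < eps -> exists2 g, tends b g & \forall y \near +oo, `|f y - g y| <= eps) ->
  tends b f.
Proof.
move=> fg; case: b fg => fg.
  exists 0 => //; apply/cvgrPdist_le => eps e0.
  have [|g [l /(_ isT) -> /cvgrPdist_le gl] fgl] := fg (eps / 2); first by rewrite divr_gt0.
  have {}gl := gl _ (divr_gt0 e0 (ltr0Sn _ 1)).
  near=> y; rewrite sub0r normrN (_ : f y = (f y - g y) - (0 - g y)); last by ring.
  rewrite (le_trans (ler_normB _ _))// [leRHS](splitr eps) lerD//; first by near: y.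
  by near: y.
suff /cvg_ex [l fl] : cvg (f y @[y --> +oo]) by exists l.
apply: cauchy_cvg; apply: cauchy_exP => eps e0.
have [|g [l _ /cvgrPdist_le gl] fgl] := fg (eps / 3); first by rewrite divr_gt0.
have {}gl := gl _ (divr_gt0 e0 (ltr0Sn _ 2)).
exists l; rewrite /nbhs /= -ball_normE /=.
near=> y => /=.
have h1 : `|f y - g y| <= eps / 3 by near: y.
have h2 : `|l - g y| <= eps / 3 by near: y.
rewrite (_ : l - f y = (l - g y) - (f y - g y)); last by ring.
by rewrite (le_lt_trans (ler_normB _ _))//; lra.
Unshelve. all: by end_near. Qed.

Lemma powR_small (a eps : R) : 0 < a -> 0 < eps ->
  exists2 d, 0 < d < 1 & forall x, 0 < x <= d -> x `^ a <= eps.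
Proof.
move=> a0 e0; exists (Num.min (1 / 2) (eps `^ (a^-1))).
  by rewrite lt_min powR_gt0// !divr_gt0//= gt_min; apply/orP; left; lra.
move=> x /andP[x0]; rewrite le_min => /andP[_ xe].
rewrite (_ : eps = (eps `^ (a^-1)) `^ a); last first.
  by rewrite -powRrM mulVf ?lt0r_neq0// powRr1// ltW.
by apply: ge0_ler_powR => //; rewrite ?nnegrE ?powR_ge0 ?ltW.
Qed.

End limits.

(** * Tails and truncated moments *)

Section tails.
Variables (R : realType) (mu : probability (measurableTypeR R) R).
Local Notation E := (mean mu).

Definition tail x := E (fun t => \1[x < `|t|]).
Definition moment1 x := E (fun t => `|t| * \1[`|t| <= x]).
Definition moment2 x := E (fun t => t ^+ 2 * \1[`|t| <= x]).

Lemma tail_ge0 x : 0 <= tail x.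
Proof.
rewrite -[0](mean_cst mu); apply: mean_le => [| |t]; [exact: bmeas_cst|exact: bmeas_norm_gt|].
by case: (x < `|t|).
Qed.

Lemma tail_cvg : tail n%:R @[n --> \oo] --> 0.
Proof.
pose F (n : nat) : set (measurableTypeR R) := [set t | n%:R < `|t|].
have mF n : measurable (F n).
  have := measurable_fun_ltr (measurable_cst (n%:R : R)) (@measurable_absval R).
  move=> /(_ measurableT [set true] I); rewrite setTI.
  by congr (measurable _); apply/seteqP; split => t /=.
have capF : \bigcap_n F n = set0.
  apply/seteqP; split => // t /(_ (Num.bound `|t|) I) /=.
  by have := archi_boundP (normr_ge0 t); rewrite /F /=; lra.
have h : (mu \o F) x @[x --> \oo] --> mu (\bigcap_n F n).
  apply: nonincreasing_cvg_mu => //.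
  - by apply: le_lt_trans (probability_le1 mu (mF 0%N)) _; rewrite ltry.
  - by rewrite capF.
  - move=> n m nm; apply/subsetPset => t; rewrite /F /=; apply: le_lt_trans.
    by rewrite ler_nat.
rewrite capF measure0 in h.
have h2 : (fine \o (mu \o F)) x @[x --> \oo] --> (0 : R) by exact: (@fine_cvg _ _ _ _ _ 0 h).
apply: cvg_trans h2; apply: near_eq_cvg; near=> n.
rewrite /tail /= -(mean_indic mu (mF n)); congr mean; apply/funext => t.
rewrite indicE; congr (nat_of_bool _)%:R.
by rewrite /F; apply/asboolP/idP => //=.
Unshelve. all: by end_near. Qed.

Lemma tail_small eps : 0 < eps -> exists2 K, 0 < K & forall x, K <= x -> tail x <= eps.
Proof.
move=> e0; have /cvgrPdist_le /(_ _ e0) [n _ hn] := tail_cvg.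
exists n.+1%:R => // x nx.
apply: le_trans (ler_norm _) (le_trans _ (hn n.+1 (leqnSn n))).
rewrite sub0r normrN !ger0_norm ?tail_ge0//.
apply: mean_le => [| |t]; rewrite ?ler_nat; try exact: bmeas_norm_gt.
by case: (ltP x `|t|) => // xt; case: ltP => //; lra.
Qed.

(** On x < |t| <= 2x one has 1 <= t^2 / x^2. *)
Lemma tail_double x : 0 < x -> tail x <= tail (2 * x) + moment2 (2 * x) / x ^+ 2.
Proof.
move=> x0; rewrite [moment2 _ / _]mulrC /tail /moment1 /moment2 -(meanZ mu _ (bmeas_sq_trunc _)) -meanD; last 2 first.
- exact: bmeas_norm_gt.
- by apply: bmeasM; [exact: bmeas_cst | exact: bmeas_sq_trunc].
apply: mean_le => [| |t]; first exact: bmeas_norm_gt.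
  apply: bmeasD; first exact: bmeas_norm_gt.
  by apply: bmeasM; [exact: bmeas_cst | exact: bmeas_sq_trunc].
case: (ltP (2 * x) `|t|) => /= h1; case: (ltP x `|t|) => /= h2;
  rewrite ?mulr0 ?mulr1 ?addr0 ?add0r//; try lra.
- rewrite mulrC ler_pdivlMr ?exprn_gt0// mul1r -[leRHS](real_normK (num_real t)).
  by rewrite lerXn2r// ?nnegrE ltW.
- by rewrite mulr_ge0// ?invr_ge0 sqr_ge0.
Qed.

(** On x < |t| <= 2x one has |t| <= t^2 / x. *)
Lemma moment1_double x : 0 < x -> moment1 (2 * x) <= moment1 x + moment2 (2 * x) / x.
Proof.
move=> x0; rewrite [moment2 _ / _]mulrC /tail /moment1 /moment2 -(meanZ mu _ (bmeas_sq_trunc _)) -meanD; last 2 first.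
- exact: bmeas_norm_trunc.
- by apply: bmeasM; [exact: bmeas_cst | exact: bmeas_sq_trunc].
apply: mean_le => [| |t]; first exact: bmeas_norm_trunc.
  apply: bmeasD; first exact: bmeas_norm_trunc.
  by apply: bmeasM; [exact: bmeas_cst | exact: bmeas_sq_trunc].
rewrite -(real_normK (num_real t)); set a := `|t|; have a0 : 0 <= a := normr_ge0 t.
case: (leP a x) => /= h1; case: (leP a (2 * x)) => /= h2;
  rewrite ?mulr0 ?mulr1 ?addr0 ?add0r//; try lra.
- by rewrite lerDl mulr_ge0// ?invr_ge0 ?sqr_ge0// ltW.
- by rewrite mulrC ler_pdivlMr// expr2 ler_wpM2l// ltW.
Qed.

Lemma moment1_le_id x : moment1 x <= `|x|.
Proof.
rewrite -[leRHS](mean_cst mu); apply: mean_le => [| |t]; first exact: bmeas_norm_trunc.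
  exact: bmeas_cst.
case: (leP `|t| x) => tx; rewrite ?mulr1 ?mulr0//.
by rewrite (le_trans tx)// ler_norm.
Qed.

End tails.

(** * Karamata estimates *)

Section gauges.
Variable R : realType.

Lemma powR2_gt1 (a : R) : 0 < a -> 1 < 2 `^ a.
Proof.
move=> a0; have := @gt0_ltr_powR R a a0 1 2; rewrite powR1 !nnegrE.
by apply; rewrite ?ler01 ?ler0n ?ltr1n.
Qed.

Lemma near_pinfty_ex (P : R -> Prop) :
  (\forall y \near +oo, P y) -> exists2 K, 0 < K & forall y, K <= y -> P y.
Proof.
move=> [M [_ hM]]; exists (`|M| + 1); first by rewrite ltr_wpDl.
by move=> y hy; apply: hM; apply: le_lt_trans (ler_norm _) _; lra.
Qed.

Lemma near_pinfty_scale (P : R -> Prop) l : 0 < l ->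
  (\forall y \near +oo, P y) -> \forall y \near +oo, P (l * y).
Proof.
move=> l0 [M [_ hM]]; near=> y; apply: hM; rewrite mulrC -ltr_pdivrMr//.
by near: y; apply: nbhs_pinfty_gt; rewrite num_real.
Unshelve. all: by end_near. Qed.

Lemma cvg_pinfty_scale (f : R -> R) (a l : R) : 0 < l ->
  f y @[y --> +oo] --> a -> f (l * y) @[y --> +oo] --> a.
Proof.
move=> l0 fa A /fa [M [_ hM]].
have := near_pinfty_scale l0 (nbhs_pinfty_gt (num_real M)).
by rewrite /nbhs /=; apply: filterS => y; exact: hM.
Qed.

Variables (mu : probability (measurableTypeR R) R) (alpha : R).
Hypothesis (alpha01 : 0 < alpha < 1).

(** The normalization of the rescaled measures: the truncated second moment divided by y^2
   in one direction, a Stieltjes transform in the other. Monotonicity of y^2 V y stands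
   in for the uniform convergence theorem of regular variation. *)
Definition gauge (V : R -> R) := [/\ \forall y \near +oo, 0 < V y,
  forall l, 0 < l -> V (l * y) / V y @[y --> +oo] --> l `^ (- alpha),
  forall x y, 0 < x -> x <= y -> x ^+ 2 * V x <= y ^+ 2 * V y &
  forall y, 0 < y -> moment2 mu y <= 2 * (y ^+ 2 * V y)].

Variable V : R -> R.
Hypothesis gV : gauge V.

Lemma gauge_double_lt : exists2 k, 0 < k < 1 &
  \forall y \near +oo, V (2 * y) <= k * V y.
Proof.
have [V0 VRV _ _] := gV; have /andP[a0 a1] := alpha01.
have h1 : 2 `^ (- alpha) < 1 :> R.
  by rewrite powRN invf_lt1 ?powR_gt0// powR2_gt1.
have h0 : 0 < 2 `^ (- alpha) :> R by rewrite powR_gt0.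
exists ((2 `^ (- alpha) + 1) / 2); first by apply/andP; split; lra.
have d0 : 0 < (1 - 2 `^ (- alpha)) / 2 :> R by lra.
have /cvgrPdist_le /(_ _ d0) h := VRV 2 (ltr0Sn _ 1).
near=> y.
have Vy : 0 < V y by near: y.
rewrite -ler_pdivrMr//.
have : `|2 `^ (- alpha) - V (2 * y) / V y| <= (1 - 2 `^ (- alpha)) / 2 by near: y.
by rewrite ler_norml => /andP[]; lra.
Unshelve. all: by end_near. Qed.

Lemma gauge_double_gt : exists2 k, 1 < k &
  \forall y \near +oo, k * V y <= 2 * V (2 * y).
Proof.
have [V0 VRV _ _] := gV; have /andP[a0 a1] := alpha01.
have h1 : 1 < 2 * 2 `^ (- alpha) :> R.
  rewrite -[X in X * _](powRr1) ?ler0n// -powRD; last by rewrite pnatr_eq0 implybT.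
  by apply: powR2_gt1; lra.
exists ((2 * 2 `^ (- alpha) + 1) / 2); first by lra.
have d0 : 0 < (2 * 2 `^ (- alpha) - 1) / 4 :> R by lra.
have /cvgrPdist_le /(_ _ d0) h := VRV 2 (ltr0Sn _ 1).
near=> y.
have Vy : 0 < V y by near: y.
rewrite -ler_pdivlMr// -mulrA.
have : `|2 `^ (- alpha) - V (2 * y) / V y| <= (2 * 2 `^ (- alpha) - 1) / 4 by near: y.
by rewrite ler_norml => /andP[]; lra.
Unshelve. all: by end_near. Qed.

(** Doubling x multiplies x V x by a factor at least k > 1, so the dyadic pieces of
   the first moment form a sum dominated by its last term. *)
Lemma moment1_gauge : exists2 C, 0 < C &
  \forall y \near +oo, moment1 mu y <= C * (y * V y).
Proof.
have [V0 _ Vmono VU] := gV; have [k k1 kV] := gauge_double_gt.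
have [K K0 hK] : exists2 K, 0 < K & forall y, K <= y -> 0 < V y /\ k * V y <= 2 * V (2 * y).
  by apply: near_pinfty_ex; near=> y; split; near: y.
have VK : 0 < V K by have [] := hK K (lexx _).
(* The first constant starts the induction on [K, 2K], the second absorbs one more shell. *)
pose C := Num.max (4 / V K) (4 / (1 - k^-1)).
have k0 : 0 < k by lra.
have k11 : 0 < 1 - k^-1 by rewrite subr_gt0 invf_lt1.
have C0 : 0 < C by rewrite lt_max divr_gt0.
exists C => //.
have main (n : nat) x : K <= x -> x <= 2 ^+ n.+1 * K -> moment1 mu x <= C * (x * V x).
  elim: n x => [|n IH] x Kx xn.
    have x0 : 0 < x by lra.
    apply: (le_trans (moment1_le_id mu x)); rewrite (ger0_norm (ltW x0)).
    have Vm := Vmono _ _ K0 Kx.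
    have CV : 4 / V K * (x * V x) <= C * (x * V x).
      apply: ler_wpM2r; last by rewrite le_max lexx.
      by rewrite mulr_ge0// ltW//; have [] := hK x Kx.
    apply: (le_trans _ CV); rewrite mulrAC ler_pdivlMr//.
    rewrite expr1 in xn.
    rewrite -(ler_pM2l x0) (_ : x * (4 * (x * V x)) = 4 * (x ^+ 2 * V x)); last by ring.
    apply: (@le_trans _ _ (4 * (K ^+ 2 * V K))); last by lra.
    have : x * x <= 4 * K ^+ 2 by nra.
    by move=> /(ler_wpM2r (ltW VK)); lra.
  have [small|big] := leP x (2 ^+ n.+1 * K); first exact: IH.
  have x2K : K <= x / 2.
    have : 2 * K <= 2 ^+ n.+1 * K.
      by rewrite ler_pM2r// exprS ler_peMr// exprn_ege1// ler1n.
    by lra.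
  have x2n : x / 2 <= 2 ^+ n.+1 * K by move: xn; rewrite exprS -mulrA; lra.
  have x20 : 0 < x / 2 by lra.
  have Ex : 2 * (x / 2) = x by rewrite mulrC divfK// pnatr_eq0.
  have := moment1_double mu x20; rewrite Ex => /le_trans; apply.
  have [_] := hK _ x2K; rewrite Ex => hk.
  have hU := VU x _.
  have {}hU : moment2 mu x <= 2 * (x ^+ 2 * V x) by apply: hU; lra.
  have Vx : 0 < V x by have [] := hK x (le_trans x2K _) => //; lra.
  have h1 := IH _ x2K x2n.
  have h2 : moment2 mu x / (x / 2) <= 4 * (x * V x).
    by rewrite ler_pdivrMr//; move: hU; rewrite (_ : 4 * (x * V x) * (x / 2) = 2 * (x ^+ 2 * V x)); [|field].
  have h3 : C * (x / 2 * V (x / 2)) <= C * k^-1 * (x * V x).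
    rewrite -(mulrA C) ler_pM2l// -(ler_pM2l k0).
    rewrite (_ : k * (k^-1 * (x * V x)) = x * V x); last by field; lra.
    by have := ler_wpM2l (ltW x20) hk; lra.
  have h4 : 4 <= C * (1 - k^-1) by rewrite -ler_pdivrMr// le_max lexx orbT.
  have : 4 * (x * V x) <= C * (1 - k^-1) * (x * V x).
    by apply: ler_wpM2r h4; rewrite mulr_ge0 ?ltW//; lra.
  by lra.
near=> y; have Ky : K <= y by near: y; apply: nbhs_pinfty_ge; rewrite num_real.
apply: (main (Num.bound (y / K)) y Ky).
have yK0 : 0 <= y / K by rewrite divr_ge0//; lra.
rewrite -ler_pdivrMr//; apply: ltW; apply: lt_le_trans (archi_boundP yK0) _.
by rewrite -natrX ler_nat ltnW// (leq_trans (ltn_expl _ (ltnSn 1)))// leq_exp2l.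
Unshelve. all: by end_near. Qed.

(** Beyond y the masses of the dyadic shells are dominated by a geometric series, because
   doubling multiplies V by a factor at most k < 1. *)
Lemma tail_gauge : exists2 C, 0 < C & \forall y \near +oo, tail mu y <= C * V y.
Proof.
have [V0 _ Vmono VU] := gV; have [k /andP[k0 k1] kV] := gauge_double_lt.
have [K K0 hK] : exists2 K, 0 < K & forall y, K <= y -> 0 < V y /\ V (2 * y) <= k * V y.
  by apply: near_pinfty_ex; near=> y; split; near: y.
have k10 : 0 < 1 - k by lra.
(* C = C k + 8 k: one shell, and a factor k for all those beyond it. *)
pose C := 8 * k / (1 - k).
have C0 : 0 < C by rewrite divr_gt0//; lra.
have Ck : C * k + 8 * k = C by rewrite /C; field; lra.
exists C => //.
have main (n : nat) x : K <= x -> tail mu x <= tail mu (2 ^+ n * x) + C * V x.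
  elim: n x => [|n IH] x Kx.
    by rewrite expr0 mul1r lerDl mulr_ge0 ?(ltW C0)// ltW//; have [] := hK x Kx.
  have x0 : 0 < x by lra.
  apply: (le_trans (tail_double mu x0)).
  have K2x : K <= 2 * x by lra.
  have := IH _ K2x; rewrite mulrA -exprSr.
  have hU : moment2 mu (2 * x) / x ^+ 2 <= 8 * V (2 * x).
    rewrite ler_pdivrMr ?exprn_gt0//.
    by have := VU (2 * x); rewrite exprMn => /(_ _); move=> /(_ ltac:(lra)); lra.
  have [_ hV] := hK x Kx.
  have : C * V (2 * x) <= C * (k * V x) by rewrite ler_pM2l.
  have : C * V x = C * k * V x + 8 * k * V x by rewrite -mulrDl Ck.
  by lra.
near=> y; have Ky : K <= y by near: y; apply: nbhs_pinfty_ge; rewrite num_real.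
apply/ler_addgt0Pr => e e0.
have [M M0 hM] := tail_small mu e0.
have y0 : 0 < y by lra.
have My0 : 0 <= M / y by rewrite divr_ge0// ltW.
have := main (Num.bound (M / y)) y Ky => /le_trans; apply.
rewrite addrC lerD2l; apply: hM.
rewrite -ler_pdivrMr//; apply: ltW; apply: lt_le_trans (archi_boundP My0) _.
by rewrite -natrX ler_nat ltnW// (ltn_expl _ (ltnSn 1)).
Unshelve. all: by end_near. Qed.

End gauges.

(** * Rescaled integrals *)

Section rescaled.
Variables (R : realType) (mu : probability (measurableTypeR R) R) (alpha : R).
Hypothesis (alpha01 : 0 < alpha < 1).
Variable V : R -> R.
Hypothesis gV : gauge mu alpha V.
Local Notation E := (mean mu).

(** The integral of [h] against the law of t / y, weighted by [e] and normalized by [V].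
   Convergence of these numbers is vague convergence of the rescaled measures away from 0. *)
Definition rescaled (e h : R -> R) (y : R) : R := E (fun t => e t * h (t / y)) / V y.
Local Notation S := rescaled.
Local Notation S1 := (rescaled (fun=> 1)).

(** The bound 2 covers the two weights in use, the constant 1 and sgn - theta. *)
Definition weight (e : R -> R) := bmeas e /\ forall t, `|e t| <= 2.

Lemma weight1 : weight (fun=> 1).
Proof. by split=> [|t]; [exact: bmeas_cst | rewrite normr1; lra]. Qed.

Lemma bmeas_integrand e h y : weight e -> bmeas h -> bmeas (fun t => e t * h (t / y)).
Proof. by move=> [be _] bh; apply: bmeasM => //; exact: bmeas_scale. Qed.

Lemma rescaled_lin e h1 h2 c d y : weight e -> bmeas h1 -> bmeas h2 ->
  S e (fun t => c * h1 t + d * h2 t) y = c * S e h1 y + d * S e h2 y.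
Proof.
move=> we b1 b2; have i1 := bmeas_integrand y we b1; have i2 := bmeas_integrand y we b2.
rewrite /S !mulrA -mulrDl -!meanZ// -meanD; try by apply: bmeasM => //; exact: bmeas_cst.
by congr (mean _ _ / _); apply/funext => t; ring.
Qed.

Lemma rescaled1_le h1 h2 y : 0 <= V y -> bmeas h1 -> bmeas h2 ->
  (forall t, h1 t <= h2 t) -> S1 h1 y <= S1 h2 y.
Proof.
move=> Vy b1 b2 h12; apply: ler_wpM2r; first by rewrite invr_ge0.
apply: mean_le => [| |t]; try exact: bmeas_integrand weight1 _.
by rewrite !mul1r.
Qed.

Lemma rescaled_dist e h1 h2 H y : 0 <= V y -> weight e -> bmeas h1 -> bmeas h2 -> bmeas H ->
  (forall t, `|h1 t - h2 t| <= H t) -> `|S e h1 y - S e h2 y| <= 2 * S1 H y.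
Proof.
move=> Vy we b1 b2 bH h12.
have i1 := bmeas_integrand y we b1; have i2 := bmeas_integrand y we b2.
rewrite /S -mulrBl -meanB// normrM (ger0_norm (x := (V y)^-1)) ?invr_ge0//.
rewrite mulrA; apply: ler_wpM2r; first by rewrite invr_ge0.
apply: le_trans (norm_mean_le mu (bmeasB i1 i2)) _.
have i3 := bmeas_integrand y weight1 bH.
rewrite -meanZ//; apply: mean_le => [| |t].
- exact: bmeas_norm (bmeasB i1 i2).
- by apply: bmeasM => //; exact: bmeas_cst.
- by rewrite mul1r -mulrBr normrM ler_pM//; case: we.
Qed.

Lemma rescaled_homog e h l y : V (l * y) != 0 ->
  S e (fun t => h (t / l)) y = S e h (l * y) * (V (l * y) / V y).
Proof.
move=> Vl; rewrite /S mulrA divfK//; congr (mean _ _ / _); apply/funext => t.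
by rewrite invfM mulrA mulrAC.
Qed.

(** The part of [cap] carried by the complement of the annulus d < |t| <= 1/d; errors that
   uniform approximation cannot reach are charged to it. *)
Definition outer_cap (d t : R) : R := `|t| * \1[`|t| <= d] + \1[d^-1 < `|t|].
(** As 0 < alpha < 1, the limit density |t|^(- alpha - 1) integrates |t| near 0 and 1 near
   infinity, so the rescaled measures give this function bounded mass. *)
Definition cap (t : R) : R := Num.min `|t| 1.

Lemma bmeas_outer_cap d : bmeas (outer_cap d).
Proof. by apply: bmeasD; [exact: bmeas_norm_trunc | exact: bmeas_norm_gt]. Qed.

Lemma cap_ge0 t : 0 <= cap t.
Proof. by rewrite le_min normr_ge0 ler01. Qed.

Lemma continuous_norm (T : numFieldType) : continuous (fun t : T => `|t|).
Proof. by move=> t; exact: norm_continuous. Qed.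

Lemma continuous_cap : continuous cap.
Proof. by move=> t; apply: continuous_min; [exact: continuous_norm | exact: cvg_cst]. Qed.

Lemma bmeas_cap : bmeas cap.
Proof.
apply: (@bmeas_continuous _ _ 1 continuous_cap) => t.
by rewrite ger0_norm ?cap_ge0// ge_min lexx orbT.
Qed.

Lemma rescaled_outer_cap d y : 0 < d -> 0 < y ->
  S1 (outer_cap d) y = moment1 mu (d * y) / (y * V y) + tail mu (d^-1 * y) / V y.
Proof.
move=> d0 y0.
rewrite invfM mulrA -mulrDl; congr (_ / _).
rewrite /moment1 /tail mulrC -meanZ; last exact: bmeas_norm_trunc.
rewrite -meanD; last 2 first.
- by apply: bmeasM; [exact: bmeas_cst|exact: bmeas_norm_trunc].
- exact: bmeas_norm_gt.
congr mean; apply/funext => t; rewrite mul1r /outer_cap.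
rewrite normrM normfV (gtr0_norm y0) ler_pdivrMr// ltr_pdivlMr//.
by rewrite mulrA (mulrC y^-1).
Qed.

Lemma cap_le_outer_cap t : cap t <= outer_cap 1 t.
Proof.
by rewrite /cap /outer_cap invr1; case: (leP `|t| 1) => h; rewrite ?mulr1 ?mulr0 ?addr0 ?add0r.
Qed.

Lemma rescaled_cap_bounded : exists2 M, 0 < M & \forall y \near +oo, S1 cap y <= M.
Proof.
have [C1 C10 h1] := moment1_gauge alpha01 gV.
have [C2 C20 h2] := tail_gauge alpha01 gV.
have [V0 _ _ _] := gV.
exists (C1 + C2); first exact: addr_gt0.
near=> y; have y0 : 0 < y by near: y; apply: nbhs_pinfty_gt; rewrite num_real.
have Vy : 0 < V y by near: y.
apply: (le_trans (rescaled1_le (ltW Vy) bmeas_cap (bmeas_outer_cap 1) cap_le_outer_cap)).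
rewrite rescaled_outer_cap// invr1 !mul1r lerD// ler_pdivrMr ?mulr_gt0//; by near: y.
Unshelve. all: by end_near. Qed.

(** The Karamata estimates bound the two pieces of [outer_cap] by multiples of
   d^(1 - alpha) and d^alpha; this is where alpha < 1 is essential. *)
Lemma rescaled_tight eps : 0 < eps -> exists2 d, 0 < d < 1 &
  \forall y \near +oo, S1 (outer_cap d) y <= eps.
Proof.
move=> e0; have /andP[a0 a1] := alpha01.
have [C1 C10 h1] := moment1_gauge alpha01 gV.
have [C2 C20 h2] := tail_gauge alpha01 gV.
have [V0 VRV _ _] := gV.
have [d1 /andP[d10 d11] hd1] := @powR_small R (1 - alpha) (eps / (4 * C1)) ltac:(lra) (divr_gt0 e0 (mulr_gt0 (ltr0Sn _ 3) C10)).
have [d2 /andP[d20 d21] hd2] := @powR_small R alpha (eps / (4 * C2)) a0 (divr_gt0 e0 (mulr_gt0 (ltr0Sn _ 3) C20)).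
pose d := Num.min d1 d2.
have d0 : 0 < d by rewrite lt_min d10.
have dV0 : 0 < d^-1 by rewrite invr_gt0.
exists d; first by rewrite d0 gt_min d11.
have {}hd1 : C1 * d `^ (1 - alpha) <= eps / 4.
  have := hd1 d; rewrite d0 ge_min lexx => /(_ isT).
  by rewrite ler_pdivlMr ?mulr_gt0//; lra.
have {}hd2 : C2 * d `^ alpha <= eps / 4.
  have := hd2 d; rewrite d0 ge_min lexx orbT => /(_ isT).
  by rewrite ler_pdivlMr ?mulr_gt0//; lra.
have lim : C1 * d * (V (d * y) / V y) + C2 * (V (d^-1 * y) / V y) @[y --> +oo] -->
   C1 * d * d `^ (- alpha) + C2 * d^-1 `^ (- alpha).
  by apply: cvgD; apply: cvgMr; exact: VRV.
have limE : C1 * d * d `^ (- alpha) + C2 * d^-1 `^ (- alpha) =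
    C1 * d `^ (1 - alpha) + C2 * d `^ alpha.
  rewrite -mulrA -{1}(powRr1 (ltW d0)) -powRD; last by rewrite (lt0r_neq0 d0) implybT.
  by rewrite -powR_inv1 ?ltW// -powRrM mulrNN mul1r.
have /cvgrPdist_le /(_ _ (divr_gt0 e0 (ltr0Sn _ 1))) {}lim := lim.
near=> y; have y0 : 0 < y by near: y; apply: nbhs_pinfty_gt; rewrite num_real.
have Vy : 0 < V y by near: y.
rewrite rescaled_outer_cap//.
have H1 : moment1 mu (d * y) <= C1 * (d * y * V (d * y)).
  by near: y; exact: near_pinfty_scale d0 h1.
have H2 : tail mu (d^-1 * y) <= C2 * V (d^-1 * y).
  by near: y; exact: near_pinfty_scale dV0 h2.
have : `|C1 * d * d `^ (- alpha) + C2 * d^-1 `^ (- alpha) -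
   (C1 * d * (V (d * y) / V y) + C2 * (V (d^-1 * y) / V y))| <= eps / 2 by near: y.
rewrite limE ler_norml => /andP[+ _].
have G1 : moment1 mu (d * y) / (y * V y) <= C1 * d * (V (d * y) / V y).
  rewrite ler_pdivrMr ?mulr_gt0//; apply: (le_trans H1).
  by rewrite le_eqVlt; apply/orP; left; apply/eqP; field; rewrite !lt0r_neq0.
have G2 : tail mu (d^-1 * y) / V y <= C2 * (V (d^-1 * y) / V y).
  by rewrite mulrA ler_pM2r ?invr_gt0.
by lra.
Unshelve. all: by end_near. Qed.

End rescaled.

(** * Test functions *)

Section test_functions.
Variables (R : realType) (mu : probability (measurableTypeR R) R) (alpha : R).
Hypothesis (alpha01 : 0 < alpha < 1).
Variable V : R -> R.
Hypothesis gV : gauge mu alpha V.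
Local Notation S := (rescaled mu V).
Local Notation S1 := (rescaled mu V (fun=> 1)).

Definition even_fun (h : R -> R) := forall t, h (- t) = h t.

(** The integrands for which the rescaled integrals will be shown to converge; both
   Stieltjes kernels t^2 / (t^2 + 1) and |t| / (t^2 + 1) are among them. *)
Definition test_fun (h : R -> R) :=
  [/\ continuous h, even_fun h & exists C, forall t, `|h t| <= C * cap t].

(** Test functions vanishing near 0 and near infinity, where density arguments apply. *)
Definition annulus_fun (h : R -> R) :=
  [/\ continuous h, even_fun h & exists a, exists b,
    [/\ 0 < a, a < b & forall t, ~~ (a < `|t| < b) -> h t = 0]].

Lemma even_funE h t : even_fun h -> h `|t| = h t.
Proof. by move=> he; case: (ger0P t) => _ //; rewrite he. Qed.

Lemma test_fun_bound h : test_fun h ->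
  exists2 C, 0 < C & forall t, `|h t| <= C * cap t.
Proof.
move=> [_ _ [C hC]]; exists (`|C| + 1) => [|t]; first by rewrite ltr_wpDl.
by rewrite (le_trans (hC t))// ler_wpM2r ?cap_ge0// (le_trans (ler_norm _))// lerDl.
Qed.

Lemma test_fun_bmeas h : test_fun h -> bmeas h.
Proof.
move=> th; have [C C0 hC] := test_fun_bound th; case: th => ch _ _.
apply: (@bmeas_continuous _ _ C ch) => t; rewrite (le_trans (hC t))// ger_pMr//.
by rewrite ge_min lexx orbT.
Qed.

Lemma continuousM_fun (f g : R -> R) : continuous f -> continuous g ->
  continuous (fun t => f t * g t).
Proof. by move=> cf cg t; apply: cvgM; [exact: cf|exact: cg]. Qed.

Lemma continuousD_fun (f g : R -> R) : continuous f -> continuous g ->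
  continuous (fun t => f t + g t).
Proof. by move=> cf cg t; apply: cvgD; [exact: cf|exact: cg]. Qed.

Lemma test_fun_lin f g a b : test_fun f -> test_fun g ->
  test_fun (fun t => a * f t + b * g t).
Proof.
move=> tf tg; have [C C0 hC] := test_fun_bound tf; have [D D0 hD] := test_fun_bound tg.
case: tf tg => cf ef _ [cg eg _]; split.
- by apply: continuousD_fun; apply: continuousM_fun => // t; exact: cvg_cst.
- by move=> t; rewrite ef eg.
- exists (`|a| * C + `|b| * D) => t; rewrite (le_trans (ler_normD _ _))//.
  by rewrite !normrM mulrDl -!mulrA lerD// ler_wpM2l.
Qed.

Lemma test_fun_scale f l : 0 < l -> test_fun f -> test_fun (fun t => f (t / l)).
Proof.
move=> l0 tf; have [C C0 hC] := test_fun_bound tf; case: tf => cf ef _; split.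
- move=> t; have tl : s / l @[s --> t] --> t / l by apply: cvgMl; exact: cvg_id.
  exact: (cvg_comp _ f tl (cf _)).
- by move=> t; rewrite mulNr ef.
- exists (C * Num.max 1 l^-1) => t; rewrite (le_trans (hC _))// -mulrA ler_pM2l//.
  rewrite /cap normrM normfV (gtr0_norm l0) minr_pMr; last first.
    by rewrite le_max ler01.
  rewrite mulr1 le_min !ge_min; apply/andP; split; apply/orP.
    by left; rewrite mulrC ler_wpM2r// le_max lexx orbT.
  by right; rewrite le_max lexx.
Qed.

Definition clamp (x : R) : R := Num.min 1 (Num.max 0 x).

Lemma clamp01 x : 0 <= clamp x <= 1.
Proof. by rewrite /clamp le_min ler01 le_max lexx ge_min lexx. Qed.

Lemma clamp1 x : 1 <= x -> clamp x = 1.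
Proof. by move=> x1; rewrite /clamp max_r ?min_l//; lra. Qed.

Lemma clamp0 x : x <= 0 -> clamp x = 0.
Proof. by move=> x0; rewrite /clamp max_l// min_r. Qed.

Lemma clamp_le x y : x <= y -> clamp x <= clamp y.
Proof.
by move=> xy; rewrite /clamp le_min ge_min lexx/= ge_min ge_max !le_max lexx xy !orbT.
Qed.

Lemma continuous_clamp (f : R -> R) : continuous f -> continuous (fun t => clamp (f t)).
Proof.
move=> cf t; apply: (continuous_min (f := fun=> 1) (g := fun t => Num.max 0 (f t))).
  exact: cvg_cst.
by apply: (continuous_max (f := fun=> 0)); [exact: cvg_cst | exact: cf].
Qed.

Lemma continuous_affine_norm (a b : R) : continuous (fun t : R => a * `|t| + b).
Proof.
move=> t; apply: cvgD; last exact: cvg_cst.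
by apply: cvgMr; exact: continuous_norm.
Qed.

(** Equal to 1 for d <= |t| <= 1/d and to 0 for |t| <= d/2 and for |t| >= 2/d. *)
Definition bump (d t : R) := clamp (2 / d * `|t| + - 1) * clamp (- d * `|t| + 2).

Lemma bump_annulus h d : 0 < d < 1 -> continuous h -> even_fun h ->
  annulus_fun (fun t => h t * bump d t).
Proof.
move=> /andP[d0 d1] ch eh; split.
- apply: continuousM_fun => //; apply: continuousM_fun; apply: continuous_clamp;
    exact: continuous_affine_norm.
- by move=> t; rewrite eh /bump normrN.
- have d10 : 1 < d^-1 by rewrite invf_gt1.
  exists (d / 2); exists (2 / d); split; [lra| lra |].
  move=> t; rewrite negb_and -!leNgt => /orP[h1|h1]; rewrite /bump.
  + rewrite [X in _ * (X * _)]clamp0 ?mul0r ?mulr0//.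
    by rewrite mulrAC subr_le0 ler_pdivrMr// mul1r; lra.
  + rewrite [X in _ * (_ * X)]clamp0 ?mul0r ?mulr0//.
    by move: h1; rewrite ler_pdivrMr//; lra.
Qed.

Lemma bump_close h C d t : 0 < d < 1 -> 0 <= C -> `|h t| <= C * cap t ->
  `|h t - h t * bump d t| <= C * outer_cap d t.
Proof.
move=> /andP[d0 d1] C0 hC.
have d10 : 1 < d^-1 by rewrite invf_gt1.
have b01 : 0 <= bump d t <= 1.
  have /andP[p0 p1] := clamp01 (2 / d * `|t| + - 1).
  have /andP[q0 q1] := clamp01 (- d * `|t| + 2).
  by rewrite mulr_ge0//= mulr_ile1.
have e1 : h t - h t * bump d t = h t * (1 - bump d t) by ring.
rewrite e1 normrM.
have sm : `|h t| * `|1 - bump d t| <= `|h t|.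
  by rewrite ler_piMr// ler_norml; lra.
have [lo|hi] := leP `|t| d.
  have -> : outer_cap d t = `|t|.
    by rewrite /outer_cap lo mulr1 (ltNge d^-1) (_ : `|t| <= d^-1) ?addr0//; lra.
  by rewrite (le_trans sm)// (le_trans hC)// ler_wpM2l// ge_min lexx.
have [mid|far] := leP `|t| d^-1.
  have -> : bump d t = 1.
    rewrite /bump !clamp1 ?mulr1//.
      by move: mid; rewrite -[d^-1]mul1r ler_pdivlMr//; lra.
    by rewrite lerBrDr mulrAC ler_pdivlMr//; lra.
  rewrite subrr normr0 mulr0 mulr_ge0// /outer_cap addr_ge0// mulr_ge0//.
have -> : outer_cap d t = 1 by rewrite /outer_cap far leNgt hi mulr0 add0r.
by rewrite (le_trans sm)// (le_trans hC)// ler_wpM2l// ge_min lexx orbT.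
Qed.

Lemma annulus_bmeas h : annulus_fun h -> bmeas h.
Proof.
move=> [ch eh [a [b [a0 ab hab]]]].
have cn : {within `[0, b], continuous (fun x => `|h x|)}.
  by apply: continuous_subspaceT => x; apply: cvg_norm; exact: ch.
have [|c _ hc] := EVT_max _ cn; first by lra.
apply: (@bmeas_continuous _ _ (`|h c|) ch) => t.
rewrite -(even_funE t eh).
have [lo|hi] := leP `|t| b; first by apply: hc; rewrite in_itv/= normr_ge0.
rewrite hab ?normr0// negb_and -!leNgt normr_id; apply/orP; right; exact: ltW.
Qed.

Lemma rescaledZ e h c y : weight e -> bmeas h -> S e (fun t => c * h t) y = c * S e h y.
Proof.
move=> we bh; have := rescaled_lin mu V c 0 y we bh bh.
by rewrite mul0r addr0 => <-; congr rescaled; apply/funext => t; rewrite mul0r addr0.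
Qed.

Lemma near_gauge_gt0 : \forall y \near +oo, 0 < V y.
Proof. by case: gV. Qed.

(** An approximation in the uniform norm weighted by [H], when the [H]-mass is small. *)
Lemma tends_rescaled_closure b e h : weight e -> bmeas h ->
  (forall eps, 0 < eps -> exists k, exists H, [/\ bmeas k, bmeas H, tends b (S e k),
     forall t, `|h t - k t| <= H t & \forall y \near +oo, S1 H y <= eps]) ->
  tends b (S e h).
Proof.
move=> we bh hyp; apply: tends_closure => eps e0.
have [|k [H [bk bH tk hk SH]]] := hyp (eps / 2); first by rewrite divr_gt0.
exists (S e k) => //; near=> y.
have Vy : 0 < V y by near: y; exact: near_gauge_gt0.
apply: (le_trans (rescaled_dist mu (ltW Vy) we bh bk bH hk)).
have : S1 H y <= eps / 2 by near: y.
by lra.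
Unshelve. all: by end_near. Qed.

(** Cutting a test function off to an annulus costs a multiple of [outer_cap], which is
   small by tightness. *)
Lemma tends_test_fun b e : weight e -> (forall h, annulus_fun h -> tends b (S e h)) ->
  forall h, test_fun h -> tends b (S e h).
Proof.
move=> we hyp h th; have bh := test_fun_bmeas th; have [C C0 hC] := test_fun_bound th.
have [ch eh _] := th.
apply: tends_rescaled_closure => // eps e0.
have [d d01 hd] := rescaled_tight alpha01 gV (divr_gt0 e0 C0).
have ba := bump_annulus d01 ch eh.
exists (fun t => h t * bump d t); exists (fun t => C * outer_cap d t); split.
- exact: annulus_bmeas.
- by apply: bmeasM; [exact: bmeas_cst | exact: bmeas_outer_cap].
- exact: hyp.
- by move=> t; apply: bump_close => //; exact: ltW.
- near=> y; rewrite rescaledZ; [|exact: weight1|exact: bmeas_outer_cap].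
  rewrite mulrC -ler_pdivlMr//; near: y; exact: hd.
Unshelve. all: by end_near. Qed.

End test_functions.

(** * The limit functional *)

Section limit_functional.
Variables (R : realType) (mu : probability (measurableTypeR R) R) (alpha : R).
Hypothesis (alpha01 : 0 < alpha < 1).
Variable V : R -> R.
Hypothesis gV : gauge mu alpha V.
Local Notation S := (rescaled mu V).
Local Notation S1 := (rescaled mu V (fun=> 1)).
Hypothesis S1_tends : forall h, test_fun h -> tends false (S1 h).

(** The vague limit of the rescaled measures. Its density is never needed: homogeneity
   alone determines the ratios of its values. *)
Definition limit_functional h := lim (S1 h y @[y --> +oo]).
Local Notation L := limit_functional.

Lemma limit_functional_cvg h : test_fun h -> S1 h y @[y --> +oo] --> L h.
Proof. by move=> /S1_tends [l _ hl]; rewrite /L (cvg_lim _ hl). Qed.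

Lemma limit_functionalE h l : S1 h y @[y --> +oo] --> l -> L h = l.
Proof. by move=> hl; apply: cvg_lim. Qed.

Lemma limit_functional_lin a b f g : test_fun f -> test_fun g ->
  L (fun t => a * f t + b * g t) = a * L f + b * L g.
Proof.
move=> tf tg; apply: limit_functionalE.
have h : a * S1 f y + b * S1 g y @[y --> +oo] --> a * L f + b * L g.
  by apply: cvgD; apply: cvgMr; exact: limit_functional_cvg.
apply: cvg_trans h; apply: near_eq_cvg; near=> y.
by rewrite rescaled_lin//; [exact: weight1 | exact: test_fun_bmeas | exact: test_fun_bmeas].
Unshelve. all: by end_near. Qed.

Lemma limit_functional_le f g : test_fun f -> test_fun g ->
  (forall t, f t <= g t) -> L f <= L g.
Proof.
move=> tf tg fg.
apply: ler_cvg_to (limit_functional_cvg tf) (limit_functional_cvg tg) _.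
near=> y; apply: rescaled1_le fg; try exact: test_fun_bmeas.
by apply: ltW; near: y; exact: (near_gauge_gt0 gV).
Unshelve. all: by end_near. Qed.

Lemma test_fun_cap : test_fun (@cap R).
Proof.
split; first exact: continuous_cap.
- by move=> t; rewrite /cap normrN.
- by exists 1 => t; rewrite mul1r ger0_norm// cap_ge0.
Qed.

Lemma limit_functional_bound f C : test_fun f -> (forall t, `|f t| <= C * cap t) ->
  `|L f| <= C * L (@cap R).
Proof.
move=> tf fC.
have tc (c : R) : test_fun (fun t => c * cap t + 0 * cap t).
  exact: (test_fun_lin c 0 test_fun_cap test_fun_cap).
have Lc (c : R) : L (fun t => c * cap t + 0 * cap t) = c * L (@cap R).
  by rewrite (limit_functional_lin c 0 test_fun_cap test_fun_cap) mul0r addr0.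
rewrite ler_norml -mulNr -2!Lc; apply/andP; split.
  apply: limit_functional_le => // t; have := fC t.
  by rewrite ler_norml => /andP[]; rewrite mul0r addr0 mulNr.
apply: limit_functional_le => // t; have := fC t.
by rewrite ler_norml => /andP[]; rewrite mul0r addr0.
Qed.

(** Dilating the argument by l amounts to replacing y by l y, where V (l y) ~ l^(- alpha) V y. *)
Lemma limit_functional_homog f l : 0 < l -> test_fun f ->
  L (fun t => f (t / l)) = l `^ (- alpha) * L f.
Proof.
move=> l0 tf; apply: limit_functionalE; have [V0 VRV _ _] := gV.
have h : S1 f (l * y) * (V (l * y) / V y) @[y --> +oo] --> L f * l `^ (- alpha).
  apply: cvgM; last exact: VRV.
  exact: (cvg_pinfty_scale l0 (limit_functional_cvg tf)).
rewrite mulrC; apply: cvg_trans h; apply: near_eq_cvg; near=> y.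
rewrite rescaled_homog//; apply: lt0r_neq0; near: y; exact: (near_pinfty_scale l0 (near_gauge_gt0 gV)).
Unshelve. all: by end_near. Qed.

(** Continuous approximation of the indicator of |t| > s: 0 up to s, 1 from s (1 + d) on. *)
Definition ramp (s d t : R) := clamp (s^-1 / d * `|t| - d^-1).

Lemma ramp01 s d t : 0 <= ramp s d t <= 1.
Proof. exact: clamp01. Qed.

Lemma ramp1 s d t : 0 < s -> 0 < d -> s * (1 + d) <= `|t| -> ramp s d t = 1.
Proof.
move=> s0 d0 h; rewrite /ramp clamp1// lerBrDr mulrAC ler_pdivlMr//.
rewrite mulrDl mulVf ?lt0r_neq0// mul1r mulrC ler_pdivlMr// mulrC.
by rewrite addrC.
Qed.

Lemma ramp0 s d t : 0 < s -> 0 < d -> `|t| <= s -> ramp s d t = 0.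
Proof.
move=> s0 d0 h; rewrite /ramp clamp0// subr_le0 mulrAC ler_pdivrMr//.
by rewrite mulVf ?lt0r_neq0// mulrC ler_pdivrMr// mul1r.
Qed.

Lemma ramp_le s d t u : 0 < s -> 0 < d -> `|t| <= `|u| -> ramp s d t <= ramp s d u.
Proof.
move=> s0 d0 h; apply: clamp_le; rewrite lerD2r ler_wpM2l// mulr_ge0// invr_ge0 ltW//.
Qed.

Lemma ramp_cap s d t : 0 < s -> 0 < d -> `|ramp s d t| <= Num.max 1 s^-1 * cap t.
Proof.
move=> s0 d0; have /andP[r0 r1] := ramp01 s d t; rewrite ger0_norm//.
have [lo|hi] := leP `|t| s.
  by rewrite ramp0// mulr_ge0 ?cap_ge0// le_max ler01.
rewrite (le_trans r1)// /cap; case: (leP `|t| 1) => t1.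
  have : 1 <= s^-1 * `|t| by rewrite mulrC ler_pdivlMr// mul1r ltW.
  by move=> /le_trans; apply; rewrite ler_wpM2r// le_max lexx orbT.
by rewrite mulr1 le_max lexx.
Qed.

Lemma test_fun_ramp s d : 0 < s -> 0 < d -> test_fun (ramp s d).
Proof.
move=> s0 d0; split.
- by apply: continuous_clamp; exact: continuous_affine_norm.
- by move=> t; rewrite /ramp normrN.
- by exists (Num.max 1 s^-1) => t; exact: ramp_cap.
Qed.

Lemma bmeas_shell s d : bmeas (fun t => \1[s < `|t| <= s * (1 + d)] : R).
Proof.
rewrite (_ : (fun t => _) = (fun t => \1[s < `|t|] * \1[`|t| <= s * (1 + d)])).
  by apply: bmeasM; [exact: bmeas_norm_gt | exact: bmeas_norm_le].
by apply/funext => t; case: (s < `|t|); rewrite ?mul1r ?mul0r.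
Qed.

(** Homogeneity gives thin shells small mass: a ramp across [s] and its rescaling by
   a factor close to 1 have almost the same limit. *)
Lemma shell_small s eps : 0 < s -> 0 < eps -> exists2 d, 0 < d <= 1 &
  \forall y \near +oo, S1 (fun t => \1[s < `|t| <= s * (1 + d)]) y <= eps.
Proof.
move=> s0 e0; have /andP[a0 a1] := alpha01.
pose K := Num.max 1 s^-1 * L (@cap R) + 1.
have cap0 : 0 <= L (@cap R).
  rewrite -[L _]mul1r.
  apply: le_trans (normr_ge0 (L (@cap R))) (limit_functional_bound test_fun_cap _) => t.
  by rewrite mul1r ger0_norm// cap_ge0.
have K0 : 0 < K by rewrite ltr_wpDl// mulr_ge0// le_max ler01.
(* The dilated ramps differ in the limit by at most (1 + d) - (1 - d) times K. *)
pose d := Num.min 1 (eps / (4 * K)).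
have d0 : 0 < d by rewrite lt_min ltr01 divr_gt0// mulr_gt0.
have d1 : d <= 1 by rewrite ge_min lexx.
have dK : 2 * d * K <= eps / 2.
  have : d <= eps / (4 * K) by rewrite ge_min lexx orbT.
  by rewrite ler_pdivlMr ?mulr_gt0//; lra.
exists d; first by rewrite d0.
have l0 : 0 < 1 + d by lra.
have l0' : 0 < (1 + d)^-1 by rewrite invr_gt0.
have tr := test_fun_ramp s0 d0.
have tr1 := test_fun_scale l0 tr; have tr2 := test_fun_scale l0' tr.
pose z t := 1 * ramp s d (t / (1 + d)^-1) + (- 1) * ramp s d (t / (1 + d)).
have tz : test_fun z by exact: test_fun_lin.
have Lz : L z <= eps / 2.
  rewrite /z limit_functional_lin// !limit_functional_homog// mul1r mulN1r -mulrBl.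
  have Lr0 : 0 <= L (ramp s d).
    rewrite (_ : 0 = 0 * L (@cap R) + 0 * L (@cap R)); last by rewrite mul0r addr0.
    rewrite -(limit_functional_lin 0 0 test_fun_cap test_fun_cap).
    apply: limit_functional_le => // [|t].
      exact: (test_fun_lin 0 0 test_fun_cap test_fun_cap).
    by rewrite mul0r addr0; have /andP[] := ramp01 s d t.
  have LrK : L (ramp s d) <= K.
    apply: le_trans (ler_norm _) _.
    apply: le_trans (limit_functional_bound tr (fun t => ramp_cap t s0 d0)) _.
    by rewrite lerDl.
  have p1 : (1 + d)^-1 `^ (- alpha) <= 1 + d.
    by rewrite -powR_inv1 ?(ltW l0)// -powRrM mulrNN mul1r ler1_powR//; lra.
  have p2 : 1 - d <= (1 + d) `^ (- alpha).
    apply: (@le_trans _ _ (1 + d)^-1).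
      by rewrite -[leRHS]mul1r ler_pdivlMr//; nra.
    by rewrite powRN lef_pV2 ?posrE ?powR_gt0// ler1_powR//; lra.
  apply: le_trans dK; apply: ler_pM => //; last by lra.
  rewrite subr_ge0 (@le_trans _ _ 1)//.
    by rewrite powRN invf_le1 ?powR_gt0// -[leLHS](powRr0 (1 + d)) ler_powR//; lra.
  by rewrite -powR_inv1 ?(ltW l0)// -powRrM mulrNN mul1r -[leLHS](powRr0 (1 + d)) ler_powR//; lra.
have /cvgrPdist_le /(_ _ (divr_gt0 e0 (ltr0Sn _ 1))) := limit_functional_cvg tz.
move=> hz; near=> y.
have Vy : 0 < V y by near: y; exact: (near_gauge_gt0 gV).
apply: (@le_trans _ _ (S1 z y)); last first.
  have : `|L z - S1 z y| <= eps / 2 by near: y.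
  by rewrite ler_norml => /andP[]; lra.
apply: rescaled1_le; [exact: ltW | exact: bmeas_shell | exact: test_fun_bmeas | move=> t].
rewrite /z mul1r mulN1r invrK.
have tt : `|t / (1 + d)| <= `|t * (1 + d)|.
  rewrite !normrM normfV (gtr0_norm l0) ler_wpM2l// (@le_trans _ _ 1)//; last by lra.
  by rewrite invf_le1//; lra.
have rr := ramp_le s0 d0 tt.
case: (boolP (s < `|t| <= s * (1 + d))) => [/andP[h1 h2]|_] /=; last by lra.
rewrite [X in _ <= X - _]ramp1 ?[X in _ <= _ - X]ramp0 ?subr0//.
  by rewrite normrM normfV (gtr0_norm l0) ler_pdivrMr.
by rewrite normrM (gtr0_norm l0) ler_pM2r// ltW.
Unshelve. all: by end_near. Qed.

(** A function continuous except for a jump on |t| = s agrees with a test function outside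
   a thin shell. *)
Lemma tends_jump b e h s C : 0 < s -> 0 < C -> weight e ->
  (forall f, test_fun f -> tends b (S e f)) -> bmeas h ->
  (forall d, 0 < d -> d <= 1 -> exists2 k, test_fun k &
     forall t, `|h t - k t| <= C * \1[s < `|t| <= s * (1 + d)]) ->
  tends b (S e h).
Proof.
move=> s0 C0 we et bh hk; apply: (tends_rescaled_closure gV) => // eps e0.
have [d /andP[d0 d1] hd] := shell_small s0 (divr_gt0 e0 C0).
have [k tk kt] := hk d d0 d1.
exists k; exists (fun t => C * \1[s < `|t| <= s * (1 + d)]); split => //.
- exact: test_fun_bmeas.
- by apply: bmeasM; [exact: bmeas_cst | exact: bmeas_shell].
- exact: et.
- near=> y; rewrite rescaledZ; [|exact: weight1|exact: bmeas_shell].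
  by rewrite mulrC -ler_pdivlMr//; near: y.
Unshelve. all: by end_near. Qed.

Lemma tends_tail b e s : 0 < s -> weight e ->
  (forall f, test_fun f -> tends b (S e f)) -> tends b (S e (fun t => \1[s < `|t|])).
Proof.
move=> s0 we et; apply: (tends_jump (s := s) (C := 1)) => //.
  exact: bmeas_norm_gt.
move=> d d0 d1; exists (ramp s d); first exact: test_fun_ramp.
move=> t; rewrite mul1r; have := ramp01 s d t.
case: (leP `|t| s) => h1 /=; first by rewrite ramp0// subrr normr0.
case: (leP `|t| (s * (1 + d))) => h2 /=.
  by move=> /andP[r0 r1]; rewrite ler_norml; lra.
by rewrite ramp1 ?(ltW h2)// subrr normr0.
Qed.

Lemma tends_sq_trunc b e s : 0 < s -> weight e ->
  (forall f, test_fun f -> tends b (S e f)) ->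
  tends b (S e (fun t => t ^+ 2 * \1[`|t| <= s])).
Proof.
move=> s0 we et; apply: (tends_jump (s := s) (C := 4 * s ^+ 2)) => //.
- by rewrite mulr_gt0// exprn_gt0.
- exact: bmeas_sq_trunc.
move=> d d0 d1; exists (fun t => t ^+ 2 * (1 - ramp s d t)).
  have [cr er _] := test_fun_ramp s0 d0; split.
  - apply: continuousM_fun; first exact: exprn_continuous.
    by move=> t; apply: cvgB; [exact: cvg_cst | exact: cr].
  - by move=> t; rewrite sqrrN er.
  - exists (2 * s + 4 * s ^+ 2) => t.
    have [hi|lo] := leP (s * (1 + d)) `|t|.
      rewrite ramp1// subrr mulr0 normr0 mulr_ge0 ?cap_ge0//.
      by rewrite addr_ge0 ?mulr_ge0 ?sqr_ge0// ltW.
    have /andP[r0 r1] := ramp01 s d t.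
    have t2s : `|t| <= 2 * s by nra.
    rewrite normrM normrX (ger0_norm (x := 1 - _)) ?subr_ge0//.
    apply: (@le_trans _ _ (`|t| ^+ 2)); first by rewrite ler_piMr ?sqr_ge0//; lra.
    have s20 := sqr_ge0 s; have tn := normr_ge0 t.
    rewrite /cap; case: (leP `|t| 1) => t1; nra.
move=> t; have /andP[r0 r1] := ramp01 s d t.
case: (leP `|t| s) => h1 /=.
  by rewrite ramp0// subr0 subrr normr0 mulr0.
rewrite mulr0 sub0r normrN; case: (leP `|t| (s * (1 + d))) => h2 /=; last first.
  by rewrite ramp1 ?(ltW h2)// subrr !mulr0 normr0.
rewrite mulr1 normrM normrX (ger0_norm (x := 1 - _)) ?subr_ge0//.
apply: (@le_trans _ _ (`|t| ^+ 2)); first by rewrite ler_piMr ?sqr_ge0//; lra.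
have tn := normr_ge0 t; have : `|t| <= 2 * s by nra.
by nra.
Qed.

End limit_functional.

(** * Density of resolvents and of step functions *)

Section density.
Variables (R : realType) (mu : probability (measurableTypeR R) R) (alpha : R).
Hypothesis (alpha01 : 0 < alpha < 1).
Variable V : R -> R.
Hypothesis gV : gauge mu alpha V.
Local Notation S := (rescaled mu V).
Local Notation S1 := (rescaled mu V (fun=> 1)).
Variables (b : bool) (e : R -> R).
Hypothesis we : weight e.

Lemma tends_rescaled_lin f g h c d : bmeas f -> bmeas g ->
  (forall t, h t = c * f t + d * g t) -> tends b (S e f) -> tends b (S e g) ->
  tends b (S e h).
Proof.
move=> bf bg hE tf tg; have := tends_lin c d tf tg; apply: tends_near; near=> y.
by rewrite -rescaled_lin//; congr rescaled; apply/funext => t; rewrite hE.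
Unshelve. all: by end_near. Qed.

Lemma tends_rescaled_eq f h : (forall t, h t = f t) -> tends b (S e f) -> tends b (S e h).
Proof. by move=> hf; have -> : h = f by apply/funext. Qed.

(** A majorant that is a small multiple of the cap function has small mass. *)
Lemma tends_rescaled_cap h : bmeas h ->
  (forall eps, 0 < eps -> exists k, [/\ bmeas k, tends b (S e k) &
     forall t, `|h t - k t| <= eps * cap t]) ->
  tends b (S e h).
Proof.
move=> bh hyp; have [M M0 hM] := rescaled_cap_bounded alpha01 gV.
apply: (tends_rescaled_closure gV) => // eps e0.
have [k [bk tk hk]] := hyp _ (divr_gt0 e0 M0).
exists k; exists (fun t => eps / M * cap t); split => //.
- by apply: bmeasM; [exact: bmeas_cst | exact: bmeas_cap].
- near=> y; rewrite rescaledZ; [|exact: weight1|exact: bmeas_cap].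
  rewrite mulrAC ler_pdivrMr// ler_pM2l//; near: y; exact: hM.
Unshelve. all: by end_near. Qed.

Section tauberian.
Variable w : R -> R.
Hypotheses (cw : continuous w) (ew : even_fun w) (w_cap : forall t, 0 <= w t <= cap t).
Hypothesis w_neq0 : forall t, 0 < `|t| -> 0 < w t.

Let x (t : R) : R := (1 + t ^+ 2)^-1.

Lemma inv_one_sq_bound t : 0 < x t <= 1.
Proof.
have p : 0 < 1 + t ^+ 2 by rewrite ltr_pwDl// sqr_ge0.
by rewrite /x invr_gt0 p/= invf_le1// lerDl sqr_ge0.
Qed.

Lemma continuous_inv_one_sq : continuous x.
Proof.
move=> t; apply: cvgV; first by rewrite lt0r_neq0// ltr_pwDl// sqr_ge0.
by apply: cvgD; [exact: cvg_cst | exact: exprn_continuous].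
Qed.

Lemma bmeas_wx (f : R -> R) C : continuous f -> (forall t, `|f t| <= C) ->
  bmeas (fun t => w t * f t).
Proof.
move=> cf fC; apply: bmeasM; last exact: bmeas_continuous fC.
apply: (@bmeas_continuous _ _ 1 cw) => t; have /andP[w0 wc] := w_cap t.
by rewrite ger0_norm// (le_trans wc)// ge_min lexx orbT.
Qed.

Lemma resolvent_den_ge1 c t : 0 <= c -> 1 <= 1 + c * x t.
Proof. by move=> c0; have /andP[x0 _] := inv_one_sq_bound t; rewrite lerDl mulr_ge0// ltW. Qed.

Lemma continuous_xn n c : 0 <= c -> continuous (fun t => x t ^+ n / (1 + c * x t)).
Proof.
move=> c0 t; apply: cvgM.
  exact: (cvg_comp _ (fun u => u ^+ n) (@continuous_inv_one_sq t) (@exprn_continuous R n _)).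
apply: cvgV; first by rewrite lt0r_neq0// (lt_le_trans _ (resolvent_den_ge1 t c0)).
by apply: cvgD; [exact: cvg_cst | apply: cvgMr; exact: continuous_inv_one_sq].
Qed.

Lemma xn_le1 n c t : 0 <= c -> 0 <= x t ^+ n / (1 + c * x t) <= 1.
Proof.
move=> c0; have /andP[x0 x1] := inv_one_sq_bound t; have d1 := resolvent_den_ge1 t c0.
have d0 : 0 < 1 + c * x t by apply: lt_le_trans d1.
rewrite divr_ge0 ?exprn_ge0 ?(ltW x0) ?(ltW d0)//= ler_pdivrMr// mul1r (le_trans _ d1)//.
by rewrite exprn_ile1// ltW.
Qed.

Lemma bmeas_wxn n c : 0 <= c -> bmeas (fun t => w t * (x t ^+ n / (1 + c * x t))).
Proof.
move=> c0; apply: (@bmeas_wx _ 1); first exact: continuous_xn.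
by move=> t; have /andP[h0 h1] := xn_le1 n t c0; rewrite ger0_norm.
Qed.

Hypothesis tends_resolvent : forall c, 0 <= c ->
  tends b (S e (fun t => w t / (1 + c * x t))).

(** Divided differences in c of the resolvents 1 / (1 + c x), then c -> 0, produce the
   powers of x one after the other. *)
Lemma tends_powers n c : 0 <= c -> tends b (S e (fun t => w t * (x t ^+ n / (1 + c * x t)))).
Proof.
elim: n c => [|n IH] c c0.
  by apply: tends_rescaled_eq (tends_resolvent c0) => t; rewrite expr0 mul1r.
have step d : 0 < d -> tends b (S e (fun t => w t * (x t ^+ n.+1 / (1 + d * x t)))).
  move=> d0; apply: tends_rescaled_lin (IH 0 (lexx 0)) (IH d (ltW d0)); try exact: bmeas_wxn (ltW d0).
    exact: bmeas_wxn.
  move=> t; have p : 1 + d * x t != 0.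
    by rewrite lt0r_neq0// (lt_le_trans _ (resolvent_den_ge1 t (ltW d0))).
  rewrite exprSr mul0r addr0 invr1 mulr1.
  instantiate (1 := - d^-1); instantiate (1 := d^-1).
  by field; rewrite p lt0r_neq0.
have := c0; rewrite le_eqVlt => /orP[/eqP <-|]; last exact: step.
apply: tends_rescaled_cap; first exact: bmeas_wxn.
move=> eps e0; exists (fun t => w t * (x t ^+ n.+1 / (1 + eps * x t))); split.
- exact: bmeas_wxn (ltW e0).
- exact: step.
move=> t; have /andP[w0 wc] := w_cap t; have /andP[x0 x1] := inv_one_sq_bound t.
have /andP[p0 p1] := xn_le1 n.+1 t (ltW e0).
have d0 : 1 + eps * x t != 0 by rewrite lt0r_neq0// (lt_le_trans _ (resolvent_den_ge1 t (ltW e0))).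
rewrite mul0r addr0 invr1 mulr1.
have -> : w t * x t ^+ n.+1 - w t * (x t ^+ n.+1 / (1 + eps * x t)) =
   eps * (w t * (x t * (x t ^+ n.+1 / (1 + eps * x t)))) by field.
rewrite ger0_norm; last by rewrite (mulr_ge0 (ltW e0))// (mulr_ge0 w0)// (mulr_ge0 (ltW x0)).
by rewrite ler_pM2l// (le_trans _ wc)// ler_piMr// mulr_ile1// ltW.
Qed.

Lemma continuous_horner_x (p : {poly R}) : continuous (fun t => p.[x t]).
Proof. by move=> t; exact: (cvg_comp _ (horner p) (@continuous_inv_one_sq t) (@continuous_horner R p _)). Qed.

Lemma tends_poly (p : {poly R}) : tends b (S e (fun t => w t * p.[x t])).
Proof.
pose q n t := \sum_(i < n) p`_i * x t ^+ i.
have cx n : continuous (fun t => x t ^+ n).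
  move=> t; exact: (cvg_comp _ (fun u => u ^+ n) (@continuous_inv_one_sq t) (@exprn_continuous R n _)).
have bx n : bmeas (fun t => w t * x t ^+ n).
  apply: (@bmeas_wx _ 1 (cx n)) => t; have /andP[x0 x1] := inv_one_sq_bound t.
  by rewrite ger0_norm ?exprn_ge0 ?(ltW x0)// exprn_ile1// ltW.
have tx n : tends b (S e (fun t => w t * x t ^+ n)).
  apply: tends_rescaled_eq (tends_powers n (lexx 0)) => t.
  by rewrite mul0r addr0 invr1 mulr1.
have bq n : bmeas (fun t => w t * q n t) /\ tends b (S e (fun t => w t * q n t)).
  elim: n => [|n [bn tn]].
    have z t : w t * q 0%N t = 0 * (w t * x t ^+ 0) + 0 * (w t * x t ^+ 0).
      by rewrite /q big_ord0; ring.
    split; last exact: tends_rescaled_lin z (tx 0%N) (tx 0%N).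
    rewrite (_ : (fun t => _) = (fun t => 0 * (w t * x t ^+ 0))).
      by apply: bmeasM; [exact: bmeas_cst | exact: bx].
    by apply/funext => t; rewrite /q big_ord0; ring.
  have z t : w t * q n.+1 t = 1 * (w t * q n t) + p`_n * (w t * x t ^+ n).
    by rewrite /q big_ord_recr /=; ring.
  split; last exact: tends_rescaled_lin z tn (tx n).
  rewrite (_ : (fun t => _) = (fun t => 1 * (w t * q n t) + p`_n * (w t * x t ^+ n))).
    by apply: bmeasD; (apply: bmeasM; first exact: bmeas_cst).
  exact/funext.
apply: tends_rescaled_eq (proj2 (bq (size p))) => t.
by rewrite horner_coef.
Qed.

(** In the variable x = 1 / (1 + t^2), the quotient of an annulus function by [w] is a
   continuous function on [0, 1], so polynomials in x times [w] approximate the function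
   within a multiple of [cap]. *)
Lemma tauberian_annulus h : annulus_fun h -> tends b (S e h).
Proof.
move=> ah; have bh := annulus_bmeas ah.
have [ch eh [a [c [a0 ac hac]]]] := ah.
have c0 : 0 < c by lra.
pose lo := (1 + c ^+ 2)^-1; pose hi := (1 + a ^+ 2)^-1.
have a20 : 0 < 1 + a ^+ 2 by rewrite ltr_pwDl// sqr_ge0.
have c20 : 0 < 1 + c ^+ 2 by rewrite ltr_pwDl// sqr_ge0.
have lo0 : 0 < lo by rewrite invr_gt0.
have hi1 : hi < 1 by rewrite invf_lt1// ltrDl exprn_gt0.
have lohi : lo <= hi by rewrite lef_pV2 ?posrE// lerD2l lerXn2r// ?nnegrE; lra.
(* Clamping u makes g constant, equal to 0, beyond the images of the two circles. *)
pose cl (u : R) := Num.max lo (Num.min hi u).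
have clb u : lo <= cl u <= hi.
  by rewrite /cl le_max lexx ge_max lohi ge_min lexx.
pose s u := Num.sqrt ((cl u)^-1 - 1).
have s_gt0 u : 0 < s u.
  have /andP[h1 h2] := clb u.
  by rewrite sqrtr_gt0 subr_gt0 invf_gt1; lra.
have ccl : continuous cl.
  move=> u; apply: (continuous_max (f := fun=> lo) (g := fun u => Num.min hi u)).
    exact: cvg_cst.
  by apply: (continuous_min (f := fun=> hi)); [exact: cvg_cst | exact: cvg_id].
have cs : continuous s.
  move=> u; apply: (@cvg_comp _ _ _ (fun u => (cl u)^-1 - 1) Num.sqrt); last exact: sqrt_continuous.
  apply: cvgB; last exact: cvg_cst.
  apply: cvgV; last exact: ccl.
  by have /andP[h1 _] := clb u; rewrite lt0r_neq0//; lra.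
pose g u := h (s u) / w (s u).
have cg : continuous g.
  move=> u; apply: cvgM; first exact: (cvg_comp _ h (cs u) (ch _)).
  apply: cvgV; first by rewrite lt0r_neq0// w_neq0// gtr0_norm.
  apply: (@cvg_comp _ _ _ s w); [exact: cs | exact: cw].
have gh t : h t = w t * g (x t).
  have tt : 0 < 1 + t ^+ 2 by rewrite ltr_pwDl// sqr_ge0.
  have sq : `|t| ^+ 2 = t ^+ 2 by rewrite real_normK ?num_real.
  have [far|near_] := boolP (a < `|t| < c); last first.
    rewrite (hac t near_); suff -> : g (x t) = 0 by rewrite mulr0.
    rewrite /g; suff -> : h (s (x t)) = 0 by rewrite mul0r.
    apply: hac; rewrite gtr0_norm//; move: near_; rewrite !negb_and -!leNgt => /orP[ta|ct].
      have clE : cl (x t) = hi.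
        rewrite /cl min_l ?max_r// /hi /x lef_pV2 ?posrE// lerD2l -sq.
        by rewrite lerXn2r// ?nnegrE; lra.
      rewrite /s clE /hi invrK addrAC subrr add0r sqrtr_sqr gtr0_norm//.
      by rewrite lexx.
    have clE : cl (x t) = lo.
      have xlo : x t <= lo.
        by rewrite /lo /x lef_pV2 ?posrE// lerD2l -sq lerXn2r// ?nnegrE; lra.
      by rewrite /cl max_l// ge_min xlo orbT.
    by rewrite /s clE /lo invrK addrAC subrr add0r sqrtr_sqr gtr0_norm// lexx orbT.
  rewrite /g.
  have -> : s (x t) = `|t|.
    rewrite /s; have /andP[f1 f2] := far.
    have -> : cl (x t) = x t.
      rewrite /cl min_r; last first.
        by rewrite /hi /x lef_pV2 ?posrE// lerD2l -sq lerXn2r// ?nnegrE; lra.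
      by rewrite max_r// /lo /x lef_pV2 ?posrE// lerD2l -sq lerXn2r// ?nnegrE; lra.
    by rewrite /x invrK addrAC subrr add0r sqrtr_sqr.
  have /andP[f1 _] := far.
  rewrite !even_funE//; field; rewrite lt0r_neq0// w_neq0//; lra.
apply: tends_rescaled_cap => // eps e0.
have [p hp] := weierstrass cg e0.
exists (fun t => w t * p.[x t]); split; last first.
- move=> t; rewrite gh -mulrBr normrM; have /andP[w0 wc] := w_cap t.
  have /andP[x0 x1] := inv_one_sq_bound t.
  rewrite (ger0_norm w0) mulrC; apply: ler_pM => //.
  by rewrite distrC; apply: hp; rewrite (ltW x0).
- exact: tends_poly.
have [M hM] : exists M, forall u, 0 <= u <= 1 -> `|p.[u]| <= M.
  have cn : {within `[0, 1], continuous (fun u => `|p.[u]|)}.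
    by apply: continuous_subspaceT => u; apply: cvg_norm; exact: continuous_horner.
  have [m _ hm] := EVT_max ler01 cn.
  by exists `|p.[m]| => u u01; apply: hm; rewrite in_itv.
apply: (@bmeas_wx _ M); first exact: continuous_horner_x.
by move=> t; have /andP[x0 x1] := inv_one_sq_bound t; apply: hM; rewrite (ltW x0).
Qed.

End tauberian.

End density.

Section step_functions.
Variables (R : realType) (mu : probability (measurableTypeR R) R) (alpha : R).
Hypothesis (alpha01 : 0 < alpha < 1).
Variable V : R -> R.
Hypothesis gV : gauge mu alpha V.
Local Notation S := (rescaled mu V).
Variables (b : bool) (e : R -> R).
Hypothesis we : weight e.
Variable rho : R -> R.
Hypotheses (crho : continuous rho) (erho : even_fun rho) (rho_gt0 : forall t, 0 < `|t| -> 0 < rho t).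

Let shell (u v t : R) : R := rho t * \1[u < `|t| <= v].
Hypothesis shell_cap : forall u v, 0 < u -> exists2 C, 0 < C & forall t, shell u v t <= C * cap t.
Hypothesis tends_shell : forall u v, 0 < u -> u <= v -> tends b (S e (shell u v)).

Lemma shell_ge0 u v t : 0 < u -> 0 <= shell u v t.
Proof.
move=> u0; rewrite /shell; case: (boolP (_ < _ <= _)) => [/andP[h _]|_]; rewrite ?mulr0//.
by rewrite mulr1 ltW// rho_gt0// (lt_trans u0).
Qed.

Lemma bmeas_rho_shell u v : 0 < u -> bmeas (shell u v).
Proof.
move=> u0; have [C C0 hC] := shell_cap v u0; split.
  apply: measurable_funM; first exact: continuous_measurable_fun.
  have [m1 _] := bmeas_norm_gt u; have [m2 _] := bmeas_norm_le v.
  rewrite (_ : (fun t => _) = (fun t => \1[u < `|t|] * \1[`|t| <= v])).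
    exact: measurable_funM.
  by apply/funext => t; case: (u < `|t|); rewrite ?mul1r ?mul0r.
exists C => t; rewrite ger0_norm ?shell_ge0//; apply: (le_trans (hC t)).
by rewrite ger_pMr// ge_min lexx orbT.
Qed.

Lemma shell_cat u v w t : u <= v -> v <= w -> shell u w t = shell u v t + shell v w t.
Proof.
move=> uv vw; rewrite /shell -mulrDr; congr (_ * _).
case: (leP `|t| v) => h1; case: (ltP u `|t|) => h2; case: (leP `|t| w) => h3 //=;
  rewrite ?addr0 ?add0r//; lra.
Qed.

(** Uniform continuity of h / rho lets a combination of finitely many shells follow h;
   the combination is built one shell at a time. *)
Lemma step_annulus h : annulus_fun h -> tends b (S e h).
Proof.
move=> ah; have bh := annulus_bmeas ah.
have [ch eh [a [c [a0 ac hac]]]] := ah.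
(* The maximum keeps rho away from 0, and has no effect where h is nonzero. *)
pose g t := h t / rho (Num.max a t).
have max0 t : 0 < Num.max a t by rewrite lt_max a0.
have cmax : continuous (fun t : R => Num.max a t).
  move=> t; apply: (continuous_max (f := fun=> a)); [exact: cvg_cst | exact: cvg_id].
have cg : continuous g.
  move=> t; apply: cvgM; first exact: ch.
  apply: cvgV; first by rewrite lt0r_neq0// rho_gt0// gtr0_norm.
  by apply: (@cvg_comp _ _ _ (fun t => Num.max a t) rho); [exact: cmax | exact: crho].
have hg t : a < `|t| -> h t = rho t * g `|t|.
  move=> at_; rewrite /g max_r ?ltW// !even_funE//.
  by field; rewrite lt0r_neq0// rho_gt0//; lra.
have [C C0 hC] := shell_cap c a0.
apply: (tends_rescaled_cap alpha01 gV) => // eps e0.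
have [d d0 hd] := heine a c cg (divr_gt0 e0 C0).
pose P u := exists k, [/\ bmeas k, tends b (S e k) &
  forall t, `|h t * \1[a < `|t| <= u] - k t| <= eps / C * shell a u t].
have P0 : P a.
  have z t : 0 = 0 * shell a c t + 0 * shell a c t by rewrite !mul0r addr0.
  exists (fun=> 0); split; first exact: bmeas_cst.
    have tS := tends_shell a0 (ltW ac); have bS := bmeas_rho_shell c a0.
    exact: (tends_rescaled_lin we bS bS z tS tS).
  move=> t; have -> : (a < `|t| <= a) = false.
    by case: (ltP a `|t|) => //= h1; apply/negbTE; rewrite -ltNge.
  by rewrite mulr0 subrr normr0 mulr_ge0 ?shell_ge0// ltW// divr_gt0.
have Pstep u v : a <= u -> u <= v -> v <= c -> v - u < d -> P u -> P v.
  move=> au uv vc uvd [k [bk tk hk]].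
  have u0 : 0 < u by lra.
  have bS := bmeas_rho_shell v u0; have tS := tends_shell u0 uv.
  exists (fun t => 1 * k t + g u * shell u v t); split.
  - by apply: bmeasD; apply: bmeasM => //; exact: bmeas_cst.
  - by apply: (tends_rescaled_lin we bk bS _ tk tS).
  move=> t; rewrite (shell_cat t au uv) mulrDr.
  have split1 : \1[a < `|t| <= v] = \1[a < `|t| <= u] + \1[u < `|t| <= v] :> R.
    case: (leP `|t| u) => h1; case: (ltP a `|t|) => h2; case: (leP `|t| v) => h3 //=;
      rewrite ?addr0 ?add0r//; lra.
  rewrite split1 mulrDr.
  rewrite (_ : _ - _ = (h t * \1[a < `|t| <= u] - k t) +
     (h t * \1[u < `|t| <= v] - g u * shell u v t)); last by ring.
  rewrite (le_trans (ler_normD _ _))// lerD// /shell.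
  case: (boolP (u < `|t| <= v)) => [/andP[h1 h2]|_]; last by rewrite !mulr0 subr0 normr0.
  rewrite !mulr1 hg ?(le_lt_trans au)// mulrC -mulrBl normrM.
  rewrite (gtr0_norm (x := rho t)) ?rho_gt0//; last by lra.
  apply: ler_wpM2r; first by rewrite ltW// rho_gt0//; lra.
  rewrite distrC; apply: hd; first by rewrite au (le_trans uv).
  by rewrite distrC ger0_norm; lra.
have Pall : P c.
  pose N := Num.bound ((c - a) / d).
  have ca0 : 0 <= (c - a) / d by apply: divr_ge0; lra.
  have Nlt : (c - a) / d < N%:R := archi_boundP ca0.
  have N0 : 0 < N%:R :> R by apply: le_lt_trans Nlt.
  pose s (i : nat) := a + i%:R * ((c - a) / N%:R).
  have st : 0 <= (c - a) / N%:R by apply: divr_ge0; [lra | exact: ltW].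
  have sN : s N = c by rewrite /s mulrC divfK ?lt0r_neq0//; ring.
  have smono i j : (i <= j)%N -> s i <= s j.
    by move=> ij; rewrite /s lerD2l ler_wpM2r// ler_nat.
  have sa i : a <= s i by rewrite /s lerDl mulr_ge0.
  rewrite -sN; have : (N <= N)%N := leqnn N.
  elim: {1 3}N => [_|i IH iN]; first by rewrite /s mul0r addr0.
  apply: (Pstep (s i)) => //; first exact: smono.
  - by rewrite -sN; exact: smono.
  - rewrite (_ : s i.+1 - s i = (c - a) / N%:R); last by rewrite /s -natr1; ring.
    by rewrite ltr_pdivrMr// mulrC -ltr_pdivrMr.
  - by apply: IH; exact: ltnW.
have [k [bk tk hk]] := Pall; exists k; split => // t.
have -> : h t = h t * \1[a < `|t| <= c].
  case: (boolP (a < `|t| <= c)) => [_|out]; first by rewrite mulr1.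
  rewrite mulr0; apply: hac; apply: contra out => /andP[h1 h2].
  by rewrite h1 ltW.
apply: (le_trans (hk t)); rewrite mulrAC ler_pdivrMr// -mulrA ler_pM2l// mulrC.
exact: hC.
Qed.

End step_functions.

(** * Modulus of a complex number *)

Section complex_modulus.
Variable R : realType.
Implicit Types (z w : R[i]).

Lemma nrmE z : `|z| = (nrm z)%:C.
Proof. by []. Qed.

Lemma nrm_sq z : nrm z ^+ 2 = complex.Re z ^+ 2 + complex.Im z ^+ 2.
Proof. by case: z => a b /=; rewrite sqr_sqrtr// addr_ge0 ?sqr_ge0. Qed.

Lemma nrm_ge0 z : 0 <= nrm z.
Proof. by case: z => a b /=; rewrite sqrtr_ge0. Qed.

Lemma nrmM z w : nrm (z * w) = nrm z * nrm w.
Proof. exact: ComplexField.Normc.normcM. Qed.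

Lemma nrmV z : nrm z^-1 = (nrm z)^-1.
Proof. exact: ComplexField.Normc.normcV. Qed.

Lemma nrmD z w : nrm (z + w) <= nrm z + nrm w.
Proof. exact: le_normcD. Qed.

Lemma nrmN z : nrm (- z) = nrm z.
Proof. exact: normcN. Qed.

Lemma nrmB z w : nrm (z - w) <= nrm z + nrm w.
Proof. by rewrite -(nrmN w); exact: nrmD. Qed.

Lemma nrm_distC z w : nrm (z - w) = nrm (w - z).
Proof. by rewrite -nrmN opprB. Qed.

Lemma nrm0 : nrm (0 : R[i]) = 0.
Proof. exact: ComplexField.Normc.normc0. Qed.

Lemma nrm1 : nrm (1 : R[i]) = 1.
Proof. exact: ComplexField.Normc.normc1. Qed.

Lemma nrm_eq0 z : (nrm z == 0) = (z == 0).
Proof.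
apply/eqP/eqP => [/ComplexField.Normc.eq0_normc //|->]; exact: nrm0.
Qed.

Lemma nrm_gt0 z : (0 < nrm z) = (z != 0).
Proof. by rewrite lt0r nrm_eq0 nrm_ge0 andbT. Qed.

Lemma nrm_real (x : R) : nrm x%:C = `|x|.
Proof. by rewrite /= expr0n/= addr0 sqrtr_sqr. Qed.

Lemma nrmi : nrm ('i%C : R[i]) = 1.
Proof. by rewrite /= expr0n/= add0r expr1n sqrtr1. Qed.

Lemma Re_le_nrm z : `|complex.Re z| <= nrm z.
Proof.
rewrite -(ler_pXn2r (n := 2)) ?nnegrE ?nrm_ge0// nrm_sq real_normK ?num_real//.
by rewrite lerDl sqr_ge0.
Qed.

Lemma Im_le_nrm z : `|complex.Im z| <= nrm z.
Proof.
rewrite -(ler_pXn2r (n := 2)) ?nnegrE ?nrm_ge0// nrm_sq real_normK ?num_real//.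
by rewrite lerDr sqr_ge0.
Qed.

Lemma nrm_le_sq z (M : R) : 0 <= M ->
  complex.Re z ^+ 2 + complex.Im z ^+ 2 <= M ^+ 2 -> nrm z <= M.
Proof. by move=> M0 h; rewrite -(ler_pXn2r (n := 2)) ?nnegrE ?nrm_ge0// nrm_sq. Qed.

Lemma nrm_le_ReIm z : nrm z <= `|complex.Re z| + `|complex.Im z|.
Proof.
apply: nrm_le_sq; first by rewrite addr_ge0.
rewrite sqrrD !real_normK ?num_real//.
have : 0 <= `|complex.Re z| * `|complex.Im z| by rewrite mulr_ge0.
by lra.
Qed.

Lemma cReD z w : complex.Re (z + w) = complex.Re z + complex.Re w.
Proof. by case: z; case: w. Qed.

Lemma cImD z w : complex.Im (z + w) = complex.Im z + complex.Im w.
Proof. by case: z; case: w. Qed.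

Lemma cReN z : complex.Re (- z) = - complex.Re z.
Proof. by case: z. Qed.

Lemma cImN z : complex.Im (- z) = - complex.Im z.
Proof. by case: z. Qed.

Lemma cReM z w : complex.Re (z * w) =
  complex.Re z * complex.Re w - complex.Im z * complex.Im w.
Proof. by case: z; case: w. Qed.

Lemma cImM z w : complex.Im (z * w) =
  complex.Re z * complex.Im w + complex.Im z * complex.Re w.
Proof. by case: z => a b; case: w. Qed.

Lemma cReV z : complex.Re z^-1 = complex.Re z / (complex.Re z ^+ 2 + complex.Im z ^+ 2).
Proof. by case: z. Qed.

Lemma cImV z : complex.Im z^-1 = - complex.Im z / (complex.Re z ^+ 2 + complex.Im z ^+ 2).
Proof. by case: z => a b; rewrite mulNr. Qed.

Lemma complex_ext z w : complex.Re z = complex.Re w -> complex.Im z = complex.Im w -> z = w.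
Proof. by case: z => a b; case: w => c d /= -> ->. Qed.

End complex_modulus.

(** * Second order estimates *)

Section calculus.
Variable R : realType.

Lemma sin_le_id (h : R) : 0 <= h -> `|sin h| <= h.
Proof.
move=> h0.
have [|c _] := @MVT_segment R sin cos 0 h h0 (fun x _ => is_derive_sin x).
  by apply: continuous_subspaceT; exact: continuous_sin.
rewrite sin0 !subr0 => ->; rewrite normrM (ger0_norm h0).
by rewrite ler_piMl// cos_max.
Qed.

Lemma cos_taylor0 (h : R) : 0 <= h -> `|cos h - 1| <= h ^+ 2.
Proof.
move=> h0.
have [|c /itvP ch] := @MVT_segment R cos (fun x => - sin x) 0 h h0 (fun x _ => is_derive_cos x).
  by apply: continuous_subspaceT; exact: continuous_cos.
rewrite cos0 !subr0 => ->; rewrite normrM (ger0_norm h0) expr2 normrN.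
by apply: ler_wpM2r => //; apply: (le_trans (sin_le_id _)); rewrite ch.
Qed.

Lemma sin_taylor0 (h : R) : 0 <= h -> `|sin h - h| <= h ^+ 3.
Proof.
move=> h0.
have der (x : R) : x \in `]0, h[ -> is_derive x 1 (fun x => sin x - x) (cos x - 1).
  by move=> _; apply: is_deriveB.
have [|c /itvP ch] := MVT_segment h0 der.
  apply: continuous_subspaceT => x; apply: cvgB; first exact: continuous_sin.
  exact: cvg_id.
rewrite sin0 !subr0 => ->; rewrite normrM (ger0_norm h0) exprSr.
apply: ler_wpM2r => //; apply: (le_trans (cos_taylor0 _)); rewrite ?ch//.
by rewrite lerXn2r ?nnegrE ?ch.
Qed.

Lemma cis_taylor (h : R) : `|h| <= 1 -> `|cos h - 1| + `|sin h - h| <= 2 * h ^+ 2.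
Proof.
wlog h0 : h / 0 <= h => [hwlog|].
  case: (lerP 0 h) => [h0 /(hwlog _ h0)//|h0].
  have := hwlog (- h); rewrite oppr_ge0 (ltW h0) cosN sinN normrN sqrrN -opprD.
  by rewrite normrN; apply.
rewrite (ger0_norm h0) => h1.
have := cos_taylor0 h0; have := sin_taylor0 h0.
have : h ^+ 3 <= h ^+ 2 by rewrite exprSr ler_piMr// sqr_ge0.
by lra.
Qed.

(** An error of second order in h disappears from the difference quotients. *)
Lemma is_derive_approx (f g : R -> R) (x d K : R) : is_derive (0 : R) 1 g d ->
  (\forall h \near 0, `|f (x + h) - f x - (g h - g 0)| <= K * h ^+ 2) ->
  is_derive x 1 f d.
Proof.
move=> [dg gd] fg.
have K0 : 0 <= `|K| + 1 by rewrite addr_ge0.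
have gcvg : h^-1 *: (g (h *: 1 + 0) - g 0) @[h --> 0^'] --> d.
  by rewrite -gd; exact: dg.
suff fcvg : h^-1 *: (f (h *: 1 + x) - f x) @[h --> 0^'] --> d.
  apply: DeriveDef; first by apply/cvg_ex; exists d.
  exact: cvg_lim.
apply/cvgrPdist_le => eps e0.
have /cvgrPdist_le /(_ _ (divr_gt0 e0 (ltr0Sn _ 1))) {}gcvg := gcvg.
have eK : 0 < eps / 2 / (`|K| + 1) by rewrite !divr_gt0// ltr_wpDl.
have small : \forall h \near (0 : R)^', `|h| < eps / 2 / (`|K| + 1).
  exact: dnbhs0_lt.
have fg' : \forall h \near (0 : R)^', `|f (x + h) - f x - (g h - g 0)| <= K * h ^+ 2.
  exact: nbhs_dnbhs fg.
have nz : \forall h \near (0 : R)^', h != 0 by exact: nbhs_dnbhs_neq.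
near=> h.
have h0 : h != 0 by near: h.
have G : `|d - h^-1 *: (g (h *: 1 + 0) - g 0)| <= eps / 2 by near: h.
have F : `|f (x + h) - f x - (g h - g 0)| <= K * h ^+ 2 by near: h.
have Sm : `|h| < eps / 2 / (`|K| + 1) by near: h.
move: G; rewrite /GRing.scale /= !mulr1 addr0 => G.
rewrite (addrC h x).
rewrite (_ : d - _ = (d - h^-1 * (g h - g 0)) - h^-1 * (f (x + h) - f x - (g h - g 0))); last by ring.
rewrite (le_trans (ler_normB _ _))// [leRHS]splitr lerD// normrM normfV.
rewrite mulrC ler_pdivrMr ?normr_gt0//.
apply: (le_trans F); apply: (@le_trans _ _ ((`|K| + 1) * `|h| ^+ 2)).
  by rewrite real_normK ?num_real// ler_wpM2r ?sqr_ge0// (le_trans (ler_norm _))// lerDl.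
rewrite expr2 mulrA ler_wpM2r//.
by rewrite mulrC -ler_pdivlMr ?ltr_wpDl// ltW.
Unshelve. all: by end_near. Qed.

End calculus.

(** * The kernel t / (t + w) *)

Section kernels.
Variable R : realType.
Implicit Types (a b t : R).

(** The real part of |t| / (|t| + w) for w = a + ib; [ker_im] is minus the imaginary part. *)
Definition ker_re a b t : R := `|t| * (`|t| + a) / ((`|t| + a) ^+ 2 + b ^+ 2).
Definition ker_im a b t : R := `|t| * b / ((`|t| + a) ^+ 2 + b ^+ 2).

Lemma ker_den_gt0 a b t : 0 <= a -> 0 < a ^+ 2 + b ^+ 2 ->
  0 < (`|t| + a) ^+ 2 + b ^+ 2.
Proof.
move=> a0 ab; apply: (lt_le_trans ab); rewrite lerD2r lerXn2r ?nnegrE ?addr_ge0//.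
by rewrite lerDr.
Qed.

Lemma ker_scale_re a b l t : 0 < l -> ker_re (l * a) (l * b) t = ker_re a b (t / l).
Proof.
move=> l0; rewrite /ker_re normrM normfV (gtr0_norm l0).
have e : (`|t| + l * a) ^+ 2 + (l * b) ^+ 2 = l ^+ 2 * ((`|t| / l + a) ^+ 2 + b ^+ 2).
  by field; rewrite lt0r_neq0.
rewrite e invfM; set D := ((_ / l + a) ^+ 2 + _)^-1.
by field; rewrite lt0r_neq0.
Qed.

Lemma ker_scale_im a b l t : 0 < l -> ker_im (l * a) (l * b) t = ker_im a b (t / l).
Proof.
move=> l0; rewrite /ker_im normrM normfV (gtr0_norm l0).
have e : (`|t| + l * a) ^+ 2 + (l * b) ^+ 2 = l ^+ 2 * ((`|t| / l + a) ^+ 2 + b ^+ 2).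
  by field; rewrite lt0r_neq0.
rewrite e invfM; set D := ((_ / l + a) ^+ 2 + _)^-1.
by field; rewrite lt0r_neq0.
Qed.

Definition ker (w : R[i]) t : R[i] := `|t|%:C / (`|t|%:C + w).

Lemma Re_ker (w : R[i]) t : complex.Re (ker w t) = ker_re (complex.Re w) (complex.Im w) t.
Proof.
by case: w => a b; rewrite /ker /ker_re cReM cReV cImV /= add0r mul0r subr0 mulrA.
Qed.

Lemma Im_ker (w : R[i]) t : complex.Im (ker w t) = - ker_im (complex.Re w) (complex.Im w) t.
Proof.
by case: w => a b; rewrite /ker /ker_im cImM cReV cImV /= add0r mul0r addr0 mulrA mulrN mulNr.
Qed.

Lemma ker_den_sq (w : R[i]) t : 0 <= complex.Re w ->
  `|t| ^+ 2 + nrm w ^+ 2 <= nrm (`|t|%:C + w) ^+ 2.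
Proof.
move=> a0; rewrite !nrm_sq cReD cImD; set a := complex.Re w in a0 *.
set b := complex.Im w; rewrite [complex.Re _]/= [complex.Im _]/= add0r.
have : 0 <= `|t| * a by rewrite mulr_ge0.
by lra.
Qed.

Lemma ker_den_ge (w : R[i]) t r : 0 <= complex.Re w -> r <= nrm w -> 0 <= r ->
  r <= nrm (`|t|%:C + w).
Proof.
move=> a0 rw r0; rewrite -(ler_pXn2r (n := 2)) ?nnegrE ?nrm_ge0//.
apply: le_trans (ker_den_sq t a0).
rewrite (@le_trans _ _ (nrm w ^+ 2))//; first by rewrite lerXn2r ?nnegrE ?nrm_ge0.
by rewrite lerDr sqr_ge0.
Qed.

Lemma ker_cap (w : R[i]) t : 0 <= complex.Re w -> nrm w = 1 -> nrm (ker w t) <= cap t.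
Proof.
move=> a0 w1.
have n1 : 1 <= nrm (`|t|%:C + w) by apply: ker_den_ge; rewrite ?w1.
have nt : `|t| <= nrm (`|t|%:C + w).
  rewrite -(ler_pXn2r (n := 2)) ?nnegrE ?nrm_ge0//.
  by apply: le_trans (ker_den_sq t a0); rewrite lerDl sqr_ge0.
rewrite /ker nrmM nrmV nrm_real normr_id /cap le_min; apply/andP; split.
  rewrite ler_pdivrMr; last by lra.
  by rewrite ler_peMr.
by rewrite ler_pdivrMr ?mul1r//; lra.
Qed.

Lemma continuous_ker_den a b : continuous (fun t : R => (`|t| + a) ^+ 2 + b ^+ 2).
Proof.
move=> t; apply: cvgD; last exact: cvg_cst.
have h : (`|s| + a) @[s --> t] --> `|t| + a.
  by apply: cvgD; [exact: continuous_norm | exact: cvg_cst].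
by rewrite expr2; under eq_fun do rewrite expr2; exact: cvgM.
Qed.

Lemma test_fun_ker a b : 0 <= a -> a ^+ 2 + b ^+ 2 = 1 ->
  test_fun (ker_re a b) /\ test_fun (ker_im a b).
Proof.
move=> a0 ab.
have n1 : nrm (a +i* b) = 1 by rewrite /= ab sqrtr1.
have den t : 0 < (`|t| + a) ^+ 2 + b ^+ 2 by apply: ker_den_gt0; rewrite ?ab.
have cden : continuous (fun t : R => ((`|t| + a) ^+ 2 + b ^+ 2)^-1).
  move=> t; apply: cvgV; first by rewrite lt0r_neq0.
  exact: continuous_ker_den.
have cn : continuous (fun t : R => `|t|) := @continuous_norm _.
split; split.
- apply: continuousM_fun cden; apply: continuousM_fun => //.
  by apply: continuousD_fun => // t; exact: cvg_cst.
- by move=> t; rewrite /ker_re normrN.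
- exists 1 => t; rewrite mul1r; have := @ker_cap (a +i* b) t a0 n1.
  by apply: le_trans; rewrite -[ker_re _ _ _](Re_ker (a +i* b)); exact: Re_le_nrm.
- apply: continuousM_fun cden; apply: continuousM_fun => // t; exact: cvg_cst.
- by move=> t; rewrite /ker_im normrN.
- exists 1 => t; rewrite mul1r; have := @ker_cap (a +i* b) t a0 n1.
  apply: le_trans; rewrite -normrN -[- ker_im _ _ _](Im_ker (a +i* b)); exact: Im_le_nrm.
Qed.

Definition cis (x : R) : R[i] := cos x +i* sin x.

Lemma nrm_cis x : nrm (cis x) = 1.
Proof. by rewrite /= cos2Dsin2 sqrtr1. Qed.

Lemma cisD x y : cis (x + y) = cis x * cis y.
Proof. by apply: complex_ext; rewrite /= ?cosD ?sinD//; ring. Qed.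

(** The kernel t / (t + w) is holomorphic in w, so moving w by an angle h changes it, up
   to second order, by i times the change caused by dilating w by 1 + h. *)
Lemma ker_cauchy_riemann x h t : 0 <= cos x -> 0 <= cos (x + h) -> `|h| <= 1 / 2 ->
  nrm (ker (cis (x + h)) t - ker (cis x) t
     - 'i%C * (ker ((1 + h)%:C * cis x) t - ker (cis x) t)) <= 8 * h ^+ 2 * cap t.
Proof.
move=> cx cxh h2.
pose w := cis x; pose w1 := cis (x + h); pose w2 : R[i] := (1 + h)%:C * w.
pose T : R[i] := `|t|%:C.
pose delta : R[i] := (cos h - 1) +i* (sin h - h).
have h12 : - (1 / 2) <= h <= 1 / 2 by rewrite -ler_norml.
have nd : nrm delta <= 2 * h ^+ 2.
  apply: (le_trans (nrm_le_ReIm _)); apply: cis_taylor; lra.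
have w1E : w1 = w * (1 + 'i%C * h%:C + delta).
  rewrite /w1 cisD; congr (_ * _).
  by apply: complex_ext; rewrite /cis /= ?mul0r ?mul1r ?subr0 ?addr0 ?add0r; ring.
have n0 : 1 <= nrm (T + w) by apply: ker_den_ge; rewrite ?nrm_cis.
have n1 : 1 <= nrm (T + w1) by apply: ker_den_ge; rewrite ?nrm_cis.
have n2 : 1 / 2 <= nrm (T + w2).
  apply: ker_den_ge.
  - by rewrite /w2 cReM /= mul0r subr0 mulr_ge0//; lra.
  - by rewrite nrmM nrm_real nrm_cis mulr1 ger0_norm; lra.
  - by lra.
have z0 : T + w != 0 by rewrite -nrm_gt0; lra.
have z1 : T + w1 != 0 by rewrite -nrm_gt0; lra.
have z2 : T + w2 != 0 by rewrite -nrm_gt0; lra.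
have E : ker w1 t - ker w t - 'i%C * (ker w2 t - ker w t) =
   - (ker w t * w * (delta / (T + w1) +
        'i%C * h%:C * (w * (h%:C - 'i%C * h%:C - delta)) / ((T + w1) * (T + w2)))).
  rewrite /ker -/T.
  have e1 : T / (T + w1) - T / (T + w) = - (T * w * ('i%C * h%:C + delta) / ((T + w) * (T + w1))).
    rewrite -(mulrA T) (_ : w * ('i%C * h%:C + delta) = w1 - w); last by rewrite w1E; ring.
    by field; rewrite z0 z1.
  have e2 : T / (T + w2) - T / (T + w) = - (T * w * h%:C / ((T + w) * (T + w2))).
    rewrite -(mulrA T) (_ : w * h%:C = w2 - w); last by rewrite /w2 rmorphD rmorph1; ring.
    by field; rewrite z0 z2.
  have e3 : w * (h%:C - 'i%C * h%:C - delta) = w2 - w1.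
    by rewrite w1E /w2 rmorphD rmorph1; ring.
  rewrite e1 e2 e3.
  have e4 : delta / (T + w1) = ('i%C * h%:C + delta) / (T + w1) - 'i%C * h%:C / (T + w1).
    by rewrite -mulrBl; congr (_ / _); ring.
  rewrite e4; move: ('i%C * h%:C + delta) => u.
  rewrite -!mulrA (mulrCA 'i%C (h%:C)) (mulrCA 'i%C) .
  by field; rewrite z0 z1 z2.
rewrite E nrmN (nrmM (ker w t * w)) (nrmM (ker w t) w) nrm_cis mulr1 (mulrC _ (cap t)).
apply: ler_pM; rewrite ?nrm_ge0//.
  by apply: ker_cap => //; rewrite nrm_cis.
apply: (le_trans (nrmD _ _)); rewrite !nrmM !nrmV nrmi nrm_real mul1r nrm_cis mul1r nrmM.
have k1 : nrm delta / nrm (T + w1) <= 2 * h ^+ 2.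
  by rewrite (le_trans _ nd)// ler_pdivrMr ?ler_peMr ?nrm_ge0//; lra.
have hh : `|h| <= 1 / 2 by [].
have hn := normr_ge0 h.
have hs : h ^+ 2 = `|h| ^+ 2 by rewrite real_normK ?num_real.
have k2 : nrm (h%:C - 'i%C * h%:C - delta) <= 3 * `|h|.
  apply: (le_trans (nrmB _ _)).
  have := nrmB h%:C ('i%C * h%:C); rewrite nrmM nrmi mul1r nrm_real.
  by move: nd; rewrite hs; nra.
have k3 : (nrm (T + w1) * nrm (T + w2))^-1 <= 2.
  rewrite invf_ple ?posrE ?mulr_gt0//; try lra.
  have : 1 * (1 / 2) <= nrm (T + w1) * nrm (T + w2) by apply: ler_pM; lra.
  by lra.
have k4 : `|h| * nrm (h%:C - 'i%C * h%:C - delta) / (nrm (T + w1) * nrm (T + w2))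
    <= `|h| * (3 * `|h|) * 2.
  apply: ler_pM => //; first by rewrite mulr_ge0 ?nrm_ge0.
    by rewrite invr_ge0 mulr_ge0 ?nrm_ge0.
  by rewrite ler_wpM2l.
by lra.
Qed.

End kernels.

(** * Homogeneous functionals *)

Lemma near0_le (R : realType) (e : R) : 0 < e -> \forall h \near (0 : R), `|h| <= e.
Proof. exact: nbhs0_le. Qed.

Section homogeneous.
Variables (R : realType) (alpha : R) (L : (R -> R) -> R) (M : R).
Hypothesis L_lin : forall a b f g, test_fun f -> test_fun g ->
  L (fun t => a * f t + b * g t) = a * L f + b * L g.
Hypothesis L_bound : forall f C, test_fun f -> (forall t, `|f t| <= C * cap t) ->
  `|L f| <= C * M.
Hypothesis L_homog : forall f l, 0 < l -> test_fun f ->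
  L (fun t => f (t / l)) = l `^ (- alpha) * L f.

Let A x := L (ker_re (cos x) (sin x)).
Let B x := L (ker_im (cos x) (sin x)).

Lemma test_fun_ker_cis (x : R) : 0 <= cos x ->
  test_fun (ker_re (cos x) (sin x)) /\ test_fun (ker_im (cos x) (sin x)).
Proof. by move=> cx; apply: test_fun_ker => //; exact: cos2Dsin2. Qed.

Lemma ker_dilate (x h : R) : 0 <= cos x -> -1 < h ->
  [/\ test_fun (ker_re ((1 + h) * cos x) ((1 + h) * sin x)),
      test_fun (ker_im ((1 + h) * cos x) ((1 + h) * sin x)),
      L (ker_re ((1 + h) * cos x) ((1 + h) * sin x)) = (1 + h) `^ (- alpha) * A x &
      L (ker_im ((1 + h) * cos x) ((1 + h) * sin x)) = (1 + h) `^ (- alpha) * B x].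
Proof.
move=> cx h1; have [tr ti] := test_fun_ker_cis cx.
have l0 : 0 < 1 + h by lra.
have er : ker_re ((1 + h) * cos x) ((1 + h) * sin x) =
    (fun t => ker_re (cos x) (sin x) (t / (1 + h))).
  by apply/funext => t; rewrite ker_scale_re.
have ei : ker_im ((1 + h) * cos x) ((1 + h) * sin x) =
    (fun t => ker_im (cos x) (sin x) (t / (1 + h))).
  by apply/funext => t; rewrite ker_scale_im.
by rewrite er ei; split; try exact: test_fun_scale; rewrite L_homog.
Qed.

(** Applying L to the Cauchy-Riemann estimate: the dilated kernels are evaluated by
   homogeneity, so only the angular increments remain unknown. *)
Lemma kernel_limits_increment (x h : R) : 0 <= cos x -> 0 <= cos (x + h) -> `|h| <= 1 / 2 ->
  `|A (x + h) - A x - ((1 + h) `^ (- alpha) - 1) * B x| <= 8 * M * h ^+ 2 /\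
  `|B (x + h) - B x + ((1 + h) `^ (- alpha) - 1) * A x| <= 8 * M * h ^+ 2.
Proof.
move=> cx cxh h2.
have h1 : -1 < h by move: h2; rewrite ler_norml => /andP[]; lra.
have [tr ti] := test_fun_ker_cis cx; have [tr1 ti1] := test_fun_ker_cis cxh.
have [tr2 ti2 Lr2 Li2] := ker_dilate cx h1.
have est t := ker_cauchy_riemann t cx cxh h2.
pose F t := 1 * (1 * ker_re (cos (x + h)) (sin (x + h)) t + (- 1) * ker_re (cos x) (sin x) t)
  + (- 1) * (1 * ker_im ((1 + h) * cos x) ((1 + h) * sin x) t + (- 1) * ker_im (cos x) (sin x) t).
pose G t := 1 * (1 * ker_im (cos (x + h)) (sin (x + h)) t + (- 1) * ker_im (cos x) (sin x) t)
  + 1 * (1 * ker_re ((1 + h) * cos x) ((1 + h) * sin x) t + (- 1) * ker_re (cos x) (sin x) t).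
have tF : test_fun F.
  exact: (test_fun_lin 1 (-1) (test_fun_lin 1 (-1) tr1 tr) (test_fun_lin 1 (-1) ti2 ti)).
have tG : test_fun G.
  exact: (test_fun_lin 1 1 (test_fun_lin 1 (-1) ti1 ti) (test_fun_lin 1 (-1) tr2 tr)).
have LF : L F = A (x + h) - A x - ((1 + h) `^ (- alpha) - 1) * B x.
  rewrite /F L_lin; try by apply: test_fun_lin.
  by rewrite !L_lin// Li2 /A /B; ring.
have LG : L G = B (x + h) - B x + ((1 + h) `^ (- alpha) - 1) * A x.
  rewrite /G L_lin; try by apply: test_fun_lin.
  by rewrite !L_lin// Lr2 /A /B; ring.
have RI t : F t = complex.Re (ker (cis (x + h)) t - ker (cis x) t
     - 'i%C * (ker ((1 + h)%:C * cis x) t - ker (cis x) t)) /\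
   G t = - complex.Im (ker (cis (x + h)) t - ker (cis x) t
     - 'i%C * (ker ((1 + h)%:C * cis x) t - ker (cis x) t)).
  rewrite !(cReD, cReN, cImD, cImN, cReM, cImM, Re_ker, Im_ker).
  by rewrite /F /G /=; split; rewrite !mul0r ?subr0 ?addr0; ring.
rewrite -LF -LG -!(mulrAC _ (h ^+ 2)); split; apply: L_bound => // t.
- by have [-> _] := RI t; apply: le_trans (Re_le_nrm _) (est t).
- by have [_ ->] := RI t; rewrite normrN; apply: le_trans (Im_le_nrm _) (est t).
Qed.

Lemma is_derive_dilation (c : R) :
  is_derive (0 : R) 1 (fun h => (1 + h) `^ (- alpha) * c) (- alpha * c).
Proof.
have H : is_derive (0 : R) 1 (fun h => 1 + h) (0 + 1) by apply: is_deriveD.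
have P : is_derive ((fun h => 1 + h) (0 : R)) 1 (fun y : R => y `^ (- alpha)) (- alpha * (1 + 0) `^ (- alpha - 1)).
  by apply: is_derive1_powR; rewrite addr0.
have C := is_derive1_comp (f := fun y : R => y `^ (- alpha)) P H.
have D := is_deriveM C (is_derive_cst c (0 : R) 1).
apply: is_derive_eq D _.
by rewrite /= addr0 powR1 /GRing.scale /=; ring.
Qed.

Lemma cos_ge0_quarter (x : R) : 0 <= x <= pi / 2 -> 0 <= cos x.
Proof.
move=> /andP[x0 x1]; apply: cos_ge0_pihalf; rewrite x1 andbT.
by apply: le_trans x0; rewrite oppr_le0 divr_ge0// pi_ge0.
Qed.

Lemma kernel_limits_derive x : 0 < x < pi / 2 ->
  is_derive x 1 A (- alpha * B x) /\ is_derive x 1 B (alpha * A x).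
Proof.
move=> /andP[x0 x1].
have near_ok : \forall h \near (0 : R), [/\ 0 <= cos x, 0 <= cos (x + h) & `|h| <= 1 / 2].
  near=> h.
  have hx : `|h| <= Num.min x (pi / 2 - x) by near: h; apply: near0_le; rewrite lt_min x0 subr_gt0.
  have hh : `|h| <= 1 / 2 by near: h; apply: near0_le.
  rewrite le_min !ler_norml in hx; have /andP[/andP[h1 h2] /andP[h3 h4]] := hx.
  split; [apply: cos_ge0_quarter; apply/andP; split; lra |
          apply: cos_ge0_quarter; apply/andP; split; lra |].
  exact: hh.
split.
- apply: (is_derive_approx (K := 8 * M) (is_derive_dilation (B x))).
  near=> h.
  have [cx cxh h2] : [/\ 0 <= cos x, 0 <= cos (x + h) & `|h| <= 1 / 2] by near: h.
  have [+ _] := kernel_limits_increment cx cxh h2.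
  by rewrite addr0 powR1 mulrBl.
- have -> : alpha * A x = - alpha * (- A x) by ring.
  apply: (is_derive_approx (K := 8 * M) (is_derive_dilation (- A x))).
  near=> h.
  have [cx cxh h2] : [/\ 0 <= cos x, 0 <= cos (x + h) & `|h| <= 1 / 2] by near: h.
  have [_] := kernel_limits_increment cx cxh h2.
  by rewrite addr0 powR1 -mulrBl mulrN opprK.
Unshelve. all: by end_near. Qed.

Lemma dilation_cvg0 (c : R) : (1 + h) `^ (- alpha) * c @[h --> (0 : R)] --> c.
Proof.
have [D _] := is_derive_dilation c.
have h := differentiable_continuous (iffLR (derivable1_diffP _ _) D).
have e : (fun h : R => (1 + h) `^ (- alpha) * c) 0 = c by rewrite addr0 powR1 mul1r.
by rewrite -[X in _ --> X]e; exact: h.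
Qed.

Lemma within_continuous_eps (f : R -> R) (a b : R) :
  (forall x eps, a <= x <= b -> 0 < eps ->
     \forall h \near (0 : R), a <= x + h <= b -> `|f (x + h) - f x| <= eps) ->
  {within `[a, b], continuous f}.
Proof.
move=> hf; apply/subspace_continuousP => x xab; apply/cvgrPdist_le => eps e0.
have xab' : a <= x <= b by move: xab; rewrite /= in_itv.
have [d /= d0 hd] := hf x eps xab' e0.
exists d => //= y xy yab; rewrite distrC.
have e : x + (y - x) = y by ring.
have := hd (y - x); rewrite e; apply.
  by rewrite /= sub0r normrN distrC.
by move: yab; rewrite in_itv.
Qed.

Lemma kernel_limits_continuous :
  {within `[0, pi / 2], continuous A} /\ {within `[0, pi / 2], continuous B}.
Proof.
have quad eps : 0 < eps -> \forall h \near (0 : R), 8 * M * h ^+ 2 <= eps / 2.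
  move=> e0; have M8 : 0 < 8 * `|M| + 1 by rewrite ltr_wpDl// mulr_ge0.
  near=> h.
  have h1 : `|h| <= 1 by near: h; apply: near0_le.
  have h2 : `|h| <= eps / 2 / (8 * `|M| + 1).
    by near: h; apply: near0_le; rewrite !divr_gt0.
  move: h2; rewrite ler_pdivlMr// => h2.
  have -> : h ^+ 2 = `|h| ^+ 2 by rewrite real_normK ?num_real.
  have hn := normr_ge0 h; have : `|h| ^+ 2 <= `|h| by rewrite expr2 ler_piMr.
  have := ler_norm M; have := normr_ge0 M.
  by move: (`|h|) (`|M|) hn h1 h2 => a m; nra.
have dil c eps : 0 < eps ->
    \forall h \near (0 : R), `|((1 + h) `^ (- alpha) - 1) * c| <= eps / 2.
  move=> e0; have /cvgrPdist_le /(_ _ (divr_gt0 e0 (ltr0Sn _ 1))) := @dilation_cvg0 c.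
  by apply: filterS => h; rewrite distrC mulrBl mul1r.
split; apply: within_continuous_eps => x eps x01 e0.
- near=> h => xh01.
  have h2 : `|h| <= 1 / 2 by near: h; apply: near0_le.
  have [+ _] := kernel_limits_increment (cos_ge0_quarter x01) (cos_ge0_quarter xh01) h2.
  have q1 : 8 * M * h ^+ 2 <= eps / 2 by near: h; exact: quad.
  have q2 : `|((1 + h) `^ (- alpha) - 1) * B x| <= eps / 2 by near: h; exact: dil.
  move: (A (x + h) - A x) (((1 + h) `^ (- alpha) - 1) * B x) q2 => u v.
  by rewrite !ler_norml => /andP[? ?] /andP[? ?]; apply/andP; split; lra.
- near=> h => xh01.
  have h2 : `|h| <= 1 / 2 by near: h; apply: near0_le.
  have [_] := kernel_limits_increment (cos_ge0_quarter x01) (cos_ge0_quarter xh01) h2.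
  have q1 : 8 * M * h ^+ 2 <= eps / 2 by near: h; exact: quad.
  have q2 : `|((1 + h) `^ (- alpha) - 1) * A x| <= eps / 2 by near: h; exact: dil.
  move: (B (x + h) - B x) (((1 + h) `^ (- alpha) - 1) * A x) q2 => u v.
  by rewrite !ler_norml => /andP[? ?] /andP[? ?]; apply/andP; split; lra.
Unshelve. all: by end_near. Qed.

(** Let K(x) = L (|t| / (|t| + e^(ix))) = A x - i B x. Homogeneity fixes the radial derivative
   of L (|t| / (|t| + w)), and the Cauchy-Riemann equations turn it into K' = - i alpha K.
   Hence the imaginary part of e^(i alpha x) K(x) is constant; it is 0 at x = 0, and its
   vanishing at x = pi / 2 is the claim. *)
Lemma homogeneous_ratio :
  L (fun t => `|t| / (t ^+ 2 + 1)) * cos (alpha * (pi / 2)) =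
  L (fun t => t ^+ 2 / (t ^+ 2 + 1)) * sin (alpha * (pi / 2)).
Proof.
pose H x := B x * cos (alpha * x) - A x * sin (alpha * x).
have pi2 : 0 <= pi / 2 :> R by rewrite divr_ge0// pi_ge0.
have [cA cB] := kernel_limits_continuous.
have lin (x : R) : is_derive x 1 (fun x => alpha * x) alpha.
  have := is_deriveM (is_derive_cst alpha x 1) (is_derive_id x 1).
  by move/is_derive_eq; apply; rewrite /GRing.scale /= ; ring.
have dH x : x \in `]0, (pi / 2)[ -> is_derive x 1 H 0.
  rewrite in_itv /= => /kernel_limits_derive [dA dB].
  have dc := is_derive1_comp (f := cos) (is_derive_cos (alpha * x)) (lin x).
  have ds := is_derive1_comp (f := sin) (is_derive_sin (alpha * x)) (lin x).
  have := is_deriveB (is_deriveM dB dc) (is_deriveM dA ds).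
  by move/is_derive_eq; apply; rewrite /GRing.scale /=; ring.
have cH : {within `[0, pi / 2], continuous H}.
  have clin (x : R) : (alpha * y) @[y --> x] --> alpha * x.
    by apply: cvgMr; exact: cvg_id.
  have cc : {within `[0, pi / 2], continuous (fun x => cos (alpha * x))}.
    apply: continuous_subspaceT => y; apply: (@cvg_comp _ _ _ (fun x => alpha * x) cos).
      exact: clin.
    exact: continuous_cos.
  have cs : {within `[0, pi / 2], continuous (fun x => sin (alpha * x))}.
    apply: continuous_subspaceT => y; apply: (@cvg_comp _ _ _ (fun x => alpha * x) sin).
      exact: clin.
    exact: continuous_sin.
  by move=> x; apply: cvgB; apply: cvgM; [exact: cB|exact: cc|exact: cA|exact: cs].
have [c _] := MVT_segment pi2 dH cH.
rewrite mul0r => /eqP; rewrite subr_eq0 => /eqP.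
rewrite /H mulr0 cos0 sin0 mulr1 mulr0 subr0.
have -> : B 0 = 0.
  have [t0 t1] := @test_fun_ker_cis 0 ltac:(by rewrite cos0).
  have := L_lin 0 0 t1 t1; rewrite !mul0r addr0 /B => L0.
  rewrite -[RHS]L0; congr L; apply/funext => t.
  by rewrite /ker_im sin0 mulr0 !mul0r addr0.
move/eqP; rewrite subr_eq0 => /eqP.
rewrite /A /B cos_pihalf sin_pihalf.
have -> : ker_im 0 1 = (fun t : R => `|t| / (t ^+ 2 + 1)).
  by apply/funext => t; rewrite /ker_im mulr1 addr0 expr1n real_normK ?num_real.
have -> // : ker_re 0 1 = (fun t : R => t ^+ 2 / (t ^+ 2 + 1)).
by apply/funext => t; rewrite /ker_re addr0 expr1n -expr2 real_normK ?num_real.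
Qed.

End homogeneous.

(** * Regular variation *)

Section regular_variation.
Variable R : realType.
Implicit Types (f g r : R -> R).

(** [regularly_varying] up to measurability, with the slowly varying factor eliminated. *)
Definition varies rho r :=
  (\forall y \near +oo, 0 < r y) /\
  forall l, 0 < l -> r (l * y) / r y @[y --> +oo] --> l `^ rho.

Lemma near_pinfty_gt (M : R) : \forall y \near +oo, M < y.
Proof. by apply: nbhs_pinfty_gt; rewrite num_real. Qed.

Lemma regularly_varying_varies rho r : regularly_varying rho r -> varies rho r.
Proof.
move=> [[A [_ rpos]] [l [[K [_ lpos]] lcvg] rl]]; split.
  by apply: filterS (near_pinfty_gt A) => y; exact: rpos.
move=> t t0.
have h : t `^ rho * (l (t * y) / l y) @[y --> +oo] --> t `^ rho * 1.
  by apply: cvgMr; exact: lcvg.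
rewrite mulr1 in h; apply: cvg_trans h; apply: near_eq_cvg; near=> y.
have y0 : 0 < y by near: y; exact: near_pinfty_gt.
have E1 : r y = y `^ rho * l y by near: y.
have E2 : r (t * y) = (t * y) `^ rho * l (t * y).
  by near: y; exact: near_pinfty_scale t0 rl.
rewrite E1 E2 powRM ?ltW//; have p0 : y `^ rho != 0 by rewrite lt0r_neq0// powR_gt0.
have ly : l y != 0 by rewrite lt0r_neq0// lpos//; near: y; exact: near_pinfty_gt.
by field; rewrite ly.
Unshelve. all: by end_near. Qed.

Lemma varies_regularly_varying rho r :
  (exists A : R, measurable_fun `]A, +oo[ r) -> varies rho r -> regularly_varying rho r.
Proof.
move=> [A mr] [/near_pinfty_ex [K K0 rK] rcvg].
pose A' := Num.max A K.
have AA' : A <= A' by rewrite le_max lexx.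
have KA' : K <= A' by rewrite le_max lexx orbT.
have mr' : measurable_fun `]A', +oo[ r.
  apply: measurable_funS mr => //.
  by move=> y /=; rewrite !in_itv/= !andbT; exact: le_lt_trans.
have rpos y : A' < y -> 0 < r y by move=> h; apply: rK; lra.
split; first by exists A'.
exists (fun y => r y * y `^ (- rho)).
  split.
    exists A'; split.
      apply: measurable_funM => //; apply: measurable_funTS.
      exact: (measurable_powR (- rho)).
    by move=> y h; rewrite mulr_gt0 ?rpos// powR_gt0//; lra.
  move=> t t0.
  have h : r (t * y) / r y * t `^ (- rho) @[y --> +oo] --> t `^ rho * t `^ (- rho).
    by apply: cvgMl; exact: rcvg.
  rewrite -powRD ?subrr ?powRr0 in h; last by rewrite (lt0r_neq0 t0) implybT.
  apply: cvg_trans h; apply: near_eq_cvg; near=> y.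
  have y0 : 0 < y by near: y; exact: near_pinfty_gt.
  have p0 : y `^ (- rho) != 0 by rewrite lt0r_neq0// powR_gt0.
  have ry : r y != 0 by rewrite lt0r_neq0// rpos//; near: y; exact: near_pinfty_gt.
  by rewrite powRM ?ltW//; field; rewrite ?ry ?p0.
near=> y; have y0 : 0 < y by near: y; exact: near_pinfty_gt.
rewrite mulrCA -powRD ?subrr ?powRr0 ?mulr1//.
by rewrite (lt0r_neq0 y0) implybT.
Unshelve. all: by end_near. Qed.

Lemma varies_equiv rho f g k : varies rho g -> f y / g y @[y --> +oo] --> k -> 0 < k ->
  varies rho f.
Proof.
move=> [g0 gcvg] fg k0.
have /cvgrPdist_lt /(_ _ k0) fpos := fg.
have f0 : \forall y \near +oo, 0 < f y.
  near=> y; have gy : 0 < g y by near: y.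
  have : `|k - f y / g y| < k by near: y.
  rewrite ltr_norml => /andP[_]; rewrite ltrBlDr ltrDl.
  by rewrite pmulr_lgt0// invr_gt0.
split=> // l l0.
have h : (f (l * y) / g (l * y)) * (g (l * y) / g y) * (f y / g y)^-1 @[y --> +oo] -->
    k * l `^ rho * k^-1.
  apply: cvgM; last by apply: cvgV => //; rewrite lt0r_neq0.
  by apply: cvgM; [exact: (cvg_pinfty_scale l0 fg) | exact: gcvg].
rewrite mulrAC mulfV ?lt0r_neq0// mul1r in h.
apply: cvg_trans h; apply: near_eq_cvg; near=> y.
have gy : 0 < g y by near: y.
have gly : 0 < g (l * y) by near: y; exact: near_pinfty_scale l0 g0.
have fy : 0 < f y by near: y.
by field; rewrite !lt0r_neq0.
Unshelve. all: by end_near. Qed.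

Lemma varies_power rho n r : varies rho r -> varies (rho - n%:R) (fun y => r y / y ^+ n).
Proof.
move=> [r0 rcvg]; split.
  near=> y; have y0 : 0 < y by near: y; exact: near_pinfty_gt.
  by rewrite divr_gt0 ?exprn_gt0//; near: y.
move=> l l0.
have h : r (l * y) / r y * (l ^+ n)^-1 @[y --> +oo] --> l `^ rho * (l ^+ n)^-1.
  by apply: cvgMl; exact: rcvg.
rewrite powRD ?(lt0r_neq0 l0) ?implybT// powRN powR_mulrn ?ltW//.
apply: cvg_trans h; apply: near_eq_cvg; near=> y.
have y0 : 0 < y by near: y; exact: near_pinfty_gt.
have ry : r y != 0 by rewrite lt0r_neq0//; near: y.
by rewrite exprMn; field; rewrite ry !expf_neq0// lt0r_neq0.
Unshelve. all: by end_near. Qed.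

Lemma varies_powerM rho n r : varies rho r -> varies (rho + n%:R) (fun y => y ^+ n * r y).
Proof.
move=> [r0 rcvg]; split.
  near=> y; have y0 : 0 < y by near: y; exact: near_pinfty_gt.
  by rewrite mulr_gt0 ?exprn_gt0//; near: y.
move=> l l0.
have h : l ^+ n * (r (l * y) / r y) @[y --> +oo] --> l ^+ n * l `^ rho.
  by apply: cvgMr; exact: rcvg.
rewrite powRD ?(lt0r_neq0 l0) ?implybT// powR_mulrn ?ltW// mulrC.
apply: cvg_trans h; apply: near_eq_cvg; near=> y.
have y0 : 0 < y by near: y; exact: near_pinfty_gt.
have ry : r y != 0 by rewrite lt0r_neq0//; near: y.
by rewrite exprMn; field; rewrite ry expf_neq0// lt0r_neq0.
Unshelve. all: by end_near. Qed.

End regular_variation.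

(** * Stieltjes transforms on the imaginary axis *)

Section stieltjes.
Variables (R : realType) (mu : probability (measurableTypeR R) R).
Local Notation E := (mean mu).

(** These are the transforms met on the imaginary axis:
   y (G(iy) - 1/(iy)) = i [stieltjes_sq] y - [stieltjes_lin] y; the even [stieltjes_abs] is
   tied to the first by homogeneity and to the second by the balance of the tails. *)
Definition stieltjes_sq (y : R) := E (fun t => t ^+ 2 / (t ^+ 2 + y ^+ 2)).
Definition stieltjes_lin (y : R) := E (fun t => y * t / (t ^+ 2 + y ^+ 2)).
Definition stieltjes_abs (y : R) := E (fun t => y * `|t| / (t ^+ 2 + y ^+ 2)).
(** Integrating a function of |t| against sgn - theta measures the defect from balance
   theta: the defect vanishes in the limit exactly when the tails are balanced. *)
Definition balance (theta t : R) := Num.sg t - theta.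

Lemma sq_den_gt0 (t y : R) : 0 < y -> 0 < t ^+ 2 + y ^+ 2.
Proof. by move=> y0; rewrite ltr_wpDl ?sqr_ge0// exprn_gt0. Qed.

Lemma continuous_sq_den (y : R) : 0 < y -> continuous (fun t : R => (t ^+ 2 + y ^+ 2)^-1).
Proof.
move=> y0 t; apply: cvgV; first by rewrite lt0r_neq0// sq_den_gt0.
by apply: cvgD; [exact: exprn_continuous | exact: cvg_cst].
Qed.

Lemma sq_ratio_bound (t y : R) : 0 < y -> 0 <= t ^+ 2 / (t ^+ 2 + y ^+ 2) <= 1.
Proof.
move=> y0; have d := sq_den_gt0 t y0.
by rewrite divr_ge0 ?sqr_ge0 ?(ltW d)//= ler_pdivrMr// mul1r lerDl sqr_ge0.
Qed.

Lemma abs_ratio_bound (t y : R) : 0 < y -> 0 <= y * `|t| / (t ^+ 2 + y ^+ 2) <= 1.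
Proof.
move=> y0; have d := sq_den_gt0 t y0.
rewrite divr_ge0 ?mulr_ge0 ?(ltW d) ?(ltW y0)//= ler_pdivrMr// mul1r.
rewrite -(real_normK (num_real t)); have := sqr_ge0 (`|t| - y).
have : 0 <= y * `|t| by rewrite mulr_ge0// ltW.
by lra.
Qed.

Lemma bmeas_sq y : 0 < y -> bmeas (fun t : R => t ^+ 2 / (t ^+ 2 + y ^+ 2)).
Proof.
move=> y0; apply: (@bmeas_continuous _ _ 1).
  by apply: continuousM_fun; [exact: exprn_continuous | exact: continuous_sq_den].
by move=> t; have /andP[h0 h1] := sq_ratio_bound t y0; rewrite ger0_norm.
Qed.

Lemma bmeas_abs y : 0 < y -> bmeas (fun t : R => y * `|t| / (t ^+ 2 + y ^+ 2)).
Proof.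
move=> y0; apply: (@bmeas_continuous _ _ 1).
  apply: continuousM_fun; last exact: continuous_sq_den.
  by move=> t; apply: cvgMr; exact: continuous_norm.
by move=> t; have /andP[h0 h1] := abs_ratio_bound t y0; rewrite ger0_norm.
Qed.

Lemma bmeas_lin y : 0 < y -> bmeas (fun t : R => y * t / (t ^+ 2 + y ^+ 2)).
Proof.
move=> y0; apply: (@bmeas_continuous _ _ 1).
  apply: continuousM_fun; last exact: continuous_sq_den.
  by move=> t; apply: cvgMr; exact: cvg_id.
move=> t; have /andP[h0 h1] := abs_ratio_bound t y0.
by rewrite !normrM (gtr0_norm y0) normfV (gtr0_norm (sq_den_gt0 t y0)).
Qed.

Lemma sg_indicator (t : R) : Num.sg t = \1[0 < t] - \1[t < 0].
Proof. by case: sgrP => _; rewrite ?subr0 ?sub0r. Qed.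

Lemma weight_balance theta : -1 <= theta <= 1 -> weight (balance theta).
Proof.
move=> /andP[h1 h2]; split.
  rewrite (_ : balance theta = (fun t => (\1[0 < t] - \1[t < 0]) - theta)).
    by apply: bmeasB; [apply: bmeasB; exact: bmeas_lt | exact: bmeas_cst].
  by apply/funext => t; rewrite /balance sg_indicator.
move=> t; rewrite /balance; case: sgrP => _; rewrite ler_norml; lra.
Qed.

Lemma truncated_second_momentE : truncated_second_moment mu = moment2 mu.
Proof.
apply/funext => y; rewrite /truncated_second_moment /moment2 /mean Rintegral_mkcond.
apply: eq_Rintegral => t _; rewrite patchE ler_norml.
rewrite mem_setE in_itv /=; case: (- y <= t <= y); rewrite ?mulr1 ?mulr0//.
Qed.

Variable V : R -> R.
Local Notation S := (rescaled mu V).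

Lemma rescaled_sq l y : 0 < y ->
  S (fun=> 1) (fun t => t ^+ 2 / (t ^+ 2 + l ^+ 2)) y = stieltjes_sq (l * y) / V y.
Proof.
move=> y0; congr (mean _ _ / _); apply/funext => t; rewrite mul1r.
have e : (t / y) ^+ 2 + l ^+ 2 = (t ^+ 2 + (l * y) ^+ 2) / y ^+ 2 by field; rewrite lt0r_neq0.
by rewrite e invfM invrK expr_div_n mulrA mulrAC divfK// expf_neq0// lt0r_neq0.
Qed.

Lemma rescaled_abs l y : 0 < y -> 0 < l ->
  S (fun=> 1) (fun t => `|t| / (t ^+ 2 + l ^+ 2)) y = l^-1 * (stieltjes_abs (l * y) / V y).
Proof.
move=> y0 l0; have ly := mulr_gt0 l0 y0.
rewrite mulrA /stieltjes_abs -meanZ; last exact: bmeas_abs.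
congr (mean _ _ / _); apply/funext => t; rewrite mul1r.
have e : (t / y) ^+ 2 + l ^+ 2 = (t ^+ 2 + (l * y) ^+ 2) / y ^+ 2 by field; rewrite lt0r_neq0.
rewrite e normrM normfV (gtr0_norm y0); field.
by rewrite !lt0r_neq0// sq_den_gt0.
Qed.

Lemma rescaled_balance theta l y : -1 <= theta <= 1 -> 0 < y -> 0 < l ->
  S (balance theta) (fun t => `|t| / (t ^+ 2 + l ^+ 2)) y =
  l^-1 * ((stieltjes_lin (l * y) - theta * stieltjes_abs (l * y)) / V y).
Proof.
move=> th y0 l0; have ly := mulr_gt0 l0 y0.
have ba := bmeas_abs ly; have bl := bmeas_lin ly.
have bta : bmeas (fun t => theta * (l * y * `|t| / (t ^+ 2 + (l * y) ^+ 2))).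
  by apply: bmeasM => //; exact: bmeas_cst.
rewrite mulrA /stieltjes_abs /stieltjes_lin -(meanZ mu theta)// -meanB// -meanZ; last exact: bmeasB.
congr (mean _ _ / _); apply/funext => t.
have e : (t / y) ^+ 2 + l ^+ 2 = (t ^+ 2 + (l * y) ^+ 2) / y ^+ 2 by field; rewrite lt0r_neq0.
rewrite e normrM normfV (gtr0_norm y0) /balance (_ : l * y * t = l * y * (Num.sg t * `|t|)); last by rewrite -numEsg.
by field; rewrite !lt0r_neq0// sq_den_gt0.
Qed.

Lemma rescaled_tail s y : 0 < y -> S (fun=> 1) (fun t => \1[s < `|t|]) y = tail mu (s * y) / V y.
Proof.
move=> y0; congr (mean _ _ / _); apply/funext => t.
by rewrite mul1r normrM normfV (gtr0_norm y0) ltr_pdivlMr.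
Qed.

Lemma rescaled_moment2 s y : 0 < y ->
  S (fun=> 1) (fun t => t ^+ 2 * \1[`|t| <= s]) y = moment2 mu (s * y) / (y ^+ 2 * V y).
Proof.
move=> y0; rewrite invfM mulrA mulrC /moment2 [in RHS]mulrC; congr (_ * _).
rewrite mulrC -meanZ; last exact: bmeas_sq_trunc.
congr mean; apply/funext => t.
rewrite mul1r normrM normfV (gtr0_norm y0) ler_pdivrMr// expr_div_n.
by rewrite mulrAC mulrC mulrA.
Qed.

Lemma rescaled_tail_balance theta s y : -1 <= theta <= 1 -> 0 < y -> 0 < s ->
  S (balance theta) (fun t => \1[s < `|t|]) y =
  (tail_balance mu (s * y) - theta) * (tail mu (s * y) / V y).
Proof.
move=> th y0 s0; set x := s * y; have x0 : 0 < x := mulr_gt0 s0 y0.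
have bp : bmeas (fun t : R => \1[x < t] : R) by apply: bmeas_lt.
have bm : bmeas (fun t : R => \1[t < - x] : R) by apply: bmeas_lt.
have pE : fine (mu `]x, +oo[%classic) = E (fun t => \1[x < t]).
  rewrite -(mean_indic mu); last exact: measurable_itv.
  congr mean; apply/funext => t; rewrite indicE; congr (nat_of_bool _)%:R.
  by rewrite mem_setE in_itv/= andbT.
have mE : fine (mu `]-oo, (- x)[%classic) = E (fun t => \1[t < - x]).
  rewrite -(mean_indic mu); last exact: measurable_itv.
  congr mean; apply/funext => t; rewrite indicE; congr (nat_of_bool _)%:R.
  by rewrite mem_setE in_itv.
have tE : tail mu x = E (fun t => \1[x < t]) + E (fun t => \1[t < - x]).
  rewrite -meanD//; congr mean; apply/funext => t; rewrite lter_normr.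
  rewrite ltrNr; case: (ltP x t) => h1; case: (ltP t (- x)) => h2 //=; rewrite ?addr0 ?add0r//.
  by exfalso; lra.
have p0 : 0 <= E (fun t => \1[x < t]).
  by apply: Rintegral_ge0 => t _; case: (x < t).
have m0 : 0 <= E (fun t => \1[t < - x]).
  by apply: Rintegral_ge0 => t _; case: (t < - x).
rewrite mulrA /rescaled; congr (_ / _).
have -> : E (fun t => balance theta t * \1[s < `|t / y|]) =
   (1 - theta) * E (fun t => \1[x < t]) + (- 1 - theta) * E (fun t => \1[t < - x]).
  rewrite -meanZ// -meanZ// -meanD; try by apply: bmeasM => //; exact: bmeas_cst.
  congr mean; apply/funext => t.
  rewrite normrM normfV (gtr0_norm y0) ltr_pdivlMr// -/x /balance lter_normr ltrNr.
  case: (ltP x t) => h1; case: (ltP t (- x)) => h2; rewrite /= ?mulr0 ?mulr1 ?addr0 ?add0r//.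
  - by exfalso; lra.
  - by rewrite gtr0_sg//; lra.
  - by rewrite ltr0_sg//; lra.
rewrite tE /tail_balance pE mE.
set p := E _ in p0 *; set m := E _ in m0 *.
have [pm|pm] := eqVneq (p + m) 0; last by field.
have -> : p = 0 by lra.
have -> : m = 0 by lra.
by rewrite !mulr0 addr0 !mulr0.
Qed.

End stieltjes.

(** * From tails to Stieltjes transforms *)

Section abel_tauber.
Variables (R : realType) (mu : probability (measurableTypeR R) R) (alpha theta : R).
Hypotheses (alpha01 : 0 < alpha < 1) (theta1 : -1 <= theta <= 1).
Local Notation tau := (tan (pi * alpha / 2)).
Local Notation A := (stieltjes_sq mu).
Local Notation B := (stieltjes_lin mu).

(** The real form of the expansion of G(iy) - 1/(iy). *)
Definition stieltjes_varies :=
  varies (- alpha) A /\ B y / A y @[y --> +oo] --> theta * tau.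

Let ksq (t : R) : R := t ^+ 2 / (t ^+ 2 + 1).
Let kabs (t : R) : R := `|t| / (t ^+ 2 + 1).

Lemma ksqE : ksq = ker_re 0 1.
Proof.
by apply/funext => t; rewrite /ker_re addr0 expr1n -expr2 real_normK ?num_real.
Qed.

Lemma kabsE : kabs = ker_im 0 1.
Proof.
by apply/funext => t; rewrite /ker_im mulr1 addr0 expr1n real_normK ?num_real.
Qed.

Lemma test_fun_ksq : test_fun ksq.
Proof. by rewrite ksqE; have [] := @test_fun_ker R 0 1 (lexx 0) ltac:(by rewrite expr1n expr0n add0r). Qed.

Lemma test_fun_kabs : test_fun kabs.
Proof. by rewrite kabsE; have [] := @test_fun_ker R 0 1 (lexx 0) ltac:(by rewrite expr1n expr0n add0r). Qed.

Lemma cos_half_gt0 : 0 < cos (alpha * (pi / 2)).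
Proof.
have /andP[a0 a1] := alpha01; have p0 := pi_gt0 R.
have p2 : 0 < pi / 2 :> R by rewrite divr_gt0.
apply: cos_gt0_pihalf; rewrite gtr_pMl// a1 andbT (@lt_trans _ _ 0)// ?oppr_lt0//.
exact: mulr_gt0.
Qed.

(** The tangent enters here, and only through homogeneity of the limit functional. *)
Lemma limit_ratio V : gauge mu alpha V ->
  (forall h, test_fun h -> tends false (rescaled mu V (fun=> 1) h)) ->
  limit_functional mu V kabs = limit_functional mu V ksq * tau.
Proof.
move=> gV tV.
have := homogeneous_ratio (limit_functional_lin tV) (limit_functional_bound gV tV)
  (limit_functional_homog gV tV).
rewrite -/ksq -/kabs => h; rewrite /tan (_ : pi * alpha / 2 = alpha * (pi / 2)); last by ring.
by rewrite mulrA -h mulfK// lt0r_neq0// cos_half_gt0.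
Qed.

Lemma cvg_eq_near (f g : R -> R) (l : R) : (\forall y \near +oo, f y = g y) ->
  f y @[y --> +oo] --> l -> g y @[y --> +oo] --> l.
Proof. by move=> fg; apply: cvg_trans; exact: near_eq_cvg. Qed.

Lemma tends_true (f : R -> R) : tends true f -> f y @[y --> +oo] --> 0.
Proof. by move=> [l /(_ isT) ->]. Qed.

(** With the limit functional available for [V], both Stieltjes transforms are compared
   with [V]; the balanced weight controls their difference. *)
Lemma stieltjes_ratio V : gauge mu alpha V ->
  (forall h, test_fun h -> tends false (rescaled mu V (fun=> 1) h)) ->
  (forall h, test_fun h -> tends true (rescaled mu V (balance theta) h)) ->
  A y / V y @[y --> +oo] --> limit_functional mu V ksq /\
  B y / V y @[y --> +oo] --> theta * (limit_functional mu V ksq * tau).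
Proof.
move=> gV tV tb; split.
  apply: cvg_eq_near (limit_functional_cvg tV test_fun_ksq).
  near=> y; have y0 : 0 < y by near: y; exact: near_pinfty_gt.
  by have := rescaled_sq mu V 1 y0; rewrite expr1n mul1r.
have h1 := tends_true (tb _ test_fun_kabs).
have h2 := limit_functional_cvg tV test_fun_kabs; rewrite limit_ratio// in h2.
have h : rescaled mu V (balance theta) kabs y + theta * rescaled mu V (fun=> 1) kabs y
  @[y --> +oo] --> 0 + theta * (limit_functional mu V ksq * tau).
  by apply: cvgD => //; apply: cvgMr.
rewrite add0r in h; apply: cvg_eq_near h.
near=> y; have y0 : 0 < y by near: y; exact: near_pinfty_gt.
have := rescaled_abs mu V y0 ltr01; rewrite expr1n invr1 !mul1r => ->.
have := rescaled_balance mu V theta1 y0 ltr01; rewrite expr1n invr1 !mul1r => ->.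
by rewrite mulrA -mulrDl subrK.
Unshelve. all: by end_near. Qed.

Lemma moment2_ge0 y : 0 <= moment2 mu y.
Proof. by apply: Rintegral_ge0 => t _; rewrite mulr_ge0// sqr_ge0. Qed.

Lemma moment2_le x y : x <= y -> moment2 mu x <= moment2 mu y.
Proof.
move=> xy; apply: mean_le => [| |t]; try exact: bmeas_sq_trunc.
by apply: ler_wpM2l; [exact: sqr_ge0 | rewrite ler_nat; case: leP => // tx; rewrite (le_trans tx)].
Qed.

(** The gauge is V y = U y / y^2, with U the truncated second moment. Regular variation of U
   gives the limits of the functions t^2 on annuli, hence, by step functions, of all test
   functions; balance of the tails gives limit 0 for step functions against sgn - theta.
   Both Stieltjes kernels being test functions, the transforms follow. *)
Lemma class_C_stieltjes : class_C alpha theta mu -> stieltjes_varies.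
Proof.
rewrite /class_C truncated_second_momentE => -[/regularly_varying_varies [U0 UV] tbal].
have /andP[a0 a1] := alpha01.
pose V (y : R) : R := moment2 mu y / y ^+ 2.
have VV : varies (- alpha) V.
  have -> : - alpha = 2 - alpha - 2%:R by ring.
  exact: varies_power.
have gV : gauge mu alpha V.
  have [V0 Vcvg] := VV; split => // [x y x0 xy|y y0].
    rewrite /V !(mulrC _ (moment2 _ _ / _)) !divfK ?expf_neq0//; try by rewrite lt0r_neq0//; lra.
    exact: moment2_le.
  rewrite /V (mulrC (y ^+ 2)) divfK ?expf_neq0 ?lt0r_neq0//.
  by have := moment2_ge0 y; lra.
have t1 s : 0 < s -> tends false (rescaled mu V (fun=> 1) (fun t => t ^+ 2 * \1[`|t| <= s])).
  move=> s0; exists (s `^ (2 - alpha)) => //; apply: cvg_eq_near (UV s s0).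
  near=> y; have y0 : 0 < y by near: y; exact: near_pinfty_gt.
  by rewrite rescaled_moment2// /V (mulrC (y ^+ 2)) divfK// expf_neq0// lt0r_neq0.
have lin (b : bool) e (we : weight e) f g h c d := @tends_rescaled_lin R mu V b e we f g h c d.
have tV h : test_fun h -> tends false (rescaled mu V (fun=> 1) h).
  apply: (tends_test_fun alpha01 gV (@weight1 R)) => {}h.
  apply: (step_annulus alpha01 gV (@weight1 R) (rho := fun t => t ^+ 2)).
  - exact: exprn_continuous.
  - by move=> t; rewrite sqrrN.
  - by move=> t; rewrite normr_gt0 => t0; rewrite lt0r sqr_ge0 sqrf_eq0 t0.
  - move=> u v u0; exists (`|v| + v ^+ 2 + 1) => [|t]; first by rewrite ltr_wpDl// addr_ge0// sqr_ge0.
    case: (boolP (u < `|t| <= v)) => [/andP[h1 h2]|_]; last first.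
      by rewrite mulr0 mulr_ge0 ?cap_ge0// !addr_ge0// sqr_ge0.
    have v0 : 0 < v by lra.
    rewrite mulr1 (gtr0_norm v0) -(real_normK (num_real t)) /cap; case: (leP `|t| 1) => tle.
      by have := sqr_ge0 v; nra.
    by nra.
  - move=> u v u0 uv; have v0 : 0 < v by lra.
    apply: (lin _ _ (@weight1 R) _ _ _ 1 (-1) _ _ _ (t1 v v0) (t1 u u0)); try exact: bmeas_sq_trunc.
    move=> t; rewrite mul1r mulN1r -mulrBr; congr (_ * _).
    by case: (leP `|t| u) => h1; case: (leP `|t| v) => h2 //=; rewrite ?subrr ?subr0//; lra.
have tb h : test_fun h -> tends true (rescaled mu V (balance theta) h).
  have wb := weight_balance theta1.
  apply: (tends_test_fun alpha01 gV wb) => {}h.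
  have t2 s : 0 < s -> tends true (rescaled mu V (balance theta) (fun t => \1[s < `|t|])).
    move=> s0; have [l _ hl] := tends_tail alpha01 gV tV s0 (@weight1 R) tV.
    exists 0 => //.
    have h0 : (tail_balance mu (s * y) - theta) * rescaled mu V (fun=> 1) (fun t => \1[s < `|t|]) y
        @[y --> +oo] --> (theta - theta) * l.
      apply: cvgM => //; apply: cvgB; last exact: cvg_cst.
      exact: (cvg_pinfty_scale s0 tbal).
    rewrite subrr mul0r in h0; apply: cvg_eq_near h0.
    near=> y; have y0 : 0 < y by near: y; exact: near_pinfty_gt.
    by rewrite rescaled_tail_balance// rescaled_tail.
  apply: (step_annulus alpha01 gV wb (rho := fun=> 1)) => //.
  - by move=> t; exact: cvg_cst.
  - move=> u v u0; exists (1 + u^-1) => [|t]; first by rewrite addr_gt0// invr_gt0.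
    have u1 : 0 < u^-1 by rewrite invr_gt0.
    case: (boolP (u < `|t| <= v)) => [/andP[h1 h2]|_]; last first.
      by rewrite mulr0 mulr_ge0 ?cap_ge0// addr_ge0// ltW.
    have : 1 <= u^-1 * `|t| by rewrite mulrC ler_pdivlMr// mul1r ltW.
    rewrite mulr1 /cap; case: (leP `|t| 1) => t1' h3; last by rewrite mulr1 lerDl ltW.
    by rewrite mulrDl mul1r (le_trans h3)// lerDr.
  - move=> u v u0 uv; have v0 : 0 < v by lra.
    apply: (lin _ _ wb _ _ _ 1 (-1) _ _ _ (t2 u u0) (t2 v v0)); try exact: bmeas_norm_gt.
    move=> t; rewrite !mul1r mulN1r.
    by case: (ltP u `|t|) => h1; case: (leP `|t| v) => h2 //=; rewrite ?subrr ?subr0//; lra.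
have [hA hB] := stieltjes_ratio gV tV tb.
(* ksq is at least half of t^2 on |t| <= 1, whose rescaled integral is 1. *)
have kpos : 0 < limit_functional mu V ksq.
  have [l _ hl] := t1 1 ltr01.
  have one : rescaled mu V (fun=> 1) (fun t => t ^+ 2 * \1[`|t| <= 1]) y @[y --> +oo] --> (1 : R).
    apply: (@cvg_eq_near (fun=> 1)); last exact: cvg_cst.
    near=> y; have y0 : 0 < y by near: y; exact: near_pinfty_gt.
    have Uy : 0 < moment2 mu y by near: y.
    by rewrite rescaled_moment2// mul1r /V (mulrC (y ^+ 2)) divfK ?mulfV ?expf_neq0// lt0r_neq0.
  have half : 2^-1 * rescaled mu V (fun=> 1) (fun t => t ^+ 2 * \1[`|t| <= 1]) y @[y --> +oo] --> (2^-1 * 1 : R).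
    by apply: cvgMr.
  apply: (@lt_le_trans _ _ (2^-1 * 1)); first by rewrite mulr1 invr_gt0.
  apply: ler_cvg_to half (limit_functional_cvg tV test_fun_ksq) _.
  near=> y; have Vy : 0 < V y by near: y; exact: (near_gauge_gt0 gV).
  rewrite -rescaledZ; [|exact: weight1|exact: bmeas_sq_trunc].
  apply: rescaled1_le; [exact: ltW|by apply: bmeasM; [exact: bmeas_cst|exact: bmeas_sq_trunc]|exact: test_fun_bmeas test_fun_ksq|].
  move=> t; rewrite /ksq mulrCA; apply: ler_wpM2l; first exact: sqr_ge0.
  have d0 : 0 < t ^+ 2 + 1 by rewrite ltr_wpDl// sqr_ge0.
  case: (leP `|t| 1) => h1; rewrite ?mulr1 ?mulr0 ?invr_ge0 ?(ltW d0)//.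
  rewrite lef_pV2 ?posrE//; have : `|t| ^+ 2 <= 1 by rewrite exprn_ile1.
  by rewrite real_normK ?num_real//; lra.
split; first exact: varies_equiv VV hA kpos.
have h : (B y / V y) * (A y / V y)^-1 @[y --> +oo] -->
    theta * (limit_functional mu V ksq * tau) * (limit_functional mu V ksq)^-1.
  by apply: cvgM => //; apply: cvgV => //; rewrite lt0r_neq0.
rewrite (_ : theta * _ * _ = theta * tau) in h; last by field; rewrite lt0r_neq0.
apply: cvg_eq_near h; near=> y.
have Vy : 0 < V y by near: y; exact: (near_gauge_gt0 gV).
by move: (V y) Vy => v v0; rewrite invf_div -mulrA mulKf // lt0r_neq0.
Unshelve. all: by end_near. Qed.

End abel_tauber.

(** * From Stieltjes transforms to tails *)

Section tauber.
Variables (R : realType) (mu : probability (measurableTypeR R) R) (alpha theta : R).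
Hypotheses (alpha01 : 0 < alpha < 1) (theta1 : -1 <= theta <= 1).
Local Notation tau := (tan (pi * alpha / 2)).
Local Notation A := (stieltjes_sq mu).
Local Notation B := (stieltjes_lin mu).
Local Notation ksq := (fun t : R => t ^+ 2 / (t ^+ 2 + 1)).
Local Notation kabs := (fun t : R => `|t| / (t ^+ 2 + 1)).

Lemma ksq_le_cap (t : R) : 0 <= ksq t <= cap t.
Proof.
have d0 : 0 < t ^+ 2 + 1 by rewrite ltr_wpDl// sqr_ge0.
rewrite divr_ge0 ?sqr_ge0 ?(ltW d0)//= /cap le_min; apply/andP; split.
  rewrite ler_pdivrMr// -(real_normK (num_real t)).
  have := sqr_ge0 (`|t| - 1); have := normr_ge0 t; move: (`|t|) => a a0 sq.
  have : 0 <= a * ((a - 1) ^+ 2) by rewrite mulr_ge0.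
  have : 0 <= a * a by rewrite mulr_ge0.
  by lra.
by rewrite ler_pdivrMr// mul1r lerDl.
Qed.

Lemma kabs_le_cap (t : R) : 0 <= kabs t <= cap t.
Proof.
have d0 : 0 < t ^+ 2 + 1 by rewrite ltr_wpDl// sqr_ge0.
rewrite divr_ge0 ?(ltW d0)//= /cap le_min; apply/andP; split.
  by rewrite ler_pdivrMr// ler_peMr// lerDr sqr_ge0.
rewrite ler_pdivrMr// mul1r -(real_normK (num_real t)).
by have := sqr_ge0 (`|t| - 1); have := normr_ge0 t; lra.
Qed.

Lemma stieltjes_sq_mono x y : 0 < x -> x <= y -> x ^+ 2 * A x <= y ^+ 2 * A y.
Proof.
move=> x0 xy; have y0 : 0 < y by lra.
rewrite /stieltjes_sq -!meanZ; try exact: bmeas_sq.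
apply: mean_le => [| |t]; try by apply: bmeasM; [exact: bmeas_cst | exact: bmeas_sq].
have dx := sq_den_gt0 t x0; have dy := sq_den_gt0 t y0.
rewrite !mulrA ler_pdivrMr// [leRHS]mulrAC ler_pdivlMr//.
have t2 := sqr_ge0 t.
have xy2 : x ^+ 2 <= y ^+ 2 by rewrite lerXn2r// ?nnegrE ltW.
have : 0 <= (y ^+ 2 - x ^+ 2) * (t ^+ 2 * t ^+ 2).
  by apply: mulr_ge0; [rewrite subr_ge0 | exact: mulr_ge0].
by lra.
Qed.

Lemma gauge_stieltjes : varies (- alpha) A -> gauge mu alpha A.
Proof.
move=> [A0 Acvg]; split => // [x y x0 xy|y y0]; first exact: stieltjes_sq_mono.
rewrite /stieltjes_sq /moment2 -!meanZ; try by [exact: bmeas_sq | apply: bmeasM; [exact: bmeas_cst|exact: bmeas_sq]].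
have bq := bmeas_sq y0.
apply: mean_le => [| |t]; first exact: bmeas_sq_trunc.
  by apply: bmeasM; [exact: bmeas_cst | apply: bmeasM => //; exact: bmeas_cst].
have d := sq_den_gt0 t y0; have /andP[q0 q1] := sq_ratio_bound t y0.
case: (leP `|t| y) => ty; last by rewrite mulr0 mulr_ge0// mulr_ge0// sqr_ge0.
rewrite mulr1 !mulrA ler_pdivlMr//.
have ty2 : t ^+ 2 <= y ^+ 2 by rewrite -(real_normK (num_real t)) lerXn2r// ?nnegrE// ltW.
by have := ler_wpM2l (sqr_ge0 t) ty2; lra.
Qed.

(** The gauge is the transform [stieltjes_sq] itself. Its values at l y for all l >= 1 are
   the rescaled integrals of resolvents in t^2, whose polynomial closure reaches all test
   functions; truncated moment and tails are then recovered from indicators. *)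
Lemma stieltjes_class_C : stieltjes_varies mu alpha theta -> class_C alpha theta mu.
Proof.
move=> [AV BA]; have gV := gauge_stieltjes AV; have [A0 Acvg] := AV.
have /andP[a0 a1] := alpha01.
have wb := weight_balance theta1.
have sq0 c : 0 <= c -> 0 < Num.sqrt (1 + c) /\ Num.sqrt (1 + c) ^+ 2 = 1 + c :> R.
  by move=> c0; have c1 : 0 < 1 + c := ltr_pwDl ltr01 c0; rewrite sqrtr_gt0 c1 sqr_sqrtr// ltW.
have den (t c : R) : 0 <= c -> (t ^+ 2 + 1)^-1 / (1 + c * (1 + t ^+ 2)^-1) = (t ^+ 2 + (1 + c))^-1.
  move=> c0; have t2 := sqr_ge0 t.
  have d0 : 0 < t ^+ 2 + 1 by lra.
  by rewrite -invfM; congr (_^-1); field; lra.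
have csq : continuous ksq by have [] := @test_fun_ksq R.
have cabs : continuous kabs by have [] := @test_fun_kabs R.
have tV h : test_fun h -> tends false (rescaled mu A (fun=> 1) h).
  apply: (tends_test_fun alpha01 gV (@weight1 R)) => {}h.
  apply: (tauberian_annulus alpha01 gV (@weight1 R) csq).
  - by move=> t; rewrite sqrrN.
  - exact: ksq_le_cap.
  - move=> t; rewrite normr_gt0 => t0; have t2 : 0 < t ^+ 2 by rewrite lt0r sqr_ge0 sqrf_eq0 t0.
    by rewrite divr_gt0//; lra.
  - move=> c c0; have [s0 s2] := sq0 c c0.
    exists (Num.sqrt (1 + c) `^ (- alpha)) => //.
    apply: cvg_eq_near (Acvg _ s0); near=> y.
    have y0 : 0 < y by near: y; exact: near_pinfty_gt.
    have -> : (fun t => ksq t / (1 + c * (1 + t ^+ 2)^-1)) =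
        (fun t => t ^+ 2 / (t ^+ 2 + Num.sqrt (1 + c) ^+ 2)).
      by apply/funext => t; rewrite -mulrA den// s2.
    by rewrite rescaled_sq.
have L1 : limit_functional mu A ksq = 1.
  apply: limit_functionalE; apply: (@cvg_eq_near _ (fun=> 1)); last exact: cvg_cst.
  near=> y; have y0 : 0 < y by near: y; exact: near_pinfty_gt.
  have Ay : 0 < A y by near: y.
  by have := rescaled_sq mu A 1 y0; rewrite expr1n mul1r mulfV ?lt0r_neq0.
have Ltau := limit_ratio alpha01 gV tV; rewrite L1 mul1r in Ltau.
have CA : stieltjes_abs mu y / A y @[y --> +oo] --> tau.
  rewrite -Ltau; apply: cvg_eq_near (limit_functional_cvg tV (@test_fun_kabs R)).
  near=> y; have y0 : 0 < y by near: y; exact: near_pinfty_gt.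
  by have := rescaled_abs mu A y0 ltr01; rewrite expr1n invr1 !mul1r.
have DA : (B y - theta * stieltjes_abs mu y) / A y @[y --> +oo] --> (0 : R).
  have h : B y / A y - theta * (stieltjes_abs mu y / A y) @[y --> +oo] --> theta * tau - theta * tau.
    by apply: cvgB => //; apply: cvgMr.
  rewrite subrr in h; apply: cvg_eq_near h; near=> y.
  by rewrite mulrA -mulrBl.
have tb h : test_fun h -> tends true (rescaled mu A (balance theta) h).
  apply: (tends_test_fun alpha01 gV wb) => {}h.
  apply: (tauberian_annulus alpha01 gV wb cabs).
  - by move=> t; rewrite sqrrN normrN.
  - exact: kabs_le_cap.
  - move=> t t0; have t2 := sqr_ge0 t.
    by rewrite divr_gt0//; lra.
  - move=> c c0; have [s0 s2] := sq0 c c0.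
    set s := Num.sqrt (1 + c) in s0 s2.
    exists 0 => //.
    have hh : s^-1 * ((B (s * y) - theta * stieltjes_abs mu (s * y)) / A (s * y) *
       (A (s * y) / A y)) @[y --> +oo] --> s^-1 * (0 * s `^ (- alpha)).
      apply: cvgMr; apply: cvgM; last exact: Acvg.
      exact: (cvg_pinfty_scale s0 DA).
    rewrite mul0r mulr0 in hh; apply: cvg_eq_near hh; near=> y.
    have y0 : 0 < y by near: y; exact: near_pinfty_gt.
    have Asy : 0 < A (s * y) by near: y; exact: near_pinfty_scale s0 A0.
    have -> : (fun t => kabs t / (1 + c * (1 + t ^+ 2)^-1)) =
        (fun t => `|t| / (t ^+ 2 + s ^+ 2)).
      by apply/funext => t; rewrite -mulrA den// s2.
    by rewrite rescaled_balance// mulrA divfK// lt0r_neq0.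
have [d /andP[d0 d1] hd] := rescaled_tight alpha01 gV (divr_gt0 ltr01 (ltr0Sn R 3)).
have ksqL := limit_functional_cvg tV (@test_fun_ksq R); rewrite L1 in ksqL.
have dV0 : 0 < d^-1 by rewrite invr_gt0.
(* If one of the two limits vanished, all the mass of ksq would be that of [outer_cap]. *)
have [u _ hu] := tends_sq_trunc alpha01 gV tV ltr01 (@weight1 R) tV.
have [v _ hv] := tends_tail alpha01 gV tV ltr01 (@weight1 R) tV.
have ksq_le_inner t : ksq t <= t ^+ 2 * \1[`|t| <= d^-1] + outer_cap d t.
  have /andP[k0 kc] := ksq_le_cap t; rewrite /outer_cap.
  have n0 : 0 <= `|t| * \1[`|t| <= d] by rewrite mulr_ge0.
  case: (leP `|t| d^-1) => h /=; last first.
    rewrite mulr0 add0r (le_trans kc)// (@le_trans _ _ 1) ?lerDr//.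
    by rewrite ge_min lexx orbT.
  rewrite mulr1 addr0 (@le_trans _ _ (t ^+ 2)) ?lerDl//.
  rewrite ler_pdivrMr ?ltr_wpDl ?sqr_ge0// ler_peMr ?sqr_ge0//.
  by rewrite lerDr sqr_ge0.
have ksq_le_tail t : ksq t <= \1[d < `|t|] + outer_cap d t.
  have /andP[k0 kc] := ksq_le_cap t; rewrite /outer_cap.
  case: (leP `|t| d) => h /=.
    by rewrite mulr1 add0r (le_trans kc)// (@le_trans _ _ `|t|) ?lerDl// ge_min lexx.
  by rewrite (le_trans kc)// (@le_trans _ _ 1) ?lerDl ?mulr0 ?add0r// ge_min lexx orbT.
have bound (f : R -> R) (m : R) : bmeas f -> (forall t, ksq t <= f t + outer_cap d t) ->
    rescaled mu A (fun=> 1) f y @[y --> +oo] --> m -> 0 < m.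
  move=> bf hf hm; apply: (@lt_le_trans _ _ (1 - 4^-1)); first by lra.
  have hh : rescaled mu A (fun=> 1) ksq y - 1 / 4 @[y --> +oo] --> (1 - 4^-1 : R).
    by rewrite -[X in 1 - X]mul1r; apply: cvgB => //; exact: cvg_cst.
  apply: ler_cvg_to hh hm _; near=> y.
  have Ay : 0 < A y by near: y.
  have h1 : rescaled mu A (fun=> 1) (outer_cap d) y <= 1 / 4 by near: y.
  have bt := @bmeas_outer_cap R d.
  have : rescaled mu A (fun=> 1) ksq y <=
      rescaled mu A (fun=> 1) (fun t => 1 * f t + 1 * outer_cap d t) y.
    apply: rescaled1_le; [exact: ltW|exact: test_fun_bmeas (@test_fun_ksq R)| |].
      by apply: bmeasD; (apply: bmeasM => //; exact: bmeas_cst).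
    by move=> t; rewrite !mul1r.
  by rewrite (rescaled_lin _ _ _ _ _ (@weight1 R) bf bt); lra.
have u0 : 0 < u.
  have hh : (d^-1) ^+ 2 * (rescaled mu A (fun=> 1) (fun t => t ^+ 2 * \1[`|t| <= 1]) (d^-1 * y) *
     (A (d^-1 * y) / A y)) @[y --> +oo] --> (d^-1) ^+ 2 * (u * d^-1 `^ (- alpha)).
    apply: cvgMr; apply: cvgM; last exact: Acvg.
    exact: (cvg_pinfty_scale dV0 hu).
  have : 0 < (d^-1) ^+ 2 * (u * d^-1 `^ (- alpha)).
    apply: bound ksq_le_inner _; first exact: bmeas_sq_trunc.
    apply: cvg_eq_near hh; near=> y.
    have y0 : 0 < y by near: y; exact: near_pinfty_gt.
    have Ady : 0 < A (d^-1 * y) by near: y; exact: near_pinfty_scale dV0 A0.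
    have Ay : 0 < A y by near: y.
    rewrite !rescaled_moment2//; last exact: mulr_gt0.
    by rewrite mul1r exprMn; field; rewrite !lt0r_neq0.
  by rewrite pmulr_rgt0 ?exprn_gt0// pmulr_lgt0// powR_gt0.
have v0 : 0 < v.
  have hh : rescaled mu A (fun=> 1) (fun t => \1[1 < `|t|]) (d * y) *
     (A (d * y) / A y) @[y --> +oo] --> v * d `^ (- alpha).
    by apply: cvgM; [exact: (cvg_pinfty_scale d0 hv) | exact: Acvg].
  have : 0 < v * d `^ (- alpha).
    apply: bound ksq_le_tail _; first exact: bmeas_norm_gt.
    apply: cvg_eq_near hh; near=> y.
    have y0 : 0 < y by near: y; exact: near_pinfty_gt.
    have Ady : 0 < A (d * y) by near: y; exact: near_pinfty_scale d0 A0.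
    rewrite !rescaled_tail//; last exact: mulr_gt0.
    by rewrite mul1r mulrA divfK// lt0r_neq0.
  by rewrite pmulr_lgt0// powR_gt0.
split.
  rewrite truncated_second_momentE; apply: varies_regularly_varying.
    exists 0; apply: (measurable_funS measurableT) => //.
    by apply: nondecreasing_measurable => // x y; exact: moment2_le.
  have -> : 2 - alpha = - alpha + 2%:R by ring.
  apply: (varies_equiv (varies_powerM 2 AV) _ u0).
  apply: cvg_eq_near hu; near=> y.
  have y0 : 0 < y by near: y; exact: near_pinfty_gt.
  by rewrite rescaled_moment2// mul1r.
have hb := tends_true (tends_tail alpha01 gV tV ltr01 wb tb).
have q : rescaled mu A (balance theta) (fun t => \1[1 < `|t|]) y /
   rescaled mu A (fun=> 1) (fun t => \1[1 < `|t|]) y + theta @[y --> +oo] --> 0 / v + theta.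
  by apply: cvgD; [apply: cvgM => //; apply: cvgV => //; rewrite lt0r_neq0 | exact: cvg_cst].
rewrite mul0r add0r in q; apply: cvg_eq_near q; near=> y.
have y0 : 0 < y by near: y; exact: near_pinfty_gt.
have vy : 0 < rescaled mu A (fun=> 1) (fun t => \1[1 < `|t|]) y.
  near: y; have /cvgrPdist_lt /(_ _ v0) := hv.
  by apply: filterS => y; rewrite ltr_norml => /andP[_]; rewrite ltrBlDr ltrDl.
move: vy; rewrite rescaled_tail_balance// rescaled_tail// mul1r => vy.
by rewrite mulfK ?lt0r_neq0// subrK.
Unshelve. all: by end_near. Qed.

End tauber.

(** * Contractions of a disc *)

Section complex_contraction.
Variable R : realType.

Lemma geometric_small (C eps : R) : 0 < eps -> exists n : nat, C / 2 ^+ n <= eps.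
Proof.
move=> e0; exists (Num.bound (`|C| / eps)).
have c0 : 0 <= `|C| / eps by rewrite divr_ge0// ltW.
have := archi_boundP c0; set n := Num.bound _ => h.
rewrite ler_pdivrMr ?exprn_gt0// mulrC -ler_pdivrMr//.
apply: (@le_trans _ _ (`|C| / eps)).
  by rewrite ler_pM2r ?invr_gt0// ler_norm.
by rewrite (le_trans (ltW h))// -natrX ler_nat ltnW// ltn_expl.
Qed.

(** The intervals around [u n] of radius 2C/2^n are nested. *)
Lemma geometric_limit (u : nat -> R) (C : R) : 0 <= C ->
  (forall n, `|u n.+1 - u n| <= C / 2 ^+ n) ->
  exists l, forall n, `|u n - l| <= 2 * C / 2 ^+ n.
Proof.
move=> C0 hu; pose r n : R := 2 * C / 2 ^+ n.
have r0 n : 0 <= r n by rewrite divr_ge0 ?exprn_ge0// mulr_ge0.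
have rS n : r n = C / 2 ^+ n + r n.+1.
  by rewrite /r exprS; field; rewrite expf_neq0.
have lo n m : u n - r n <= u (n + m)%N - r (n + m)%N.
  elim: m => [|m IH]; first by rewrite addn0.
  apply: (le_trans IH); rewrite addnS; have := hu (n + m)%N.
  by rewrite ler_norml => /andP[h _]; have := rS (n + m)%N; lra.
have hi n m : u (n + m)%N + r (n + m)%N <= u n + r n.
  elim: m => [|m IH]; first by rewrite addn0.
  apply: le_trans IH; rewrite addnS; have := hu (n + m)%N.
  by rewrite ler_norml => /andP[_ h]; have := rS (n + m)%N; lra.
have cross n m : u n - r n <= u m + r m.
  have h1 := lo n m; have h2 := hi m n; rewrite addnC in h2.
  by have := r0 (n + m)%N; lra.
pose A := [set x | exists n, x = u n - r n].
have ubA m : ubound A (u m + r m) by move=> x [n ->].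
have A0 : A (u 0%N - r 0%N) by exists 0%N.
have hA : has_sup A by split; [exists (u 0%N - r 0%N) | exists (u 0%N + r 0%N)].
exists (sup A) => n; rewrite ler_norml; apply/andP; split.
  have : sup A <= u n + r n by apply: ge_sup => //; exists (u 0%N - r 0%N).
  by rewrite /r; lra.
have : u n - r n <= sup A by apply: sup_upper_bound => //; exists n.
by rewrite /r; lra.
Qed.

(** The n-th Picard step moves by at most r / 2^n. *)
Lemma contraction_fixpoint (T : R[i] -> R[i]) (z : R[i]) (r : R) : 0 <= r ->
  (forall u, nrm (u - z) <= r -> nrm (T u - z) <= r) ->
  (forall u v, nrm (u - z) <= r -> nrm (v - z) <= r -> nrm (T u - T v) <= nrm (u - v) / 2) ->
  exists2 w, nrm (w - z) <= r & T w = w.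
Proof.
move=> r0 Tb Tc; pose u n := iter n T z.
have ub n : nrm (u n - z) <= r.
  elim: n => [|n IH]; first by rewrite /u /= subrr nrm0.
  exact: Tb.
have du n : nrm (u n.+1 - u n) <= r / 2 ^+ n.
  elim: n => [|n IH]; first by rewrite expr0 divr1; exact: Tb (ub 0%N).
  apply: (le_trans (Tc _ _ (ub n.+1) (ub n))).
  rewrite exprS invfM (_ : r * (2^-1 * (2 ^+ n)^-1) = r / 2 ^+ n / 2); last by ring.
  by rewrite ler_pM2r ?invr_gt0.
have [a ha] : exists l, forall n, `|complex.Re (u n) - l| <= 2 * r / 2 ^+ n.
  apply: geometric_limit => // n; apply: le_trans (du n).
  by rewrite -cReN -cReD; exact: Re_le_nrm.
have [b hb] : exists l, forall n, `|complex.Im (u n) - l| <= 2 * r / 2 ^+ n.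
  apply: geometric_limit => // n; apply: le_trans (du n).
  by rewrite -cImN -cImD; exact: Im_le_nrm.
pose w : R[i] := a +i* b.
have uw n : nrm (u n - w) <= 4 * r / 2 ^+ n.
  apply: (le_trans (nrm_le_ReIm _)); rewrite cReD cReN cImD cImN.
  by have := ha n; have := hb n; rewrite /w /=; lra.
have wb : nrm (w - z) <= r.
  apply/ler_addgt0Pr => e e0; have [n hn] := geometric_small (4 * r) e0.
  rewrite (_ : w - z = (u n - z) - (u n - w)); last by ring.
  by rewrite (le_trans (nrmB _ _))// lerD// (le_trans (uw n)).
exists w => //; apply/eqP; rewrite -subr_eq0 -nrm_eq0 eq_le nrm_ge0 andbT.
apply/ler_addgt0Pr => e e0; rewrite add0r; have [n hn] := geometric_small (8 * r) e0.
rewrite (_ : T w - w = (u n.+1 - w) - (T (u n) - T w)); last by rewrite /u /=; ring.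
rewrite (le_trans (nrmB _ _))//.
have h1 := Tc _ _ (ub n) wb; have h2 := uw n; have h3 := uw n.+1.
apply: le_trans hn; rewrite exprS invfM in h3.
have h4 : 4 * r * (2^-1 * (2 ^+ n)^-1) = 4 * r / 2 ^+ n / 2 by ring.
rewrite h4 in h3; have h5 : 8 * r / 2 ^+ n = 2 * (4 * r / 2 ^+ n) by ring.
by rewrite h5; have := nrm_ge0 (u n - w); lra.
Qed.

End complex_contraction.

(** * Increments of the reciprocal Cauchy transform *)

Section complex_mean.
Variables (R : realType) (mu : probability (measurableTypeR R) R).
Implicit Types (f g : R -> R[i]) (z w c : R[i]).

Definition cbmeas f := bmeas (fun t => complex.Re (f t)) /\ bmeas (fun t => complex.Im (f t)).

Definition cmean f : R[i] :=
  mean mu (fun t => complex.Re (f t)) +i* mean mu (fun t => complex.Im (f t)).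

Lemma cbmeas_cst c : cbmeas (fun=> c).
Proof. by split; exact: bmeas_cst. Qed.

Lemma bmeas_ext (f g : R -> R) : (forall t, f t = g t) -> bmeas g -> bmeas f.
Proof. by move=> fg; have -> : f = g by apply/funext. Qed.

Lemma cbmeasD f g : cbmeas f -> cbmeas g -> cbmeas (fun t => f t + g t).
Proof.
move=> [f1 f2] [g1 g2]; split.
  by apply: bmeas_ext (bmeasD f1 g1) => t; rewrite cReD.
by apply: bmeas_ext (bmeasD f2 g2) => t; rewrite cImD.
Qed.

Lemma cbmeasM f g : cbmeas f -> cbmeas g -> cbmeas (fun t => f t * g t).
Proof.
move=> [f1 f2] [g1 g2]; split.
  by apply: bmeas_ext (bmeasB (bmeasM f1 g1) (bmeasM f2 g2)) => t; rewrite cReM.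
by apply: bmeas_ext (bmeasD (bmeasM f1 g2) (bmeasM f2 g1)) => t; rewrite cImM.
Qed.

Lemma cmeanD f g : cbmeas f -> cbmeas g -> cmean (fun t => f t + g t) = cmean f + cmean g.
Proof.
move=> [f1 f2] [g1 g2]; apply: complex_ext => /=.
  by rewrite -meanD//; congr mean; apply/funext => t; rewrite cReD.
by rewrite -meanD//; congr mean; apply/funext => t; rewrite cImD.
Qed.

Lemma cmeanZ c f : cbmeas f -> cmean (fun t => c * f t) = c * cmean f.
Proof.
case: c => a b [f1 f2].
have bz (x : R) (h : R -> R) : bmeas h -> bmeas (fun t => x * h t).
  by move=> bh; apply: bmeasM => //; exact: bmeas_cst.
apply: complex_ext => /=.
  rewrite -!meanZ// -meanB; try exact: bz.
  by congr mean; apply/funext => t; rewrite cReM.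
rewrite -!meanZ// -meanD; try exact: bz.
by congr mean; apply/funext => t; rewrite cImM.
Qed.

Lemma cmean_cst c : cmean (fun=> c) = c.
Proof. by apply: complex_ext => /=; rewrite mean_cst. Qed.

Lemma cmean_bound f (H : R -> R) : cbmeas f -> bmeas H -> (forall t, nrm (f t) <= H t) ->
  nrm (cmean f) <= 2 * mean mu H.
Proof.
move=> [f1 f2] bH fH; apply: (le_trans (nrm_le_ReIm _)) => /=.
rewrite (_ : 2 * _ = mean mu H + mean mu H); last by ring.
apply: lerD.
  apply: le_trans (norm_mean_le mu f1) _; apply: mean_le => // [|t]; first exact: bmeas_norm.
  by rewrite (le_trans (Re_le_nrm _)).
apply: le_trans (norm_mean_le mu f2) _; apply: mean_le => // [|t]; first exact: bmeas_norm.
by rewrite (le_trans (Im_le_nrm _)).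
Qed.

Lemma bmeas_nrm_sq f : cbmeas f -> bmeas (fun t => nrm (f t) ^+ 2).
Proof.
move=> [f1 f2]; apply: bmeas_ext (bmeasD (bmeasM f1 f1) (bmeasM f2 f2)) => t.
by rewrite nrm_sq !expr2.
Qed.

Definition resolvent z (t : R) : R[i] := (z - t%:C)^-1.

Lemma resolvent_neq0 z t : 0 < complex.Im z -> z - t%:C != 0.
Proof.
move=> z0; rewrite -nrm_gt0; apply: lt_le_trans (Im_le_nrm _).
by rewrite cImD cImN /= subr0 normr_gt0 lt0r_neq0.
Qed.

Lemma nrm_resolvent z t : 0 < complex.Im z -> nrm (resolvent z t) <= (complex.Im z)^-1.
Proof.
move=> z0; have n0 : 0 < nrm (z - t%:C) by rewrite nrm_gt0 resolvent_neq0.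
rewrite /resolvent nrmV lef_pV2 ?posrE//; apply: le_trans (Im_le_nrm _).
by rewrite cImD cImN /= subr0 ler_norm.
Qed.

Lemma Re_resolvent z t : complex.Re (resolvent z t) =
  (complex.Re z - t) / ((complex.Re z - t) ^+ 2 + complex.Im z ^+ 2).
Proof. by rewrite /resolvent cReV cReD cReN cImD cImN /= subr0. Qed.

Lemma Im_resolvent z t : complex.Im (resolvent z t) =
  - complex.Im z / ((complex.Re z - t) ^+ 2 + complex.Im z ^+ 2).
Proof. by rewrite /resolvent cImV cReD cReN cImD cImN /= subr0. Qed.

Lemma cbmeas_resolvent z : 0 < complex.Im z -> cbmeas (resolvent z).
Proof.
move=> z0; have csub : continuous (fun t : R => complex.Re z - t).
  by move=> t; apply: cvgB; [exact: cvg_cst | exact: cvg_id].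
have cden : continuous (fun t : R => ((complex.Re z - t) ^+ 2 + complex.Im z ^+ 2)^-1).
  move=> t; apply: cvgV; first by rewrite lt0r_neq0// ltr_wpDl ?sqr_ge0 ?exprn_gt0.
  apply: cvgD; last exact: cvg_cst.
  exact: (cvg_comp _ (fun u => u ^+ 2) (csub t) (@exprn_continuous R 2 _)).
split.
  apply: (@bmeas_continuous _ _ (complex.Im z)^-1); last first.
    by move=> t; apply: le_trans (Re_le_nrm _) (nrm_resolvent t z0).
  rewrite (_ : (fun t => _) = (fun t => (complex.Re z - t) * ((complex.Re z - t) ^+ 2 + complex.Im z ^+ 2)^-1)).
    exact: continuousM_fun.
  by apply/funext => t; rewrite Re_resolvent.
apply: (@bmeas_continuous _ _ (complex.Im z)^-1); last first.
  by move=> t; apply: le_trans (Im_le_nrm _) (nrm_resolvent t z0).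
rewrite (_ : (fun t => _) = (fun t => - complex.Im z * ((complex.Re z - t) ^+ 2 + complex.Im z ^+ 2)^-1)).
  by apply: continuousM_fun => // t; exact: cvg_cst.
by apply/funext => t; rewrite Im_resolvent.
Qed.

Local Notation G := (cauchy_transform mu).
Local Notation F := (F_transform mu).

Lemma cauchy_transformE z : G z = cmean (resolvent z).
Proof. by []. Qed.

Lemma resolvent_identity z w t : 0 < complex.Im z -> 0 < complex.Im w ->
  resolvent z t - resolvent w t = (w - z) * (resolvent z t * resolvent w t).
Proof.
move=> z0 w0; have hz := resolvent_neq0 t z0; have hw := resolvent_neq0 t w0.
by rewrite /resolvent; field; rewrite hz hw.
Qed.

(** The normalized resolvent has mean 1; [deviation] is its deviation from the mean. *)
Definition deviation z t := F z * resolvent z t - 1.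

Lemma cbmeas_deviation z : 0 < complex.Im z -> cbmeas (deviation z).
Proof.
move=> z0; apply: cbmeasD; last exact: cbmeas_cst.
by apply: cbmeasM; [exact: cbmeas_cst | exact: cbmeas_resolvent].
Qed.

(** F z - z subtracts from the reciprocal transform exactly what centres the normalized
   resolvents, so that the increments become covariances. *)
Lemma F_increment z w : 0 < complex.Im z -> 0 < complex.Im w -> G z != 0 -> G w != 0 ->
  (F z - z) - (F w - w) = (z - w) * cmean (fun t => deviation z t * deviation w t).
Proof.
move=> z0 w0 Gz Gw.
have bz := cbmeas_resolvent z0; have bw := cbmeas_resolvent w0.
have bzw := cbmeasM bz bw.
have e1 : (w - z) * cmean (fun t => resolvent z t * resolvent w t) = G z - G w.
  rewrite -cmeanZ// !cauchy_transformE -[X in _ = _ - X]mul1r -mulNr -cmeanZ// -cmeanD//; last first.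
    by apply: cbmeasM => //; exact: cbmeas_cst.
  by congr cmean; apply/funext => t; rewrite mulN1r resolvent_identity.
have e2 : cmean (fun t => deviation z t * deviation w t) =
    F z * F w * cmean (fun t => resolvent z t * resolvent w t) - 1.
  rewrite (_ : (fun t => _) = (fun t => (F z * F w) * (resolvent z t * resolvent w t) +
    ((- F z) * resolvent z t + ((- F w) * resolvent w t + 1)))); last first.
    by apply/funext => t; rewrite /deviation; ring.
  have bc c f : cbmeas f -> cbmeas (fun t => c * f t).
    by move=> bf; apply: cbmeasM => //; exact: cbmeas_cst.
  have b1 := @cbmeas_cst 1.
  rewrite cmeanD; [|exact: bc|by apply: cbmeasD; [exact: bc|apply: cbmeasD; [exact: bc|]]].
  rewrite cmeanD; [|exact: bc|by apply: cbmeasD; [exact: bc|]].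
  rewrite cmeanD; [|exact: bc|by []].
  rewrite !cmeanZ// cmean_cst -!cauchy_transformE /F_transform !mulNr !mulVf//.
  by ring.
rewrite e2; move: (cmean _) e1 => c e1.
have e3 : F z * F w * ((w - z) * c) = F w - F z.
  by rewrite e1 /F_transform; field; rewrite Gz Gw.
by transitivity (- (F z * F w * ((w - z) * c)) - (z - w)); [rewrite e3; ring | ring].
Qed.

(** The diagonal case of the same computation, with a conjugate: a variance. *)
Lemma Im_F z : 0 < complex.Im z -> G z != 0 ->
  complex.Im (F z - z) = complex.Im z * mean mu (fun t => nrm (deviation z t) ^+ 2).
Proof.
move=> z0 Gz; have [b1 b2] := cbmeas_resolvent z0.
set y := complex.Im z in z0 *.
have bF : cbmeas (fun t => F z * resolvent z t).
  by apply: cbmeasM; [exact: cbmeas_cst | exact: cbmeas_resolvent].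
have [bF1 _] := bF.
have pt t : nrm (deviation z t) ^+ 2 =
   (- (nrm (F z) ^+ 2 / y)) * complex.Im (resolvent z t) +
   ((- 2) * complex.Re (F z * resolvent z t) + 1).
  have h : nrm (resolvent z t) ^+ 2 = - complex.Im (resolvent z t) / y.
    rewrite nrm_sq Re_resolvent Im_resolvent -/y.
    have d0 : (complex.Re z - t) ^+ 2 + y ^+ 2 != 0.
      by rewrite lt0r_neq0// ltr_wpDl ?sqr_ge0 ?exprn_gt0.
    by field; rewrite d0 lt0r_neq0.
  rewrite (_ : - (nrm (F z) ^+ 2 / y) * complex.Im (resolvent z t) = nrm (F z * resolvent z t) ^+ 2); last first.
    by rewrite nrmM exprMn h; ring.
  rewrite /deviation !nrm_sq cReD cImD /=; ring.
rewrite (_ : (fun t => _) = (fun t => - (nrm (F z) ^+ 2 / y) * complex.Im (resolvent z t) +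
   ((- 2) * complex.Re (F z * resolvent z t) + 1))); last exact/funext.
have bc (c : R) (f : R -> R) : bmeas f -> bmeas (fun t => c * f t).
  by move=> bf; apply: bmeasM => //; exact: bmeas_cst.
have bone : bmeas (fun _ : R => 1 : R) by exact: bmeas_cst.
rewrite meanD; [|exact: bc|by apply: bmeasD; [exact: bc|]].
rewrite meanD; [|exact: bc|by []].
rewrite !meanZ// mean_cst.
have -> : mean mu (fun t => complex.Re (F z * resolvent z t)) = 1.
  have := cmeanZ (F z) (cbmeas_resolvent z0).
  by rewrite -cauchy_transformE /F_transform mulVf// => /(congr1 (@complex.Re R)).
have -> : mean mu (fun t => complex.Im (resolvent z t)) = complex.Im (G z) by [].
have nF : nrm (F z) ^+ 2 = (complex.Re (G z) ^+ 2 + complex.Im (G z) ^+ 2)^-1.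
  by rewrite /F_transform nrmV exprVn nrm_sq.
rewrite nF cImD cImN -/y /F_transform cImV.
have d0 : complex.Re (G z) ^+ 2 + complex.Im (G z) ^+ 2 != 0.
  by rewrite -nrm_sq expf_neq0// nrm_eq0.
by field; rewrite d0 lt0r_neq0.
Qed.

Lemma Im_F_ratio z : 0 < complex.Im z -> G z != 0 ->
  complex.Im (F z - z) / complex.Im z = mean mu (fun t => nrm (deviation z t) ^+ 2).
Proof. by move=> z0 Gz; rewrite Im_F// mulrC mulKf// lt0r_neq0. Qed.

Lemma cmean_deviationM z w : 0 < complex.Im z -> 0 < complex.Im w -> G z != 0 -> G w != 0 ->
  nrm (cmean (fun t => deviation z t * deviation w t)) <=
  complex.Im (F z - z) / complex.Im z + complex.Im (F w - w) / complex.Im w.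
Proof.
move=> z0 w0 Gz Gw; rewrite !Im_F_ratio//.
have bz := cbmeas_deviation z0; have bw := cbmeas_deviation w0.
have nz := bmeas_nrm_sq bz; have nw := bmeas_nrm_sq bw.
have bh : bmeas (fun t => 2^-1 * (nrm (deviation z t) ^+ 2 + nrm (deviation w t) ^+ 2)).
  by apply: bmeasM; [exact: bmeas_cst | exact: bmeasD].
apply: (le_trans (cmean_bound (cbmeasM bz bw) bh _)).
  move=> t; rewrite nrmM; have := sqr_ge0 (nrm (deviation z t) - nrm (deviation w t)).
  by lra.
rewrite meanZ; last exact: bmeasD.
by rewrite meanD// mulrA mulfV// mul1r.
Qed.

(** A form of the Schwarz-Pick inequality for the Nevanlinna function F z - z. *)
Lemma F_schwarz_pick z w : 0 < complex.Im z -> 0 < complex.Im w -> G z != 0 -> G w != 0 ->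
  nrm ((F z - z) - (F w - w)) <= nrm (z - w) *
    (complex.Im (F z - z) / complex.Im z + complex.Im (F w - w) / complex.Im w).
Proof.
move=> z0 w0 Gz Gw; rewrite F_increment// nrmM; apply: ler_wpM2l; first exact: nrm_ge0.
exact: cmean_deviationM.
Qed.

End complex_mean.

(** * Inverting the reciprocal Cauchy transform *)

Section inverse.
Variables (R : realType) (mu : probability (measurableTypeR R) R).
Implicit Types (z w : R[i]).
Local Notation G := (cauchy_transform mu).
Local Notation F := (F_transform mu).

Definition in_cone (eta M : R) z := M < complex.Im z /\ `|complex.Re z| <= eta * complex.Im z.

Lemma cone_nrm eta M z : 0 <= M -> in_cone eta M z -> nrm z <= (1 + eta) * complex.Im z.
Proof.
move=> M0 [Mz zeta]; apply: (le_trans (nrm_le_ReIm _)).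
by rewrite (gtr0_norm (le_lt_trans M0 Mz)); lra.
Qed.

(** z G(z) - 1 is the mean of t / (z - t), at most K / Im z where |t| <= K and bounded by
   2 + eta in the cone. *)
Lemma cone_zG eta eps : 0 < eta -> 0 < eps -> exists2 M, 0 < M &
  forall w, in_cone eta M w -> nrm (w * G w - 1) <= eps.
Proof.
move=> eta0 e0.
have e4 : 0 < eps / (4 * (2 + eta)) by rewrite divr_gt0// mulr_gt0//; lra.
have [K K0 hK] := tail_small mu e4.
have M0 : 0 < 4 * K / eps by rewrite divr_gt0// mulr_gt0.
exists (4 * K / eps) => // w cw; have [Mw _] := cw.
have w0 : 0 < complex.Im w by lra.
have wn := cone_nrm (ltW M0) cw.
have br := cbmeas_resolvent w0.
have -> : w * G w - 1 = cmean mu (fun t => w * resolvent w t + (- 1)).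
  rewrite cmeanD ?cmean_cst ?cmeanZ//; last exact: cbmeas_cst.
  by apply: cbmeasM => //; exact: cbmeas_cst.
have bH : bmeas (fun t => K / complex.Im w * (fun=> 1) t + (2 + eta) * \1[K < `|t|]).
  by apply: bmeasD; apply: bmeasM; try exact: bmeas_cst; exact: bmeas_norm_gt.
apply: (le_trans (cmean_bound (H := fun t => K / complex.Im w * (fun=> 1) t + (2 + eta) * \1[K < `|t|]) _ _ _ _)) => //.
- apply: cbmeasD; last exact: cbmeas_cst.
  by apply: cbmeasM => //; exact: cbmeas_cst.
- move=> t.
  have rn := nrm_resolvent t w0.
  case: (ltP K `|t|) => h /=; rewrite !mulr1.
    have k0 : 0 <= K / complex.Im w by rewrite divr_ge0 ?ltW.
    have : nrm (w * resolvent w t) <= 1 + eta.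
      rewrite nrmM; apply: (@le_trans _ _ ((1 + eta) * complex.Im w * (complex.Im w)^-1)).
        by apply: ler_pM; rewrite ?nrm_ge0.
      by rewrite mulfK ?lt0r_neq0.
    by have := nrmD (w * resolvent w t) (- 1); rewrite nrmN nrm1; lra.
  rewrite mulr0 addr0.
  have -> : w * resolvent w t - 1 = t%:C * resolvent w t.
    by rewrite /resolvent; field; exact: resolvent_neq0.
  rewrite nrmM nrm_real; apply: ler_pM; rewrite ?nrm_ge0//.
have bone : bmeas (fun _ : R => 1 : R) by exact: bmeas_cst.
rewrite meanD; try (by apply: bmeasM; [exact: bmeas_cst|exact: bmeas_norm_gt]); last first.
  by apply: bmeasM => //; exact: bmeas_cst.
rewrite !meanZ//; last exact: bmeas_norm_gt.
rewrite mean_cst mulr1 -/(tail mu K).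
have h1 : K / complex.Im w <= eps / 4.
  by rewrite ler_pdivrMr//; move: Mw; rewrite ltr_pdivrMr//; lra.
have h2 : (2 + eta) * tail mu K <= eps / 4.
  have := hK K (lexx _); rewrite ler_pdivlMr ?mulr_gt0//; lra.
by lra.
Qed.

Lemma cone_F eta k : 0 < eta -> 0 < k -> exists2 M, 0 < M &
  forall w, in_cone eta M w -> G w != 0 /\ nrm (F w - w) <= k * complex.Im w.
Proof.
move=> eta0 k0; pose e := Num.min (1 / 2) (k / (2 * (1 + eta))).
have e0 : 0 < e by rewrite lt_min !divr_gt0// mulr_gt0//; lra.
have [M M0 hM] := cone_zG eta0 e0.
exists M => // w cw; have h := hM w cw.
have h2 : nrm (w * G w - 1) <= 1 / 2 by apply: (le_trans h); rewrite ge_min lexx.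
have n2 : 1 / 2 <= nrm (w * G w).
  have := nrmB (w * G w) (w * G w - 1); rewrite (_ : _ - (_ - 1) = 1); last by ring.
  by rewrite nrm1; lra.
have wG : w * G w != 0 by rewrite -nrm_gt0; lra.
move: (wG); rewrite mulf_eq0 negb_or => /andP[w0 G0]; split => //.
have -> : F w - w = - (w * ((w * G w - 1) / (w * G w))).
  by rewrite /F_transform; field; rewrite w0 G0.
rewrite nrmN nrmM [X in _ * X]nrmM nrmV.
have wn := cone_nrm (ltW M0) cw.
apply: (@le_trans _ _ ((1 + eta) * complex.Im w * (2 * e))).
  apply: ler_pM; rewrite ?nrm_ge0//.
    by rewrite mulr_ge0 ?invr_ge0 ?nrm_ge0.
  by rewrite ler_pdivrMr; nra.
have : e <= k / (2 * (1 + eta)) by rewrite ge_min lexx orbT.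
rewrite ler_pdivlMr; last by rewrite mulr_gt0//; lra.
have [Mw _] := cw; have w0' : 0 <= complex.Im w by lra.
by move=> /(ler_wpM2r w0'); lra.
Qed.

(** Discs of radius Im z / 2 about the points of a cone stay in a wider cone. *)
Lemma cone_ball eta M z w : 0 < eta -> in_cone eta M z -> 0 <= M ->
  nrm (w - z) <= complex.Im z / 2 ->
  [/\ in_cone (2 * eta + 1) (M / 2) w, complex.Im z / 2 <= complex.Im w &
     complex.Im w <= 3 / 2 * complex.Im z].
Proof.
move=> eta0 [Mz zeta] M0 wz.
have := le_trans (Im_le_nrm _) wz; have := le_trans (Re_le_nrm _) wz.
rewrite cReD cReN cImD cImN !ler_norml => /andP[r1 r2] /andP[i1 i2].
have z0 : 0 < complex.Im z by lra.
have i3 : complex.Im z / 2 <= complex.Im w by lra.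
split; [split; first by lra | by [] | by lra].
move: zeta; rewrite !ler_norml => /andP[a1 a2].
have : eta * (complex.Im z / 2) <= eta * complex.Im w by rewrite ler_pM2l.
by move=> h; apply/andP; split; lra.
Qed.

(** The equation F w = z is solved in the disc of radius Im z / 2 about z, where a
   point z far out in a cone has exactly one preimage; one function serves all cones. *)
Definition local_inverse z : R[i] :=
  xget z [set w | nrm (w - z) <= complex.Im z / 2 /\ F w = z].

(** The point w with F w = z is the fixed point of the contraction w |-> z - (F w - w). *)
Lemma local_inverseP eta : 0 < eta -> exists2 M, 0 < M & forall z, in_cone eta M z ->
  [/\ nrm (local_inverse z - z) <= complex.Im z / 2, F (local_inverse z) = z,
      G (local_inverse z) != 0 &
      complex.Im (F (local_inverse z) - local_inverse z) / complex.Im (local_inverse z) <= 1 / 8].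
Proof.
move=> eta0; have eta1 : 0 < 2 * eta + 1 by lra.
have [M M0 hM] := cone_F eta1 (divr_gt0 ltr01 (ltr0Sn R 7)).
have M20 : 0 < 2 * M by lra.
exists (2 * M) => // z cz; have [Mz _] := cz.
have z0 : 0 < complex.Im z by lra.
have ball w : nrm (w - z) <= complex.Im z / 2 -> [/\ in_cone (2 * eta + 1) M w,
    complex.Im z / 2 <= complex.Im w & complex.Im w <= 3 / 2 * complex.Im z].
  move=> wz; have := cone_ball eta0 cz (ltW M20) wz.
  by rewrite (_ : 2 * M / 2 = M)//; field.
have Ew w : nrm (w - z) <= complex.Im z / 2 -> complex.Im (F w - w) / complex.Im w <= 1 / 8.
  move=> /ball [cw w1 _]; have w0 : 0 < complex.Im w by lra.
  rewrite ler_pdivrMr//; apply: le_trans (ler_norm _) (le_trans (Im_le_nrm _) _).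
  by have [] := hM w cw.
have [w wb wT] : exists2 w, nrm (w - z) <= complex.Im z / 2 & z - (F w - w) = w.
  apply: (@contraction_fixpoint R (fun w => z - (F w - w)) z); first by lra.
    move=> u ub; have [cu u1 u2] := ball u ub; have [_ Fu] := hM u cu.
    rewrite addrAC subrr add0r nrmN; lra.
  move=> u v ub vb; have [cu u1 _] := ball u ub; have [cv v1 _] := ball v vb.
  have u0 : 0 < complex.Im u by lra.
  have v0 : 0 < complex.Im v by lra.
  have [Gu _] := hM u cu; have [Gv _] := hM v cv.
  rewrite (_ : z - (F u - u) - (z - (F v - v)) = - ((F u - u) - (F v - v))); last by ring.
  rewrite nrmN; apply: (le_trans (F_schwarz_pick u0 v0 Gu Gv)).
  rewrite ler_wpM2l ?nrm_ge0//; have := Ew u ub; have := Ew v vb; lra.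
have Fw : F w = z.
  have h : z - F w = (z - (F w - w)) - w by ring.
  by apply/esym/eqP; rewrite -subr_eq0 h wT subrr.
have [h1 h2] : [set w | nrm (w - z) <= complex.Im z / 2 /\ F w = z] (local_inverse z).
  by apply: xgetPex; exists w.
split => //; last exact: Ew.
by have [cw _ _] := ball _ h1; have [] := hM _ cw.
Qed.

Lemma cmean_sub f g h : cbmeas f -> cbmeas g -> cbmeas h -> (forall t, f t - g t = h t) ->
  cmean mu f - cmean mu g = cmean mu h.
Proof.
move=> bf bg bh e; apply/eqP; rewrite subr_eq -cmeanD//; apply/eqP; congr cmean.
by apply/funext => t; rewrite -e subrK.
Qed.

(** The increments satisfy z - z0 = (w - w0) (1 + Q), where Q is the covariance of the
   deviations at w and w0; it is small, and Lipschitz in w at w0. *)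
Lemma inverse_quotient w0 z0 (C0 : R) : 0 < C0 -> C0 <= complex.Im w0 -> F w0 = z0 ->
  G w0 != 0 -> complex.Im (F w0 - w0) / complex.Im w0 <= 1 / 8 ->
  exists d : R[i], exists2 C : R, 0 < C & forall z w,
    z != z0 -> C0 <= complex.Im w -> F w = z -> G w != 0 ->
    complex.Im (F w - w) / complex.Im w <= 1 / 8 ->
    nrm ((w - w0) / (z - z0) - d) <= C * nrm (z - z0).
Proof.
move=> C00 i0 F0 G0 e0.
pose Q0 := cmean mu (fun t => deviation mu w0 t * deviation mu w0 t).
(* Ca bounds the Lipschitz constant of the deviation, Cb its size at w0. *)
pose Ca := C0^-1 + 2 * nrm z0 * (C0^-1 * C0^-1).
pose Cb := nrm z0 * C0^-1 + 1.
have iC : 0 < C0^-1 by rewrite invr_gt0.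
have Ca0 : 0 < Ca.
  by rewrite /Ca ltr_pwDl// mulr_ge0// ?mulr_ge0 ?nrm_ge0// ltW.
have Cb0 : 0 < Cb by rewrite /Cb ltr_wpDl// mulr_ge0 ?nrm_ge0// ltW.
exists (1 + Q0)^-1; exists (8 * (Ca * Cb)); first by rewrite !mulr_gt0.
move=> z w zz i1 F1 G1 e1.
have y0 : 0 < complex.Im w0 by lra.
have y1 : 0 < complex.Im w by lra.
have b0 := cbmeas_deviation mu y0; have b1 := cbmeas_deviation mu y1.
pose Q := cmean mu (fun t => deviation mu w t * deviation mu w0 t).
have smallQ u v : 0 < complex.Im u -> 0 < complex.Im v -> G u != 0 -> G v != 0 ->
    complex.Im (F u - u) / complex.Im u <= 1 / 8 -> complex.Im (F v - v) / complex.Im v <= 1 / 8 ->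
    nrm (cmean mu (fun t => deviation mu u t * deviation mu v t)) <= 1 / 4.
  by move=> u0 v0 Gu Gv eu ev; apply: (le_trans (cmean_deviationM u0 v0 Gu Gv)); lra.
have Qs : nrm Q <= 1 / 4 by exact: smallQ.
have Q0s : nrm Q0 <= 1 / 4 by exact: smallQ.
have inc : z - z0 = (w - w0) * (1 + Q).
  have := F_increment y1 y0 G1 G0; rewrite F1 F0 -/Q => h.
  by rewrite mulrDr mulr1 -h; ring.
have n34 (q : R[i]) : nrm q <= 1 / 4 -> 1 / 2 <= nrm (1 + q).
  by move=> h; have := nrmB (1 + q) q; rewrite addrK nrm1; lra.
have nQ := n34 _ Qs; have nQ0 := n34 _ Q0s.
have zQ : 1 + Q != 0 by rewrite -nrm_gt0; lra.
have zQ0 : 1 + Q0 != 0 by rewrite -nrm_gt0; lra.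
have dw : nrm (w - w0) <= 2 * nrm (z - z0).
  by rewrite inc nrmM; have := nrm_ge0 (w - w0); nra.
have wz : w - w0 != 0.
  by apply: contra zz => /eqP h; rewrite -subr_eq0 inc h mul0r.
have quot : (w - w0) / (z - z0) - (1 + Q0)^-1 = (Q0 - Q) / ((1 + Q) * (1 + Q0)).
  by rewrite inc; field; rewrite zQ zQ0 wz.
have r1 := cbmeas_resolvent y1; have r0 := cbmeas_resolvent y0.
have bbig : cbmeas (fun t => (z - z0) * resolvent w t + z0 * (w0 - w) * (resolvent w t * resolvent w0 t)).
  exact: (cbmeasD (cbmeasM (cbmeas_cst (z - z0)) r1) (cbmeasM (cbmeas_cst (z0 * (w0 - w))) (cbmeasM r1 r0))).
have dQ : nrm (Q0 - Q) <= 2 * (Ca * Cb * nrm (z - z0)).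
  rewrite nrm_distC /Q /Q0.
  rewrite (cmean_sub (cbmeasM b1 b0) (cbmeasM b0 b0)
    (h := fun t => ((z - z0) * resolvent w t + z0 * (w0 - w) * (resolvent w t * resolvent w0 t)) *
       deviation mu w0 t)); last 2 first.
  - exact: cbmeasM bbig b0.
  - move=> t; rewrite -mulrBl; congr (_ * _).
    rewrite /deviation F1 F0 -(mulrA z0) -resolvent_identity//; ring.
  have bc : bmeas (fun _ : R => Ca * Cb * nrm (z - z0)) by exact: bmeas_cst.
  apply: (le_trans (cmean_bound mu (H := fun=> Ca * Cb * nrm (z - z0)) _ bc _)).
  - exact: cbmeasM bbig b0.
  - move=> t; rewrite nrmM (mulrAC Ca).
    have n1 : nrm (resolvent w t) <= C0^-1.
      by apply: (le_trans (nrm_resolvent t y1)); rewrite lef_pV2 ?posrE.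
    have n0 : nrm (resolvent w0 t) <= C0^-1.
      by apply: (le_trans (nrm_resolvent t y0)); rewrite lef_pV2 ?posrE.
    apply: ler_pM; rewrite ?nrm_ge0//.
      apply: (le_trans (nrmD _ _)); rewrite !nrmM (nrm_distC w0).
      rewrite /Ca mulrDl; apply: lerD.
        by rewrite mulrC ler_wpM2r ?nrm_ge0.
      have h1 : nrm (resolvent w t) * nrm (resolvent w0 t) <= C0^-1 * C0^-1.
        by apply: ler_pM; rewrite ?nrm_ge0.
      rewrite (_ : 2 * nrm z0 * (C0^-1 * C0^-1) * nrm (z - z0) =
        nrm z0 * (2 * nrm (z - z0)) * (C0^-1 * C0^-1)); last by ring.
      apply: ler_pM => //; rewrite ?mulr_ge0 ?nrm_ge0//.
      by rewrite ler_wpM2l ?nrm_ge0.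
    apply: (le_trans (nrmB _ _)); rewrite nrmM nrm1 F0 /Cb lerD2r.
    by rewrite ler_wpM2l ?nrm_ge0.
  by rewrite mean_cst.
rewrite quot nrmM nrmV nrmM ler_pdivrMr; last by rewrite mulr_gt0//; lra.
have : 1 / 2 * (1 / 2) <= nrm (1 + Q) * nrm (1 + Q0) by apply: ler_pM; lra.
move=> h; apply: (le_trans dQ).
have p0 : 0 <= Ca * Cb * nrm (z - z0) by rewrite !mulr_ge0 ?nrm_ge0 ?ltW.
by move: p0 h; move: (nrm (1 + Q) * nrm (1 + Q0)) => a; nra.
Qed.

End inverse.

Section inverse_exists.
Variables (R : realType) (mu : probability (measurableTypeR R) R).
Implicit Types (z w : R[i]).
Local Notation G := (cauchy_transform mu).
Local Notation F := (F_transform mu).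
Local Notation H := (local_inverse mu).

Lemma pos_complex (e : R[i]) : 0 < e -> 0 < complex.Re e /\ e = (complex.Re e)%:C.
Proof.
move=> e0; have := e0; rewrite ltcE /= => /andP[/eqP i0 r0]; split => //.
by apply: complex_ext => //=; rewrite i0.
Qed.

Lemma derivable_of_bound (f : R[i] -> R[i]) z0 d (C r : R) : 0 < C -> 0 < r ->
  (forall z, z != z0 -> nrm (z - z0) < r ->
     nrm ((f z - f z0) / (z - z0) - d) <= C * nrm (z - z0)) ->
  derivable (f : (R[i])^o -> (R[i])^o) z0 1.
Proof.
move=> C0 r0 hf; apply/cvg_ex; exists (d : (R[i])^o); apply/cvgrPdist_le => e e0.
have [re0 eE] := pos_complex e0; set e' := complex.Re e in re0 eE.
pose s := Num.min r (e' / C).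
have s0 : 0 < s%:C :> R[i] by rewrite ltcR lt_min r0 divr_gt0.
have sm : \forall h \near (0 : (R[i])^o)^', `|h| < s%:C by exact: dnbhs0_lt.
have nz : \forall h \near (0 : (R[i])^o)^', h != 0 by exact: nbhs_dnbhs_neq.
near=> h.
have hs : `|h| < s%:C by near: h.
have h0 : h != 0 by near: h.
move: hs; rewrite nrmE ltcR lt_min => /andP[hr he].
rewrite distrC nrmE eE lecR /GRing.scale /= mulr1.
have zz : h + z0 - z0 = h by rewrite addrK.
have := hf (h + z0); rewrite zz => /(_ _ hr); rewrite mulrC => hh.
have hz : h + z0 != z0 by rewrite -subr_eq0 zz.
apply: (le_trans (hh hz)); rewrite mulrC -ler_pdivlMr//; exact: ltW.
Unshelve. all: by end_near. Qed.

(** Every cone is enlarged once, so that the values of the inverse at points near z, and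
   these points themselves, stay where the estimates hold. *)
Lemma local_inverse_is_F_inverse : is_F_inverse mu H.
Proof.
move=> eta eta0; have eta1 : 0 < 2 * eta + 1 by lra.
have [M1 M10 hM1] := local_inverseP mu eta1.
have M20 : 0 < 2 * M1 by lra.
have M21 : 2 * M1 / 2 = M1 by field.
exists (2 * M1) => //.
have sub z : Gamma_cone eta (2 * M1) z -> in_cone eta (2 * M1) z.
  by move=> [h1 h2]; split => //; exact: ltW.
have spec z u : Gamma_cone eta (2 * M1) z -> nrm (u - z) <= complex.Im z / 2 ->
    [/\ complex.Im z / 4 <= complex.Im (H u), F (H u) = u, G (H u) != 0 &
      complex.Im (F (H u) - H u) / complex.Im (H u) <= 1 / 8].
  move=> /sub cz uz; have [cu u1 u2] := cone_ball eta0 cz (ltW M20) uz; rewrite M21 in cu.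
  have [h1 h2 h3 h4] := hM1 u cu; split => //.
  have [_ u3 _] := cone_ball eta1 cu (ltW M10) h1.
  by lra.
have self z : Gamma_cone eta (2 * M1) z -> nrm (z - z) <= complex.Im z / 2.
  by move=> [h1 _]; rewrite subrr nrm0; lra.
split.
- move=> z0 cz; have [Mz _] := cz.
  have y4 : 0 < complex.Im z0 / 4 by lra.
  have [i0 F0 G0 e0] := spec z0 z0 cz (self z0 cz).
  have [d [C C0 hC]] := inverse_quotient y4 i0 F0 G0 e0.
  have r0 : 0 < complex.Im z0 / 2 by lra.
  apply: (derivable_of_bound (d := d) C0 r0) => z zz zr.
  have [i1 F1 G1 e1] := spec z0 z cz (ltW zr).
  exact: hC.
- move=> z cz; have [i0 _ _ _] := spec z z cz (self z cz).
  by have [Mz _] := cz; rewrite /upper_half_plane /=; lra.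
- by move=> z cz; have [_ F0 _ _] := spec z z cz (self z cz).
- move=> e e0; have [M2 M2pos hM2] := cone_F mu eta1 (divr_gt0 e0 (ltr0Sn R 1)).
  exists ((1 + eta) * (2 * M2)) => z cz.
  have M2' : 0 < 2 * M2 by lra.
  rewrite nrmE ltcR => hN.
  have zn : nrm z <= (1 + eta) * complex.Im z by apply: cone_nrm (ltW M20) (sub z cz).
  have Mz : 2 * M2 < complex.Im z by rewrite -(ltr_pM2l (x := 1 + eta)); lra.
  have cz2 : in_cone eta (2 * M2) z by split => //; have [_ h] := cz; exact: ltW.
  have cu1 : in_cone (2 * eta + 1) M1 z.
    by have [+ _ _] := cone_ball eta0 (sub z cz) (ltW M20) (self z cz); rewrite M21.
  have [h1 h2 _ _] := hM1 z cu1.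
  have [cw w1 w2] := cone_ball eta0 cz2 (ltW M2') h1.
  rewrite (_ : 2 * M2 / 2 = M2) in cw; last by field.
  have [_ hw] := hM2 _ cw; rewrite h2 in hw.
  have z0 : z != 0 by rewrite -nrm_gt0; apply: le_lt_trans hN; rewrite !mulr_ge0//; lra.
  have -> : H z / z - 1 = - ((z - H z) / z) by field.
  rewrite nrmE nrmN ltcR nrmM nrmV ltr_pdivrMr ?nrm_gt0//.
  have zi := le_trans (ler_norm _) (Im_le_nrm z).
  have : e / 2 * complex.Im (H z) <= e / 2 * (3 / 2 * complex.Im z) by apply: ler_wpM2l; lra.
  have : e * complex.Im z <= e * nrm z by rewrite ler_pM2l.
  have : 0 < e * nrm z by rewrite mulr_gt0// nrm_gt0.
  by lra.
Qed.

Lemma F_inverseP : is_F_inverse mu (F_inverse mu).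
Proof.
have ex : exists H, [set H | is_F_inverse mu H] H.
  by exists H; exact: local_inverse_is_F_inverse.
exact: (xgetPex (id : R[i] -> R[i]) ex).
Qed.

End inverse_exists.

(** * Asymptotic expansions *)

Section asymptotics.
Variable R : realType.
Implicit Types (u : R -> R[i]) (c : R[i]) (v : R -> R).

(** The epsilon form of [asymptotic_pinfty]. *)
Definition asymp u c v :=
  forall e : R, 0 < e -> \forall y \near +oo, nrm (u y - c * (v y)%:C) <= e * v y.

Lemma complex_cvg0 (f : R -> R[i]) :
  (f : R -> (R[i])^o) y @[y --> +oo] --> (0 : (R[i])^o) <->
  forall e : R, 0 < e -> \forall y \near +oo, nrm (f y) <= e.
Proof.
split=> [/cvgrPdist_le h e e0|h].
  have := h e%:C; rewrite ltcR => /(_ e0); apply: filterS => y.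
  by rewrite sub0r normrN nrmE lecR.
apply/cvgrPdist_le => e /pos_complex [e0 eE]; rewrite eE.
apply: filterS (h _ e0) => y.
by rewrite sub0r normrN nrmE lecR.
Qed.

Lemma asymptoticP u c v : c != 0 -> (\forall y \near +oo, 0 < v y) ->
  asymptotic_pinfty u c v <-> asymp u c v.
Proof.
move=> c0 v0; have nc : 0 < nrm c by rewrite nrm_gt0.
split=> [[eps /complex_cvg0 he hu] e e0|hu].
  have h := he _ (divr_gt0 e0 nc); near=> y.
  have vy : 0 < v y by near: y.
  have -> : u y = c * (v y)%:C * (1 + eps y) by near: y.
  rewrite mulrDr mulr1 addrAC subrr add0r !nrmM nrm_real (gtr0_norm vy).
  rewrite mulrAC; apply: ler_wpM2r; first exact: ltW.
  by rewrite mulrC -ler_pdivlMr//; near: y.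
exists (fun y => u y / (c * (v y)%:C) - 1).
  apply/complex_cvg0 => e e0; near=> y.
  have vy : 0 < v y by near: y.
  have cv : c * (v y)%:C != 0 by rewrite mulf_neq0// -nrm_gt0 nrm_real normr_gt0 lt0r_neq0.
  rewrite -{1}(divff cv) -mulrBl.
  rewrite nrmM nrmV ler_pdivrMr ?nrm_gt0// nrmM nrm_real (gtr0_norm vy) mulrA.
  by near: y; apply: hu; rewrite mulr_gt0.
near=> y.
have vy : 0 < v y by near: y.
have cv : c * (v y)%:C != 0 by rewrite mulf_neq0// -nrm_gt0 nrm_real normr_gt0 lt0r_neq0.
by rewrite addrC subrK mulrC divfK.
Unshelve. all: by end_near. Qed.

Lemma asymp_near u w c v : (\forall y \near +oo, u y = w y) -> asymp u c v -> asymp w c v.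
Proof. by move=> uw hu e e0; near=> y; have <- : u y = w y; near: y => //; exact: hu.
Unshelve. all: by end_near. Qed.

Lemma asymp_scale u c v (s : R -> R) : (\forall y \near +oo, 0 < s y) ->
  asymp u c v -> asymp (fun y => (s y)%:C * u y) c (fun y => s y * v y).
Proof.
move=> s0 hu e e0; near=> y; have sy : 0 < s y by near: y.
rewrite rmorphM mulrCA -mulrBr nrmM nrm_real (gtr0_norm sy) mulrCA ler_pM2l//.
by near: y; exact: hu.
Unshelve. all: by end_near. Qed.

Lemma asympN u c v : asymp u c v -> asymp (fun y => - u y) (- c) v.
Proof.
move=> hu e e0; apply: filterS (hu e e0) => y.
by rewrite mulNr -opprD nrmN.
Qed.

Lemma asymp_mul u k c v : (\forall y \near +oo, 0 < v y) ->
  (forall e : R, 0 < e -> \forall y \near +oo, nrm (k y - 1) <= e) ->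
  asymp u c v -> asymp (fun y => u y * k y) c v.
Proof.
move=> v0 hk hu e e0.
have nc : 0 < nrm c + 1 by rewrite ltr_wpDl// nrm_ge0.
have h1 := hu 1 ltr01.
have h2 := hu _ (divr_gt0 e0 (ltr0Sn R 1)).
have h3 := hk _ (divr_gt0 (divr_gt0 e0 (ltr0Sn R 1)) nc).
near=> y; have vy : 0 < v y by near: y.
have e1 : nrm (u y - c * (v y)%:C) <= 1 * v y by near: y.
have e2 : nrm (u y - c * (v y)%:C) <= e / 2 * v y by near: y.
have e3 : nrm (k y - 1) <= e / 2 / (nrm c + 1) by near: y.
have un : nrm (u y) <= (nrm c + 1) * v y.
  have := nrmD (u y - c * (v y)%:C) (c * (v y)%:C).
  by rewrite subrK nrmM nrm_real (gtr0_norm vy); lra.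
rewrite (_ : _ - _ = u y * (k y - 1) + (u y - c * (v y)%:C)); last by ring.
apply: (le_trans (nrmD _ _)); rewrite nrmM.
have : nrm (u y) * nrm (k y - 1) <= (nrm c + 1) * v y * (e / 2 / (nrm c + 1)).
  by apply: ler_pM; rewrite ?nrm_ge0.
rewrite (_ : (nrm c + 1) * v y * (e / 2 / (nrm c + 1)) = e / 2 * v y); last first.
  by field; rewrite lt0r_neq0.
by lra.
Unshelve. all: by end_near. Qed.

(** Values of a Nevanlinna function at hyperbolically close points are close, relative
    to their imaginary parts; hence one asymptotic expansion implies the other. *)
Lemma asymp_transfer (a b : R -> R[i]) c v : (\forall y \near +oo, 0 < v y) ->
  (forall e : R, 0 < e -> \forall y \near +oo,
     nrm (b y - a y) <= e * (complex.Im (a y) + complex.Im (b y))) ->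
  asymp a c v -> asymp b c v.
Proof.
move=> v0 hab ha e e0.
have nc : 0 < nrm c + 1 by rewrite ltr_wpDl// nrm_ge0.
pose d := Num.min (1 / 2) (e / 2 / (4 * (nrm c + 1))).
have d0 : 0 < d by rewrite lt_min !divr_gt0// mulr_gt0.
have h1 := ha 1 ltr01; have h2 := ha _ (divr_gt0 e0 (ltr0Sn R 1)); have h3 := hab d d0.
near=> y; have vy : 0 < v y by near: y.
have e1 : nrm (a y - c * (v y)%:C) <= 1 * v y by near: y.
have e2 : nrm (a y - c * (v y)%:C) <= e / 2 * v y by near: y.
have e3 : nrm (b y - a y) <= d * (complex.Im (a y) + complex.Im (b y)) by near: y.
have an : nrm (a y) <= (nrm c + 1) * v y.
  have := nrmD (a y - c * (v y)%:C) (c * (v y)%:C).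
  by rewrite subrK nrmM nrm_real (gtr0_norm vy); lra.
have ia := le_trans (ler_norm _) (Im_le_nrm (a y)).
have ib := le_trans (ler_norm _) (Im_le_nrm (b y - a y)); rewrite cImD cImN in ib.
have d2 : d <= 1 / 2 by rewrite ge_min lexx.
have dE : d <= e / 2 / (4 * (nrm c + 1)) by rewrite ge_min lexx orbT.
have na := nrm_ge0 (a y); have nba := nrm_ge0 (b y - a y).
have sum : complex.Im (a y) + complex.Im (b y) <= 4 * nrm (a y).
  have s0 : 0 <= complex.Im (a y) + complex.Im (b y).
    by rewrite -(ler_pM2l d0) mulr0; apply: le_trans e3.
  have : d * (complex.Im (a y) + complex.Im (b y)) <= 1 / 2 * (complex.Im (a y) + complex.Im (b y)).
    exact: ler_wpM2r.
  by lra.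
have step : nrm (b y - a y) <= e / 2 * v y.
  apply: (le_trans e3); apply: (@le_trans _ _ (d * (4 * ((nrm c + 1) * v y)))).
    by rewrite ler_pM2l//; lra.
  apply: (@le_trans _ _ (e / 2 / (4 * (nrm c + 1)) * (4 * ((nrm c + 1) * v y)))).
    by apply: ler_wpM2r dE; rewrite !mulr_ge0// ltW.
  by rewrite (_ : _ * (4 * _) = e / 2 * v y)//; field; rewrite lt0r_neq0.
rewrite (_ : _ - _ = (b y - a y) + (a y - c * (v y)%:C)); last by ring.
by have := nrmD (b y - a y) (a y - c * (v y)%:C); lra.
Unshelve. all: by end_near. Qed.

End asymptotics.

(** * Transforms on the imaginary axis *)

Section transforms_on_axis.
Variables (R : realType) (mu : probability (measurableTypeR R) R).
Local Notation G := (cauchy_transform mu).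
Local Notation F := (F_transform mu).
Local Notation iy y := ('i%C * y%:C).

Lemma Re_iy (y : R) : complex.Re (iy y) = 0.
Proof. by rewrite cReM /= mul0r mulr0 subr0. Qed.

Lemma Im_iy (y : R) : complex.Im (iy y) = y.
Proof. by rewrite cImM /= mul0r mul1r add0r. Qed.

Lemma nrm_iy (y : R) : 0 < y -> nrm (iy y) = y.
Proof. by move=> y0; rewrite nrmM nrmi nrm_real mul1r gtr0_norm. Qed.

Lemma iy_neq0 (y : R) : 0 < y -> iy y != 0 :> R[i].
Proof. by move=> y0; rewrite -nrm_gt0 nrm_iy. Qed.

Lemma sqr_iy (y : R) : (iy y) ^+ 2 = - (y ^+ 2)%:C :> R[i].
Proof. by rewrite exprMn sqr_i mulN1r rmorphXn. Qed.

Lemma iyG_cvg1 (e : R) : 0 < e -> \forall y \near +oo, nrm (iy y * G (iy y) - 1) <= e.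
Proof.
move=> e0; have [M M0 hM] := cone_zG mu ltr01 e0.
near=> y; apply: hM; split; rewrite ?Re_iy Im_iy.
  by near: y; exact: near_pinfty_gt.
by rewrite normr0 mul1r ltW//; near: y; exact: near_pinfty_gt.
Unshelve. all: by end_near. Qed.

Lemma G_iy_neq0 : \forall y \near +oo, G (iy y) != 0.
Proof.
have h : 0 < 1 / 2 :> R by lra.
apply: filterS (iyG_cvg1 h) => y; apply: contraTneq => ->.
by rewrite mulr0 sub0r nrmN nrm1 -ltNge; lra.
Qed.

Lemma cauchy_axis (y : R) : 0 < y ->
  G (iy y) - (iy y)^-1 = (- (stieltjes_lin mu y / y)) +i* (stieltjes_sq mu y / y).
Proof.
move=> y0; have yi : 0 < complex.Im (iy y) by rewrite Im_iy.
have [b1 b2] := cbmeas_resolvent yi.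
have inv : (iy y)^-1 = 0 +i* (- y^-1).
  by apply: complex_ext; rewrite ?cReV ?cImV Re_iy Im_iy /= ?mul0r// expr0n add0r; field; rewrite lt0r_neq0.
have ReG : complex.Re (G (iy y)) = - (stieltjes_lin mu y / y).
  rewrite (_ : - (_ / y) = (- y^-1) * stieltjes_lin mu y); last by ring.
  rewrite /stieltjes_lin -meanZ; last exact: bmeas_lin.
  change (mean mu (fun t => complex.Re (resolvent (iy y) t)) =
    mean mu (fun t => - y^-1 * (y * t / (t ^+ 2 + y ^+ 2)))).
  congr mean; apply/funext => t; rewrite Re_resolvent Re_iy Im_iy sub0r sqrrN.
  by field; rewrite !lt0r_neq0// sq_den_gt0.
have ImG : complex.Im (G (iy y)) = stieltjes_sq mu y / y - y^-1.
  rewrite (_ : _ / y = y^-1 * stieltjes_sq mu y); last by ring.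
  rewrite -[X in _ - X](mean_cst mu) /stieltjes_sq -meanZ; last exact: bmeas_sq.
  rewrite -meanB; [|by apply: bmeasM; [exact: bmeas_cst|exact: bmeas_sq]|exact: bmeas_cst].
  change (mean mu (fun t => complex.Im (resolvent (iy y) t)) =
    mean mu (fun t => y^-1 * (t ^+ 2 / (t ^+ 2 + y ^+ 2)) - y^-1)).
  congr mean; apply/funext => t; rewrite Im_resolvent Re_iy Im_iy sub0r sqrrN.
  by field; rewrite !lt0r_neq0// sq_den_gt0.
rewrite inv; apply: complex_ext; rewrite ?cReD ?cImD ?cReN ?cImN ?ReG ?ImG /=; ring.
Qed.

Lemma cauchy_F_axis (y : R) : 0 < y -> G (iy y) != 0 ->
  (y ^+ 2)%:C * (G (iy y) - (iy y)^-1) = (F (iy y) - iy y) * (iy y * G (iy y)).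
Proof.
move=> y0 G0; have i0 := iy_neq0 y0.
rewrite -[(y ^+ 2)%:C]opprK -sqr_iy /F_transform; move: (iy y) i0 (G (iy y)) G0 => z z0 g g0.
by field; rewrite z0 g0.
Qed.

Lemma measurable_div_power (f : R -> R) n : (exists A : R, measurable_fun `]A, +oo[ f) ->
  exists A : R, measurable_fun `]A, +oo[ (fun y => f y / y ^+ n).
Proof.
move=> [A mf]; exists (Num.max A 0).
have m : measurable_fun `](Num.max A 0), +oo[ (fun y => f y * y `^ (- n%:R)).
  apply: measurable_funM; last by apply: measurable_funTS; exact: (measurable_powR (- n%:R)).
  apply: measurable_funS mf => //.
  by move=> y /=; rewrite !in_itv/= !andbT gt_max => /andP[].
apply: eq_measurable_fun m => y; rewrite inE /= in_itv /= andbT gt_max => /andP[_ y0].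
by rewrite powR_invn// ltW.
Qed.

Lemma measurable_stieltjes : exists A : R,
  measurable_fun `]A, +oo[ (fun y => stieltjes_sq mu y / y).
Proof.
pose m (y : R) := Num.max y 0 ^+ 2 * stieltjes_sq mu (Num.max y 0).
have mm : measurable_fun [set: R] m.
  apply: nondecreasing_measurable => // x y xy; rewrite /m.
  have [x0|] := boolP (0 < x); last rewrite -leNgt => x0.
    rewrite (max_l (ltW x0)) max_l; last by lra.
    exact: stieltjes_sq_mono.
  rewrite (max_r x0) expr0n mul0r mulr_ge0 ?sqr_ge0//.
  by apply: Rintegral_ge0 => t _; rewrite divr_ge0 ?addr_ge0 ?sqr_ge0.
have [A mA] : exists A : R, measurable_fun `]A, +oo[ (fun y => m y / y ^+ 3).
  by apply: measurable_div_power; exists 0; exact: measurable_funTS.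
exists (Num.max A 0).
have m2 : measurable_fun `](Num.max A 0), +oo[ (fun y => m y / y ^+ 3).
  apply: measurable_funS mA => //.
  by move=> y /=; rewrite !in_itv/= !andbT gt_max => /andP[].
apply: eq_measurable_fun m2 => y; rewrite inE /= in_itv /= andbT gt_max => /andP[_ y0].
by rewrite /m max_l ?ltW//; field; rewrite lt0r_neq0.
Qed.

End transforms_on_axis.

(** * The equivalences *)

Section final.
Variables (R : realType) (mu : probability (measurableTypeR R) R) (alpha theta : R).
Hypotheses (alpha01 : 0 < alpha < 1) (theta1 : -1 <= theta <= 1).
Local Notation tau := (tan (pi * alpha / 2)).
Local Notation G := (cauchy_transform mu).
Local Notation F := (F_transform mu).
Local Notation A := (stieltjes_sq mu).
Local Notation B := (stieltjes_lin mu).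
Local Notation iy y := ('i%C * y%:C).

(** Its imaginary part is 1: the size of the expansions is read off imaginary parts. *)
Definition direction : R[i] := 'i%C - (theta * tau)%:C.
Local Notation c := direction.

Lemma Im_direction : complex.Im c = 1.
Proof. by rewrite /direction cImD cImN /= subr0. Qed.

Lemma Re_direction : complex.Re c = - (theta * tau).
Proof. by rewrite /direction cReD cReN /= sub0r. Qed.

Lemma direction_neq0 : c != 0.
Proof. by apply/eqP => c0; have := Im_direction; rewrite c0 /=; lra. Qed.

Definition cauchy_condition := exists2 f : R -> R, regularly_varying (- alpha - 1) f &
  asymptotic_pinfty (fun y => G (iy y) - (iy y)^-1) c f.

Definition voiculescu_condition := exists2 g : R -> R, regularly_varying (1 - alpha) g &
  asymptotic_pinfty (fun y => voiculescu_transform mu (iy y)) (- c) g.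

Lemma stieltjes_cauchy : stieltjes_varies mu alpha theta -> cauchy_condition.
Proof.
move=> [AV BA]; have [A0 _] := AV.
have VV : varies (- alpha - 1) (fun y => A y / y).
  by have := varies_power 1 AV; under eq_fun do rewrite expr1.
exists (fun y => A y / y).
  by apply: varies_regularly_varying VV; exact: measurable_stieltjes.
have [v0 _] := VV.
apply/(asymptoticP _ direction_neq0 v0) => e e0.
have /cvgrPdist_le /(_ _ e0) h := BA.
near=> y; have y0 : 0 < y by near: y; exact: near_pinfty_gt.
have Ay : 0 < A y by near: y.
have hy : `|theta * tau - B y / A y| <= e by near: y.
rewrite cauchy_axis//.
apply: (le_trans (nrm_le_ReIm _)).
rewrite cReD cReN cImD cImN cReM cImM Re_direction Im_direction /=.
rewrite !mulr0 mul1r add0r subrr normr0 addr0 subr0.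
rewrite (_ : - (B y / y) - _ = (theta * tau - B y / A y) * (A y / y)); last first.
  by field; rewrite !lt0r_neq0.
rewrite normrM (gtr0_norm (x := A y / y)) ?divr_gt0//.
by rewrite ler_wpM2r// divr_ge0 ?ltW.
Unshelve. all: by end_near. Qed.

Lemma cauchy_stieltjes : cauchy_condition -> stieltjes_varies mu alpha theta.
Proof.
move=> [f /regularly_varying_varies fV]; have [f0 _] := fV.
move=> /(asymptoticP _ direction_neq0 f0) hf.
have comp (e : R) : 0 < e -> \forall y \near +oo,
    `|1 - A y / y / f y| <= e /\ `|theta * tau - B y / y / f y| <= e.
  move=> e0; have h := hf e e0; near=> y.
  have y0 : 0 < y by near: y; exact: near_pinfty_gt.
  have fy : 0 < f y by near: y.
  have : nrm (G (iy y) - (iy y)^-1 - c * (f y)%:C) <= e * f y by near: y.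
  rewrite cauchy_axis// => hy.
  have := le_trans (Re_le_nrm _) hy; have := le_trans (Im_le_nrm _) hy.
  rewrite cReD cReN cImD cImN cReM cImM Re_direction Im_direction /=.
  rewrite !mulr0 mul1r add0r subr0 => h1 h2.
  have q (x : R) : `|x / f y| <= e = (`|x| <= e * f y).
    by rewrite normrM normfV (gtr0_norm fy) ler_pdivrMr.
  split.
    rewrite (_ : 1 - _ = - ((A y / y - f y) / f y)); last by field; rewrite !lt0r_neq0.
    by rewrite normrN q.
  rewrite (_ : _ - _ = (- (B y / y) - - (theta * tau) * f y) / f y); last by field; rewrite !lt0r_neq0.
  by rewrite q.
have Af : A y / y / f y @[y --> +oo] --> (1 : R).
  by apply/cvgrPdist_le => e e0; apply: filterS (comp e e0) => y [].
have Bf : B y / y / f y @[y --> +oo] --> theta * tau.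
  by apply/cvgrPdist_le => e e0; apply: filterS (comp e e0) => y [].
have AyV := varies_equiv fV Af ltr01.
have AV : varies (- alpha) A.
  have h := varies_powerM 1 AyV; have e : - alpha - 1 + 1%:R = - alpha by ring.
  rewrite e in h; apply: (varies_equiv (k := 1) h _ ltr01).
  have [h0 _] := h.
  apply: (@cvg_eq_near _ (fun=> 1)); last exact: cvg_cst.
  near=> y; have y0 : 0 < y by near: y; exact: near_pinfty_gt.
  have : 0 < y ^+ 1 * (A y / y) by near: y.
  rewrite expr1 mulrC divfK ?lt0r_neq0// => Ay.
  by rewrite mulfV// lt0r_neq0.
split => //; have [A0 _] := AV.
have h : (B y / y / f y) * (A y / y / f y)^-1 @[y --> +oo] --> theta * tau * 1^-1.
  by apply: cvgM => //; apply: cvgV => //; rewrite oner_neq0.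
rewrite invr1 mulr1 in h; apply: cvg_eq_near h; near=> y.
have y0 : 0 < y by near: y; exact: near_pinfty_gt.
have Ay : 0 < A y by near: y.
have fy : 0 < f y by near: y.
by field; rewrite !lt0r_neq0.
Unshelve. all: by end_near. Qed.

Lemma Im_F_ge0 (z : R[i]) : 0 < complex.Im z -> G z != 0 -> 0 <= complex.Im (F z - z).
Proof.
move=> z0 Gz; rewrite Im_F// mulr_ge0 ?(ltW z0)//.
by apply: Rintegral_ge0 => t _; rewrite sqr_ge0.
Qed.

Local Notation W y := (F_inverse mu (iy y)).

(** At z = F (W y) the Voiculescu transform F^-1(z) - z is W y - F (W y). *)
Lemma voiculescu_F : \forall y \near +oo,
  voiculescu_transform mu (iy y) = - (F (W y) - W y).
Proof.
have [M M0 [_ _ FW _]] := F_inverseP mu ltr01.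
near=> y; rewrite /voiculescu_transform FW ?opprB//.
have My : M < y by near: y; exact: near_pinfty_gt.
by split; rewrite ?Re_iy Im_iy// normr0 mul1r; lra.
Unshelve. all: by end_near. Qed.

(** Since F^-1(iy) / (iy) tends to 1, the points iy and F^-1(iy) are hyperbolically close. *)
Lemma F_close (e : R) : 0 < e -> \forall y \near +oo,
  nrm ((F (W y) - W y) - (F (iy y) - iy y)) <=
  e * (complex.Im (F (iy y) - iy y) + complex.Im (F (W y) - W y)).
Proof.
move=> e0; have [M M0 [_ Wim FW Wlim]] := F_inverseP mu ltr01.
pose d := Num.min (1 / 2) (e / 2).
have d0 : 0 < d by rewrite lt_min !divr_gt0.
(* d <= 1/2 ensures Im (W y) >= y / 2, and d <= e / 2 gives the final bound. *)
have [N hN] := Wlim d d0.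
near=> y.
have y0 : 0 < y by near: y; exact: near_pinfty_gt.
have My : M < y by near: y; exact: near_pinfty_gt.
have Ny : N < y by near: y; exact: near_pinfty_gt.
have G0 : G (iy y) != 0 by near: y; exact: G_iy_neq0.
have cone : Gamma_cone 1 M (iy y) by split; rewrite ?Re_iy Im_iy// normr0 mul1r.
have wy : nrm (W y - iy y) <= d * y.
  have := hN _ cone; rewrite nrmE nrm_iy// ltcR => /(_ Ny); rewrite nrmE ltcR => h.
  have factor (a b : R[i]) : b != 0 -> a - b = b * (a / b - 1) by move=> b0; field.
  rewrite (factor _ _ (iy_neq0 y0)).
  by rewrite nrmM nrm_iy// mulrC ler_wpM2r// ltW.
have FWy := FW _ cone; have Wi : 0 < complex.Im (W y) := Wim _ cone.
have GW : G (W y) != 0.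
  by move: FWy; apply: contra_eqN => /eqP h; rewrite /F_transform h invr0 eq_sym iy_neq0.
have yi : 0 < complex.Im (iy y) by rewrite Im_iy.
have iW : y / 2 <= complex.Im (W y).
  have := le_trans (Im_le_nrm _) wy; rewrite cImD cImN Im_iy ler_norml => /andP[h _].
  have : d * y <= 1 / 2 * y by rewrite ler_pM2r// ge_min lexx.
  by lra.
apply: (le_trans (F_schwarz_pick Wi yi GW G0)); rewrite Im_iy.
have p1 := Im_F_ge0 yi G0; have p2 := Im_F_ge0 Wi GW.
move: p1 p2; set a := complex.Im (F (iy y) - iy y); set b := complex.Im (F (W y) - W y) => p1 p2.
have h1 : b / complex.Im (W y) <= 2 * b / y.
  rewrite ler_pdivrMr// mulrAC ler_pdivlMr//.
  by have := ler_wpM2l p2 iW; lra.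
have h2 : 0 <= a / y by rewrite divr_ge0// ltW.
have h3 : 0 <= b / complex.Im (W y) by rewrite divr_ge0// ltW.
apply: (@le_trans _ _ (d * y * (2 * b / y + a / y))).
  by apply: (ler_pM (nrm_ge0 _) (addr_ge0 h3 h2) wy); rewrite lerD2r.
rewrite (_ : d * y * _ = d * (2 * b + a)); last by field; rewrite lt0r_neq0.
have : d <= e / 2 by rewrite ge_min lexx orbT.
have s : 0 <= 2 * b + a by lra.
by move=> /(ler_wpM2r s); have : 0 <= e * a; [rewrite mulr_ge0// ltW | lra].
Unshelve. all: by end_near. Qed.

Lemma F_close_sym (e : R) : 0 < e -> \forall y \near +oo,
  nrm ((F (iy y) - iy y) - (F (W y) - W y)) <=
  e * (complex.Im (F (W y) - W y) + complex.Im (F (iy y) - iy y)).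
Proof. by move=> e0; apply: filterS (F_close e0) => y; rewrite nrm_distC [X in e * X]addrC. Qed.

Lemma asymp_voiculescu (g : R -> R) : (\forall y \near +oo, 0 < g y) ->
  asymptotic_pinfty (fun y => voiculescu_transform mu (iy y)) (- c) g <->
  asymp (fun y => F (iy y) - iy y) c g.
Proof.
move=> g0; have nc : - c != 0 by rewrite oppr_eq0 direction_neq0.
rewrite (asymptoticP _ nc g0); split => h.
  apply: (asymp_transfer g0 F_close_sym).
  rewrite -(opprK c); apply: asymp_near (asympN h).
  by apply: filterS voiculescu_F => y ->; rewrite opprK.
apply: asymp_near (asympN (asymp_transfer g0 F_close h)).
by apply: filterS voiculescu_F => y ->.
Qed.

Lemma iyG_inv_cvg1 (e : R) : 0 < e -> \forall y \near +oo, nrm ((iy y * G (iy y))^-1 - 1) <= e.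
Proof.
move=> e0; pose d := Num.min (1 / 2) (e / 2).
have d0 : 0 < d by rewrite lt_min !divr_gt0.
apply: filterS (iyG_cvg1 mu d0) => y; set k := _ * _ => hk.
have h1 : nrm (k - 1) <= 1 / 2 by apply: (le_trans hk); rewrite ge_min lexx.
have h2 : nrm (k - 1) <= e / 2 by apply: (le_trans hk); rewrite ge_min lexx orbT.
have nk : 1 / 2 <= nrm k.
  by have := nrmB k (k - 1); rewrite (_ : k - (k - 1) = 1) ?nrm1; [lra | ring].
have k0 : k != 0 by rewrite -nrm_gt0; lra.
rewrite (_ : k^-1 - 1 = - ((k - 1) / k)); last by field.
rewrite nrmN nrmM nrmV ler_pdivrMr; last by lra.
have : e * (1 / 2) <= e * nrm k by rewrite ler_pM2l.
by lra.
Qed.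

(** y^2 (G - 1/(iy)) = (F - iy) (iy G) on the axis, and iy G(iy) tends to 1. *)
Lemma asymp_cauchy (f : R -> R) : (\forall y \near +oo, 0 < f y) ->
  asymp (fun y => G (iy y) - (iy y)^-1) c f <->
  asymp (fun y => F (iy y) - iy y) c (fun y => y ^+ 2 * f y).
Proof.
move=> f0; have s0 : \forall y \near +oo, 0 < (y : R) ^+ 2.
  by apply: filterS (near_pinfty_gt 0) => y y0; rewrite exprn_gt0.
have g0 : \forall y \near +oo, 0 < y ^+ 2 * f y.
  by near=> y; rewrite mulr_gt0//; near: y.
have rel : \forall y \near +oo, (y ^+ 2)%:C * (G (iy y) - (iy y)^-1) =
    (F (iy y) - iy y) * (iy y * G (iy y)).
  near=> y; apply: cauchy_F_axis; first by near: y; exact: near_pinfty_gt.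
  by near: y; exact: G_iy_neq0.
split => h.
  have := asymp_mul g0 iyG_inv_cvg1 (asymp_scale s0 h); apply: asymp_near.
  near=> y; have -> : (y ^+ 2)%:C * (G (iy y) - (iy y)^-1) =
    (F (iy y) - iy y) * (iy y * G (iy y)) by near: y.
  rewrite mulfK// mulf_neq0//; first by rewrite iy_neq0//; near: y; exact: near_pinfty_gt.
  by near: y; exact: G_iy_neq0.
have h1 := asymp_mul g0 (iyG_cvg1 mu) h.
have s1 : \forall y \near +oo, 0 < ((y : R) ^+ 2)^-1.
  by apply: filterS s0 => y; rewrite invr_gt0.
have h2 := asymp_scale s1 h1.
move=> e e0; have h3 := h2 e e0; near=> y.
have y0 : 0 < y by near: y; exact: near_pinfty_gt.
have y2 : y ^+ 2 != 0 by rewrite expf_neq0// lt0r_neq0.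
have : nrm (((y ^+ 2)^-1)%:C * ((F (iy y) - iy y) * (iy y * G (iy y))) -
  c * ((y ^+ 2)^-1 * (y ^+ 2 * f y))%:C) <= e * ((y ^+ 2)^-1 * (y ^+ 2 * f y)) by near: y.
rewrite mulKf//.
have <- : (y ^+ 2)%:C * (G (iy y) - (iy y)^-1) = (F (iy y) - iy y) * (iy y * G (iy y)) by near: y.
by rewrite mulrA -rmorphM mulVf// mul1r.
Unshelve. all: by end_near. Qed.

Lemma cauchy_voiculescu : cauchy_condition -> voiculescu_condition.
Proof.
move=> [f fR]; have fV := regularly_varying_varies fR; have [f0 _] := fV.
move=> /(asymptoticP _ direction_neq0 f0) hf.
have gV : varies (1 - alpha) (fun y => y ^+ 2 * f y).
  by have := varies_powerM 2 fV; rewrite (_ : - alpha - 1 + 2%:R = 1 - alpha); last by ring.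
have [g0 _] := gV.
exists (fun y => y ^+ 2 * f y).
  apply: varies_regularly_varying gV; have [[K [mf _]] _] := fR.
  by exists K; apply: measurable_funM => //; apply: measurable_funX.
by apply/(asymp_voiculescu g0); apply/(asymp_cauchy f0).
Qed.

Lemma voiculescu_cauchy : voiculescu_condition -> cauchy_condition.
Proof.
move=> [g gR]; have gV := regularly_varying_varies gR; have [g0 _] := gV.
move=> /(asymp_voiculescu g0) hg.
have fV : varies (- alpha - 1) (fun y => g y / y ^+ 2).
  by have := varies_power 2 gV; rewrite (_ : 1 - alpha - 2%:R = - alpha - 1); last by ring.
have [f0 _] := fV.
exists (fun y => g y / y ^+ 2).
  apply: varies_regularly_varying fV; have [[K [mg _]] _] := gR.
  by apply: measurable_div_power; exists K.
apply/(asymptoticP _ direction_neq0 f0); apply/(asymp_cauchy f0) => e e0.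
have h := hg e e0; near=> y.
have y0 : 0 < y by near: y; exact: near_pinfty_gt.
by rewrite /= (mulrC (y ^+ 2)) divfK ?expf_neq0 ?lt0r_neq0//; near: y.
Unshelve. all: by end_near. Qed.

End final.

Unset Implicit Arguments.

Theorem proposition5p9 (R : realType) (alpha theta : R)
    (halpha : 0 < alpha < 1) (htheta : -1 <= theta <= 1)
    (mu : probability (measurableTypeR R) R) :
  [<-> class_C alpha theta mu;
       exists2 f : R -> R, regularly_varying (- alpha - 1) f &
         asymptotic_pinfty
           (fun y => cauchy_transform mu ('i%C * y%:C) - ('i%C * y%:C)^-1)
           ('i%C - (theta * tan (pi * alpha / 2))%:C) f;
       exists2 g : R -> R, regularly_varying (1 - alpha) g &
         asymptotic_pinfty
           (fun y => voiculescu_transform mu ('i%C * y%:C))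
           (- ('i%C - (theta * tan (pi * alpha / 2))%:C)) g].
Proof.
tfae.
- by move=> /(class_C_stieltjes halpha htheta) /stieltjes_cauchy.
- exact: cauchy_voiculescu.
- by move=> /voiculescu_cauchy /cauchy_stieltjes /(stieltjes_class_C halpha htheta).
Qed.
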